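(* Consider functions $(\lambda_1,\lambda_2,\lambda_3)\mapsto \mathcal{T}_{\lambda_1,\lambda_2,\lambda_3}\in K=\mathbb{Q}((q^{-1/2}))$ on triples of partitions, and the following system of equations, required to hold for all triples of partitions $(\lambda_1,\lambda_2,\lambda_3)$: \begin{align*} (R^3_2)\quad s_{\square}(q^{\lambda_1+\rho})\,\mathcal{T}_{\lambda_1,\lambda_2,\lambda_3} &= \sum_{\beta_2\in\lambda_2-\square} q^{(\kappa(\beta_2)-\kappa(\lambda_2))/2}\,\mathcal{T}_{\lambda_1,\beta_2,\lambda_3}-\sum_{\gamma_3\in\lambda_3+\square}\mathcal{T}_{\lambda_1,\lambda_2,\gamma_3},\\ (R^1_3)\quad s_{\square}(q^{\lambda_2+\rho})\,\mathcal{T}_{\lambda_1,\lambda_2,\lambda_3} &= \sum_{\beta_3\in\lambda_3-\square} q^{(\kappa(\beta_3)-\kappa(\lambda_3))/2}\,\mathcal{T}_{\lambda_1,\lambda_2,\beta_3}-\sum_{\gamma_1\in\lambda_1+\square}\mathcal{T}_{\gamma_1,\lambda_2,\lambda_3},\\ (R^2_1)\quad s_{\square}(q^{\lambda_3+\rho})\,\mathcal{T}_{\lambda_1,\lambda_2,\lambda_3} &= \sum_{\beta_1\in\lambda_1-\square} q^{(\kappa(\beta_1)-\kappa(\lambda_1))/2}\,\mathcal{T}_{\beta_1,\lambda_2,\lambda_3}-\sum_{\gamma_2\in\lambda_2+\square}\mathcal{T}_{\lambda_1,\gamma_2,\lambda_3},\\ (R^3_1)\quad s_{\square}(q^{\lambda_2^t+\rho})\,\mathcal{T}_{\lambda_1,\lambda_2,\lambda_3}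 &= \sum_{\alpha_1\in\lambda_1-\square}\mathcal{T}_{\alpha_1,\lambda_2,\lambda_3}-\sum_{\gamma_3\in\lambda_3+\square} q^{(\kappa(\gamma_3)-\kappa(\lambda_3))/2}\,\mathcal{T}_{\lambda_1,\lambda_2,\gamma_3},\\ (R^1_2)\quad s_{\square}(q^{\lambda_3^t+\rho})\,\mathcal{T}_{\lambda_1,\lambda_2,\lambda_3} &= \sum_{\alpha_2\in\lambda_2-\square}\mathcal{T}_{\lambda_1,\alpha_2,\lambda_3}-\sum_{\gamma_1\in\lambda_1+\square} q^{(\kappa(\gamma_1)-\kappa(\lambda_1))/2}\,\mathcal{T}_{\gamma_1,\lambda_2,\lambda_3},\\ (R^2_3)\quad s_{\square}(q^{\lambda_1^t+\rho})\,\mathcal{T}_{\lambda_1,\lambda_2,\lambda_3} &= \sum_{\alpha_3\in\lambda_3-\square}\mathcal{T}_{\lambda_1,\lambda_2,\alpha_3}-\sum_{\gamma_2\in\lambda_2+\square} q^{(\kappa(\gamma_2)-\kappa(\lambda_2))/2}\,\mathcal{T}_{\lambda_1,\gamma_2,\lambda_3}. \end{align*} This system together with the initial condition $\mathcal{T}_{\emptyset,\emptyset,\emptyset}=1$ has a unique solution, namely $$\mathcal{T}_{\lambda_1,\lambda_2,\lambda_3}=(-1)^{|\lambda_1|+|\lambda_2|+|\lambda_3|}\,\mathcal{C}_{\lambda_1^t,\lambda_2^t,\lambda_3^t},$$ where $\mathcal{C}$ is the topological vertex.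
   Context: Partitions are identified with Young diagrams; $\lambda^t$ is the transpose, $|\lambda|$ the number of boxes, $\square$ the one-box partition, $\emptyset$ the empty partition. $\lambda+\square$ (resp. $\lambda-\square$) denotes the set of partitions whose diagram is obtained from that of $\lambda$ by adding (resp. removing) one box. $\kappa(\lambda):=2\sum_{(i,j)\in\lambda}(j-i)$, where $(i,j)$ denotes the box in row $i$, column $j$. $s_\lambda$ and $s_{\lambda/\eta}$ are Schur and skew Schur functions ($s_{\lambda/\eta}=0$ unless $\eta\subseteq\lambda$). Let $\rho=(-\tfrac12,-\tfrac32,-\tfrac52,\dots)$. For a partition $\mu$, $f(q^{\mu+\rho})$ denotes the symmetric function $f$ evaluated at the infinite list of variables $q^{\mu_i-i+1/2}$, $i=1,2,\dots$ (with $\mu_i=0$ for $i$ large); this converges in $K=\mathbb{Q}((q^{-1/2}))$ and is the expansion of a rational function of $q^{1/2}$. For example $s_\square(q^{\mu+\rho})=(q^{1/2}-q^{-1/2})\sum_{(i,j)\in\mu}q^{j-i}+\frac{1}{q^{1/2}-q^{-1/2}}$. Also $q^\rho:=q^{\emptyset+\rho}$. The topological vertex is $$\mathcal{C}_{\lambda_1,\lambda_2,\lambda_3}:=q^{\kappa(\lambda_2)/2+\kappa(\lambda_3)/2}\,s_{\lambda_2^t}(q^\rho)\sum_\eta s_{\lambda_3^t/\eta}(q^{\lambda_2+\rho})\,s_{\lambda_1/\eta}(q^{\lambda_2^t+\rho}),$$ the sum being over all partitions $\eta$. It is known that $\mathcal{C}$ is invariant under cyclic permutation of its three partitions, and that $\mathcal{C}_{\lambda_1,\lambda_2,\lambda_3}=q^{\sum_i\kappa(\lambda_i)/2}\,\mathcal{C}_{\lambda_3^t,\lambda_2^t,\lambda_1^t}$.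 *)

(* Defs.v *)
From HB Require Import structures.
From mathcomp Require Import all_boot all_order all_algebra.
From mathcomp Require Import boolp classical_sets functions cardinality fsbigop.

Set Implicit Arguments.
Unset Strict Implicit.
Unset Printing Implicit Defensive.

Import Order.TTheory GRing.Theory.
Local Open Scope ring_scope.

Section FormalPowerSeries.
Variable R : idomainType.

Record fps := Fps { fps_coef : nat -> R }.
Implicit Types f g h : fps.

Lemma fpsP f g : fps_coef f =1 fps_coef g -> f = g.
Proof. by case: f g => f [g] /= /funext ->. Qed.

HB.instance Definition _ := gen_eqMixin fps.
HB.instance Definition _ := gen_choiceMixin fps.

Definition fps_zero := Fps (fun=> 0).
Definition fps_opp f := Fps (fun n => - fps_coef f n).
Definition fps_add f g := Fps (fun n => fps_coef f n + fps_coef g n).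
Definition fps_one := Fps (fun n => (n == 0%N)%:R).
Definition fps_mul f g :=
  Fps (fun n => \sum_(i < n.+1) fps_coef f i * fps_coef g (n - i)%N).

Fact fps_addA : associative fps_add.
Proof. by move=> f g h; apply: fpsP => n /=; rewrite addrA. Qed.
Fact fps_addC : commutative fps_add.
Proof. by move=> f g; apply: fpsP => n /=; rewrite addrC. Qed.
Fact fps_add0 : left_id fps_zero fps_add.
Proof. by move=> f; apply: fpsP => n /=; rewrite add0r. Qed.
Fact fps_addN : left_inverse fps_zero fps_opp fps_add.
Proof. by move=> f; apply: fpsP => n /=; rewrite addNr. Qed.

HB.instance Definition _ :=
  GRing.isZmodule.Build fps fps_addA fps_addC fps_add0 fps_addN.

Let trunc n f : {poly R} := \poly_(i < n.+1) fps_coef f i.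

Let coef_trunc n f i : (i <= n)%N -> (trunc n f)`_i = fps_coef f i.
Proof. by move=> le_in; rewrite coef_poly ltnS le_in. Qed.

Let fps_mul_trunc n m f g : (m <= n)%N ->
  fps_coef (fps_mul f g) m = (trunc n f * trunc n g)`_m.
Proof.
move=> le_mn; rewrite coefM /=; apply: eq_bigr => i _.
have le_im : (i <= m)%N by rewrite -ltnS.
by rewrite !coef_trunc // (leq_trans _ le_mn) // leq_subr.
Qed.

Fact fps_mulC : commutative fps_mul.
Proof.
by move=> f g; apply: fpsP => n; rewrite !(@fps_mul_trunc n n) // mulrC.
Qed.

Let fps_mul_truncl n f g h :
  fps_coef (fps_mul (fps_mul f g) h) n = (trunc n f * trunc n g * trunc n h)`_n.
Proof.
rewrite [RHS]coefM [LHS]/=; apply: eq_bigr => i _.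
have le_in : (i <= n)%N by rewrite -ltnS.
by rewrite -(fps_mul_trunc _ _ le_in) coef_trunc ?leq_subr.
Qed.

Fact fps_mulA : associative fps_mul.
Proof.
move=> f g h; apply: fpsP => n.
by rewrite fps_mulC !fps_mul_truncl -[in RHS]mulrA [in RHS]mulrC.
Qed.

Fact fps_mul1 : left_id fps_one fps_mul.
Proof.
move=> f; apply: fpsP => n /=.
rewrite big_ord_recl /= mul1r subn0 big1 ?addr0 // => i _.
by rewrite /= mul0r.
Qed.

Fact fps_mulDl : left_distributive fps_mul fps_add.
Proof.
move=> f g h; apply: fpsP => n /=; rewrite -big_split.
by apply: eq_bigr => i _; rewrite mulrDl.
Qed.

Fact fps_one_neq0 : fps_one != 0.
Proof.
by apply/eqP => /(congr1 (fun f => fps_coef f 0)) /eqP; rewrite /= oner_eq0.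
Qed.

HB.instance Definition _ := GRing.Zmodule_isComNzRing.Build fps
  fps_mulA fps_mulC fps_mul1 fps_mulDl fps_one_neq0.

Definition fps_unit : pred fps := fun f => `[< exists g, g * f = 1 >].
Definition fps_inv f : fps := xget f [set g | g * f = 1]%classic.

Fact fps_mulVf : {in fps_unit, left_inverse 1 fps_inv *%R}.
Proof. by move=> f /asboolP[g gf1]; rewrite /fps_inv; case: xgetP => [h _ //|/(_ g)]. Qed.
Fact fps_unitP f g : g * f = 1 -> fps_unit f.
Proof. by move=> gf1; apply/asboolP; exists g. Qed.
Fact fps_inv_out : {in [predC fps_unit], fps_inv =1 id}.
Proof.
move=> f /negP nUf; rewrite /fps_inv; case: xgetP => // g _ gf1.
by case: nUf; apply: fps_unitP gf1.
Qed.

HB.instance Definition _ := GRing.ComNzRing_hasMulInverse.Build fps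
  fps_mulVf fps_unitP fps_inv_out.

Let fps_order f : f != 0 ->
  exists2 n, fps_coef f n != 0 & forall m, (m < n)%N -> fps_coef f m = 0.
Proof.
move=> f_neq0; have exf : exists n, fps_coef f n != 0.
  apply: contrapT => nex; case/eqP: f_neq0; apply: fpsP => n /=.
  by apply/eqP/negPn/negP => fn; apply: nex; exists n.
case: (ex_minnP exf) => n fn minn; exists n => // m lt_mn.
by apply/eqP; apply: contraLR lt_mn; rewrite -leqNgt; apply: minn.
Qed.

Fact fps_integral f g : f * g = 0 -> (f == 0) || (g == 0).
Proof.
move=> fg0; apply/norP => -[/fps_order[a fa ma] /fps_order[b gb mb]].
have := congr1 (fun h => fps_coef h (a + b)%N) fg0.
have lt_a : (a < (a + b).+1)%N by rewrite ltnS leq_addr.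
rewrite /= (bigD1 (Ordinal lt_a)) //= addKn big1 ?addr0 => [/eqP|i].
  by rewrite mulf_eq0 (negPf fa) (negPf gb).
rewrite -val_eqE /= neq_ltn => /orP[/ma -> | lt_ai]; first by rewrite mul0r.
have le_i : (i <= a + b)%N by rewrite -ltnS.
by rewrite mb ?mulr0 // ltn_subLR // ltn_add2r.
Qed.

HB.instance Definition _ := GRing.ComUnitRing_isIntegral.Build fps fps_integral.

Definition fpsX : fps := Fps (fun n => (n == 1%N)%:R).

End FormalPowerSeries.

(* Formal Laurent series in t = q^{-1/2}: Q((t)) = Frac Q[[t]]. *)
Definition K : fieldType := {fraction (fps rat)}.

Local Notation "x %:F" := (@FracField.tofrac _ x).

Definition tvar : K := (fpsX rat)%:F.

(* q^{1/2}.  Since the exponents of q in use are half-integers, q^{a/2} is    *)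
(* written qhalf ^ a with a : int.                                            *)
Definition qhalf : K := tvar^-1.

(* t-adic convergence: u N - l lies in t^m Q[[t]] for all N large enough. *)
Definition converges_to (u : nat -> K) (l : K) : Prop :=
  forall m : nat, exists N0 : nat, forall N : nat, (N0 <= N)%N ->
    exists f : fps rat, u N - l = tvar ^+ m * f%:F.

(* The limit of u, with junk value 0 if u diverges. *)
Definition limK (u : nat -> K) : K := xget 0 [set l | converges_to u l]%classic.

Lemma coef_fpsXnM (R : idomainType) (f : fps R) (m n : nat) :
  (n < m)%N -> fps_coef (fpsX R ^+ m * f) n = 0.
Proof.
elim: m n f => // m IHm n f lt_nm; rewrite exprS -mulrA.
rewrite -[LHS]/(\sum_(i < n.+1) (i == 1%N :> nat)%:R
                  * fps_coef (fpsX R ^+ m * f) (n - i)%N).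
apply: big1 => i _; have := ltn_ord i; case: eqP => [->|_ _]; last first.
  by rewrite mul0r.
by case: n lt_nm {i} => // n lt_nm _; rewrite subSS subn0 IHm ?mulr0.
Qed.

Lemma converges_to_unique (u : nat -> K) (l l' : K) :
  converges_to u l -> converges_to u l' -> l = l'.
Proof.
move=> ul ul'.
have div m : exists f : fps rat, l - l' = tvar ^+ m * f%:F.
  have [N0 cN0] := ul m; have [N1 cN1] := ul' m.
  have [f Ef] := cN0 _ (leq_maxl N0 N1).
  have [g Eg] := cN1 _ (leq_maxr N0 N1).
  exists (g - f); rewrite rmorphB mulrBr -Ef -Eg.
  by rewrite opprB [RHS]addrC addrA subrK.
have [f Ef] := div 0%N; rewrite expr0 mul1r in Ef.
suff f0 : f = 0 by apply/eqP; rewrite -subr_eq0 Ef f0 rmorph0.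
apply: fpsP => n; have [g] := div n.+1.
rewrite Ef -rmorphXn -rmorphM => /eqP; rewrite tofrac_eq => /eqP ->.
by rewrite coef_fpsXnM.
Qed.

Lemma limK_eq (u : nat -> K) (l : K) : converges_to u l -> limK u = l.
Proof.
move=> ul; apply: xget_unique => // l' ul'.
exact: converges_to_unique ul' ul.
Qed.

Definition is_intpart (s : seq nat) : bool := sorted geq s && (0%N \notin s).

Record intpart := IntPart { parts :> seq nat; _ : is_intpart parts }.

HB.instance Definition _ := [isSub for parts].
HB.instance Definition _ := [Countable of intpart by <:].

(* The i-th part, counted from 0, and 0 beyond the last one. *)
Definition part (la : intpart) (i : nat) : nat := nth 0%N la i.

Definition psize (la : intpart) : nat := sumn la.

(* The boxes (row, column) of the Young diagram; rows and columns are counted *)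
(* from 0, which leaves the contents column - row unchanged.                  *)
Definition boxes (la : intpart) : seq (nat * nat) :=
  [seq (i, j) | i <- iota 0 (size la), j <- iota 0 (part la i)].

Definition part_incl (la mu : intpart) : bool :=
  all [in boxes mu] (boxes la).

Definition empty_part : intpart := @IntPart [::] isT.
Definition box_part : intpart := @IntPart [:: 1%N] isT.

(* The j-th part of the transpose is the length of the j-th column. *)
Definition transpose_seq (s : seq nat) : seq nat :=
  [seq count (ltn j) s | j <- iota 0 (head 0%N s)].

Lemma transpose_subproof (la : intpart) : is_intpart (transpose_seq la).
Proof.
case: la => [s /= _]; apply/andP; split.
  apply: (@homo_sorted _ _ (fun j => count (ltn j) s) leq).
    by move=> j k le_jk; apply: sub_count => x /=; apply: leq_ltn_trans.
  exact: iota_sorted.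
apply/mapP => -[j]; rewrite mem_iota /= add0n => lt_j /esym/eqP.
by case: s lt_j => //= x s ->.
Qed.

Definition transpose (la : intpart) : intpart :=
  IntPart (transpose_subproof la).

Definition kappa (la : intpart) : int :=
  2 * \sum_(b <- boxes la) (b.2%:Z - b.1%:Z).

Definition add_box (la : intpart) : set intpart :=
  [set ga | exists2 b, b \notin boxes la & boxes ga =i b :: boxes la]%classic.

Definition rem_box (la : intpart) : set intpart :=
  [set be | add_box be la]%classic.

Definition skew_boxes (la eta : intpart) : seq (nat * nat) :=
  [seq b <- boxes la | b \notin boxes eta].

Definition filling (N : nat) (la eta : intpart) : finType :=
  {ffun seq_sub (skew_boxes la eta) -> 'I_N}.

Definition semistandard (N : nat) (la eta : intpart)
    (T : filling N la eta) : bool :=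
  [forall b, forall c,
     (((val b).1 == (val c).1) && ((val b).2 < (val c).2)%N ==> (T b <= T c)%N)
  && (((val b).2 == (val c).2) && ((val b).1 < (val c).1)%N ==> (T b < T c)%N)].

(* s_{la/eta}(x_0, ..., x_{N-1}), combinatorial definition. *)
Definition skew_schur_poly (N : nat) (la eta : intpart) (x : nat -> K) : K :=
  if part_incl eta la then
    \sum_(T : filling N la eta | semistandard T) \prod_b x (T b)
  else 0.

(* s_{la/eta}(x_0, x_1, ...), where the x_i tend to 0 t-adically. *)
Definition skew_schur (la eta : intpart) (x : nat -> K) : K :=
  limK (fun N => skew_schur_poly N la eta x).

Definition schur (la : intpart) (x : nat -> K) : K :=
  skew_schur la empty_part x.

(* The variables q^{mu+rho}: with parts counted from 0, the i-th one is       *)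
(* q^{mu_i - i - 1/2}.                                                        *)
Definition qrho (mu : intpart) (i : nat) : K :=
  qhalf ^ (2 * (part mu i)%:Z - 2 * i%:Z - 1).

(* The sum over eta is a finitely supported sum over all partitions. *)
Definition vertex (la1 la2 la3 : intpart) : K :=
  qhalf ^ (kappa la2 + kappa la3)
  * schur (transpose la2) (qrho empty_part)
  * \sum_(eta \in [set: intpart])
      (skew_schur (transpose la3) eta (qrho la2)
       * skew_schur la1 eta (qrho (transpose la2))).

Definition R32 (T : intpart -> intpart -> intpart -> K) : Prop :=
  forall la1 la2 la3 : intpart,
    schur box_part (qrho la1) * T la1 la2 la3 =
      \sum_(be2 \in rem_box la2) (qhalf ^ (kappa be2 - kappa la2) * T la1 be2 la3)
      - \sum_(ga3 \in add_box la3) T la1 la2 ga3.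

Definition R13 (T : intpart -> intpart -> intpart -> K) : Prop :=
  forall la1 la2 la3 : intpart,
    schur box_part (qrho la2) * T la1 la2 la3 =
      \sum_(be3 \in rem_box la3) (qhalf ^ (kappa be3 - kappa la3) * T la1 la2 be3)
      - \sum_(ga1 \in add_box la1) T ga1 la2 la3.

Definition R21 (T : intpart -> intpart -> intpart -> K) : Prop :=
  forall la1 la2 la3 : intpart,
    schur box_part (qrho la3) * T la1 la2 la3 =
      \sum_(be1 \in rem_box la1) (qhalf ^ (kappa be1 - kappa la1) * T be1 la2 la3)
      - \sum_(ga2 \in add_box la2) T la1 ga2 la3.

Definition R31 (T : intpart -> intpart -> intpart -> K) : Prop :=
  forall la1 la2 la3 : intpart,
    schur box_part (qrho (transpose la2)) * T la1 la2 la3 =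
      \sum_(al1 \in rem_box la1) T al1 la2 la3
      - \sum_(ga3 \in add_box la3) (qhalf ^ (kappa ga3 - kappa la3) * T la1 la2 ga3).

Definition R12 (T : intpart -> intpart -> intpart -> K) : Prop :=
  forall la1 la2 la3 : intpart,
    schur box_part (qrho (transpose la3)) * T la1 la2 la3 =
      \sum_(al2 \in rem_box la2) T la1 al2 la3
      - \sum_(ga1 \in add_box la1) (qhalf ^ (kappa ga1 - kappa la1) * T ga1 la2 la3).

Definition R23 (T : intpart -> intpart -> intpart -> K) : Prop :=
  forall la1 la2 la3 : intpart,
    schur box_part (qrho (transpose la1)) * T la1 la2 la3 =
      \sum_(al3 \in rem_box la3) T la1 la2 al3
      - \sum_(ga2 \in add_box la2) (qhalf ^ (kappa ga2 - kappa la2) * T la1 ga2 la3).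

Definition vertex_system (T : intpart -> intpart -> intpart -> K) : Prop :=
  [/\ R32 T, R13 T & R21 T] /\ [/\ R31 T, R12 T & R23 T].

Definition signed_vertex (la1 la2 la3 : intpart) : K :=
  (-1) ^+ (psize la1 + psize la2 + psize la3)
  * vertex (transpose la1) (transpose la2) (transpose la3).

(* Main.v *)
Require Import Defs.
From HB Require Import structures.
From mathcomp Require Import all_boot all_order all_algebra.
From mathcomp Require Import boolp classical_sets functions cardinality fsbigop.
From mathcomp Require Import ring zify.

Set Implicit Arguments.
Unset Strict Implicit.
Unset Printing Implicit Defensive.

Import Order.TTheory GRing.Theory.
Local Open Scope ring_scope.

(** The solution is exhibited as a determinant, and the relations become identities
    between determinants that differ by a rank one matrix.

    Let mu be the transpose of la2 and nu that of la1, and let H_mu(u) be the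
    generating series [Hq mu] of the h_k(q^(mu + rho)).  Removing the largest entry
    from tableaux expands skew Schur functions along horizontal strips, and
    elementary row operations do the same for determinants in the beta-numbers
    ([slater_genH]); this gives the Jacobi-Trudi formula ([skew_schur_jt]) and, by
    the Cauchy-Binet principle, turns the sum over eta in the vertex into the
    determinant [Z] of the coefficients of u^k v^l in the Cauchy kernel
    H_mu(u) H_(mu^t)(v) / (1 - uv), where k and l run over the beta-numbers of la3
    and nu ([vertex_sum], [signed_vertexE]).  The other factors of the vertex are a
    power of q and g(mu) = s_mu(q^rho).

    A box added to or removed from la3 or nu shifts a row or a column of this
    determinant.  Shifting the columns up and the rows down differ by a matrix of
    rank one, because multiplication by 1 - uv removes the denominator of the kernel;
    this is [Z_R13].  A box added to mu multiplies the kernel by a cross-ratio which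
    is constant on the curve uv = 1, so that the matrix changes by a scalar and a
    matrix of rank one ([ck_update]), and the determinant is affine along such a
    change ([det_rank1]).  The sum over all boxes of these rank one matrices, with the
    weights g, follows from the partial fraction expansions of H_mu(qu) / H_mu(u) and
    H_mu(u/q) / H_mu(u) ([sum_add_geo], [sum_rem_geo]): their poles correspond to the
    addable and removable boxes, and their residues to the ratios of the values of g,
    because the Jacobi-Trudi determinant of s_mu(q^rho) factors as a function of each
    of its rows ([det_hshift_row]).  This proves [Z_R21] and [Z_R12].  Transposition
    exchanges the two variables of the kernel and deduces the other three relations
    ([signed_vertex_transpose]).

    For uniqueness, let U be the difference of two solutions.  Induction on the boxes
    of la2: if U vanishes at la2, then [R21] says that the sum of the values of U
    over the partitions obtained by adding a box to la2 vanishes, and [R13], which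
    leaves the second partition alone, then gives the same for the sums weighted by
    any power of s_box(q^(ga2 + rho)) ([U_moments]).  As the partition is determined
    by the value of s_box ([D_inj]), all these values of U vanish.  For empty la2
    the relations [R21] and [R23] involve the same unknown, the value at la2 = box;
    eliminating it determines U unless la3 is the transpose of la1, a case covered by
    [R32] ([U_empty]). *)

(** * Determinants under rank one perturbations *)

Section TraceDet.
Variables (R : comNzRingType) (n : nat).
Implicit Types (M N : 'M[R]_n) (i j : 'I_n) (r l d : 'I_n -> R).

(** The trace of the product of N by the adjugate of M, that is, the derivative of the
    determinant at M in the direction N. *)
Definition trdet M N := \sum_i \sum_j N i j * cofactor M i j.

Definition row_repl M (v : 'I_n -> R) i0 : 'M[R]_n :=
  \matrix_(i, j) if i == i0 then v j else M i j.
Definition col_repl M (v : 'I_n -> R) j0 : 'M[R]_n :=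
  \matrix_(i, j) if j == j0 then v i else M i j.

Lemma det_row_repl M v i :
  \det (row_repl M v i) = \sum_j v j * cofactor M i j.
Proof.
rewrite (expand_det_row _ i); apply: eq_bigr => j _; rewrite mxE eqxx.
congr (_ * (_ * \det _)); apply/matrixP => k l; rewrite !mxE.
by rewrite eq_sym (negPf (neq_lift _ _)).
Qed.

Lemma det_col_repl M v j :
  \det (col_repl M v j) = \sum_i v i * cofactor M i j.
Proof.
rewrite (expand_det_col _ j); apply: eq_bigr => i _; rewrite mxE eqxx.
congr (_ * (_ * \det _)); apply/matrixP => k l; rewrite !mxE.
by rewrite eq_sym (negPf (neq_lift _ _)).
Qed.

Lemma trdet_rows M N : trdet M N = \sum_i \det (row_repl M (N i) i).
Proof. by apply: eq_bigr => i _; rewrite det_row_repl. Qed.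

Lemma trdet_cols M N : trdet M N = \sum_j \det (col_repl M (N^~ j) j).
Proof.
by rewrite /trdet exchange_big; apply: eq_bigr => j _; rewrite det_col_repl.
Qed.

Lemma eq_trdet M N N' : N =2 N' -> trdet M N = trdet M N'.
Proof. by move=> eqN; do 2![apply: eq_bigr => ? _]; rewrite eqN. Qed.

Lemma trdetD M N N' : trdet M (N + N') = trdet M N + trdet M N'.
Proof.
rewrite /trdet -big_split; apply: eq_bigr => i _; rewrite -big_split.
by apply: eq_bigr => j _; rewrite mxE mulrDl.
Qed.

Lemma trdetZ M N c : trdet M (c *: N) = c * trdet M N.
Proof.
rewrite /trdet big_distrr; apply: eq_bigr => i _; rewrite big_distrr.
by apply: eq_bigr => j _; rewrite mxE -mulrA.
Qed.

Lemma trdet_sum I (s : seq I) (P : pred I) M (N : I -> 'M[R]_n) :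
  trdet M (\sum_(k <- s | P k) N k) = \sum_(k <- s | P k) trdet M (N k).
Proof.
apply: (big_morph (trdet M)) => [N1 N2|]; first exact: trdetD.
by rewrite -(scale0r 0) trdetZ mul0r.
Qed.

Lemma trdet_diagl M d : trdet M (\matrix_(i, j) (d i * M i j)) = (\sum_i d i) * \det M.
Proof.
rewrite big_distrl; apply: eq_bigr => i _ /=; rewrite (expand_det_row M i) big_distrr /=.
by apply: eq_bigr => j _; rewrite mxE -mulrA.
Qed.

Lemma trdet_diagr M d : trdet M (\matrix_(i, j) (d j * M i j)) = (\sum_i d i) * \det M.
Proof.
rewrite /trdet exchange_big big_distrl; apply: eq_bigr => j _ /=.
rewrite (expand_det_col M j) big_distrr /=.
by apply: eq_bigr => i _; rewrite mxE -mulrA.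
Qed.

(** Replacing column [j] by a multiple of column [j0] gives two proportional columns,
    except for [j = j0]. *)
Lemma trdet_col M j0 l : trdet M (\matrix_(i, j) (M i j0 * l j)) = l j0 * \det M.
Proof.
rewrite /trdet exchange_big (bigD1 j0) //= [X in _ + X]big1 ?addr0 => [|j ne_j].
  rewrite (expand_det_col M j0) [in RHS]big_distrr /=; apply: eq_bigr => i _ /=.
  by rewrite mxE; ring.
transitivity (l j * (\adj M *m M) j j0).
  by rewrite mxE big_distrr; apply: eq_bigr => i _; rewrite /= !mxE; ring.
by rewrite mul_adj_mx mxE (negPf ne_j) mulr0n mulr0.
Qed.

Lemma det_scale_rows M d : \det (\matrix_(i, j) (d i * M i j)) = (\prod_i d i) * \det M.
Proof.
have -> : \matrix_(i, j) (d i * M i j) = diag_mx (\row_i d i) *m M.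
  by apply/matrixP => i j; rewrite mul_diag_mx !mxE.
by rewrite det_mulmx det_diag; congr (_ * _); apply: eq_bigr => i _; rewrite mxE.
Qed.

(** Expanding by rows, a term that takes two or more rows from the rank one matrix has
    two proportional rows. *)
Lemma det_rank1 M r l :
  \det (\matrix_(i, j) (M i j + r i * l j)) =
    \det M + trdet M (\matrix_(i, j) (r i * l j)).
Proof.
pose MJ (J : {set 'I_n}) : 'M[R]_n := \matrix_(i, j) if i \in J then r i * l j else M i j.
transitivity (\sum_(J : {set 'I_n}) \det (MJ J)).
  rewrite exchange_big; apply: eq_bigr => s _; rewrite -big_distrr; congr (_ * _).
  under eq_bigr => i _ do rewrite mxE addrC.
  rewrite bigA_distr; apply: eq_bigr => J _; apply: eq_bigr => i _.
  by rewrite mxE.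
have MJ0 (J : {set 'I_n}) i1 i2 : i1 \in J -> i2 \in J -> i1 != i2 -> \det (MJ J) = 0.
  move=> J1 J2 ne_i; pose d i := if i \in J then r i else 1.
  have -> : MJ J = \matrix_(i, j) (d i *
      (\matrix_(i, j) if i \in J then l j else M i j) i j).
    by apply/matrixP => i j; rewrite !mxE /d; case: ifP => //; rewrite mul1r.
  rewrite det_scale_rows (determinant_alternate ne_i) ?mulr0 // => j.
  by rewrite !mxE J1 J2.
rewrite (bigD1 finset.set0) //=; congr (_ + _).
  by congr (\det _); apply/matrixP => i j; rewrite mxE inE.
rewrite trdet_rows.
transitivity (\sum_(J in [set [set i] | i : 'I_n]) \det (MJ J)); last first.
  rewrite big_imset => [|i1 i2 _ _]; last exact: set1_inj.
  apply: eq_big => [i|i _]; first by rewrite inE.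
  by congr (\det _); apply/matrixP => i1 j; rewrite !mxE inE; case: eqP => // ->.
rewrite [RHS]big_mkcond [LHS]big_mkcond; apply: eq_bigr => J _.
have [->|[i iJ]] := set_0Vmem J.
  by rewrite eqxx; case: imsetP => // -[i _ /setP/(_ i)]; rewrite !inE eqxx.
have -> : J != finset.set0 by apply/set0Pn; exists i.
case: imsetP => // nJ; have [i' /andP[iJ' ne_i]|J1] := pickP [pred i' | (i' \in J) && (i' != i)].
  exact: MJ0 iJ' iJ ne_i.
case: nJ; exists i => //; apply/setP => i'; rewrite inE.
apply/idP/eqP => [iJ'|-> //]; apply/eqP; apply: contraFT (J1 i') => ne_i.
by rewrite /= iJ' ne_i.
Qed.

Lemma det_sum_rows (T : finType) (w : 'I_n -> T -> R) (P : T -> 'I_n -> R) :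
  \det (\matrix_(i, j) \sum_k w i k * P k j) =
    \sum_(f : {ffun 'I_n -> T})
      (\prod_i w i (f i)) * \det (\matrix_(i, j) P (f i) j).
Proof.
rewrite /(\det _).
under [RHS]eq_bigr do rewrite big_distrr.
rewrite exchange_big; apply: eq_bigr => s _ /=.
under eq_bigr => i _ do rewrite mxE.
rewrite bigA_distr_bigA big_distrr; apply: eq_bigr => f _ /=.
rewrite big_split mulrCA; congr (_ * (_ * _)).
by apply: eq_bigr => i _; rewrite mxE.
Qed.

End TraceDet.

(** Replacing each row by its difference with a multiple of the next one
    truncates the geometric convolution to the gap between two consecutive
    indices; this is what turns determinants into sums over horizontal strips. *)
Lemma det_geometric_rows (R : comNzRingType) n (P : nat -> 'I_n -> R) (x : R)
    (a lo : nat -> nat) :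
    (forall i, (i.+1 < n)%N -> lo i = (a i.+1).+1 /\ (a i.+1 < a i)%N) ->
    (forall i, (i.+1 = n)%N -> lo i = 0%N) ->
  \det (\matrix_(i < n, j < n) \sum_(0 <= c < (a i).+1) x ^+ (a i - c) * P c j) =
  \det (\matrix_(i < n, j < n) \sum_(lo i <= c < (a i).+1) x ^+ (a i - c) * P c j).
Proof.
move=> lo_next lo_last.
pose Q k j := \sum_(0 <= c < (a k).+1) x ^+ (a k - c) * P c j.
pose U : 'M[R]_n := \matrix_(i, k) if k == i then 1 else
  if (k == i.+1 :> nat) then - x ^+ (a i - a k) else 0.
have detU : \det U = 1.
  rewrite -det_tr det_trig => [|]; last first.
    apply/is_trig_mxP => i j lt_ij; rewrite !mxE -val_eqE /=.
    by rewrite ltn_eqF // ltn_eqF // ltnW.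
  by rewrite big1 // => i _; rewrite !mxE eqxx.
rewrite -[LHS]mul1r -detU -det_mulmx; congr (\det _); apply/matrixP => i j.
rewrite mxE [RHS]mxE (eq_bigr (fun k => U i k * Q k j)) => [|k _]; last first.
  by rewrite [X in _ * X]mxE.
rewrite (bigD1 i) //= [U i i]mxE eqxx mul1r.
have [lt_i|ge_i] := ltnP i.+1 n; last first.
  have lo0 : lo i = 0%N by apply: lo_last; apply/eqP; rewrite eqn_leq ltn_ord.
  rewrite lo0 [X in _ + X]big1 ?addr0 // => k ne_k.
  rewrite mxE (negPf ne_k) ifF ?mul0r //; apply/negbTE.
  by rewrite neq_ltn (leq_trans (ltn_ord k)).
have [loE lt_a] := lo_next i lt_i.
rewrite (bigD1 (Ordinal lt_i)) -?val_eqE ?gtn_eqF //=.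
rewrite [X in _ + (_ + X)]big1 ?addr0 => [|k]; last first.
  by rewrite mxE -!val_eqE /= => /andP[/negPf -> /negPf ->]; rewrite mul0r.
rewrite mxE -val_eqE /= gtn_eqF // eqxx /Q.
rewrite [X in X + _](big_cat_nat _ (n := lo i)) //=; last by rewrite loE ltnS ltnW.
rewrite loE mulNr addrAC -[RHS]add0r; congr (_ + _).
apply/eqP; rewrite subr_eq0; apply/eqP; rewrite big_distrr /= !big_nat.
apply: eq_bigr => c /andP[_ lt_c]; rewrite mulrA -exprD; congr (_ ^+ _ * _).
by lia.
Qed.

(** * Partitions, boxes and contents *)

Section Partitions.
Implicit Types (la mu nu eta ga be : intpart) (i j k n : nat).

Lemma part_geq la i j : (i <= j)%N -> (part la j <= part la i)%N.
Proof.
move=> le_ij; rewrite /part; have [lt_j|le_j] := ltnP j (size la); last first.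
  by rewrite (nth_default _ le_j).
case: la lt_j => s /= /andP[sorted_s _] lt_j.
apply: (sorted_leq_nth (rev_trans leq_trans) leqnn 0%N sorted_s) => //.
exact: leq_ltn_trans le_ij lt_j.
Qed.

Lemma part_gt0 la i : (0 < part la i)%N = (i < size la)%N.
Proof.
rewrite /part; have [lt_i|le_i] := ltnP i (size la); last by rewrite nth_default.
case: la lt_i => s /= /andP[_ s_n0] lt_i; rewrite lt0n.
by apply: contraNneq s_n0 => <-; apply: mem_nth.
Qed.

Lemma part_default la i : (size la <= i)%N -> part la i = 0%N.
Proof. exact: nth_default. Qed.

Lemma eq_ltnl (a b : nat) : (forall l, (l < a)%N = (l < b)%N) -> a = b.
Proof. by move=> eq_ab; move: (eq_ab a) (eq_ab b); lia. Qed.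

Lemma part_inj la mu : part la =1 part mu -> la = mu.
Proof.
move=> eq_part; apply/val_inj/(@eq_from_nth _ 0%N) => [|i _]; last exact: eq_part.
by apply: eq_ltnl => l; rewrite -!part_gt0 eq_part.
Qed.

Lemma mem_boxes la i j : ((i, j) \in boxes la) = (j < part la i)%N.
Proof.
apply/allpairsPdep/idP => [[i' [j' [_ + [-> ->]]]]|lt_j].
  by rewrite mem_iota add0n.
exists i, j; rewrite !mem_iota !add0n /=; split=> //.
by rewrite -part_gt0 (leq_ltn_trans _ lt_j).
Qed.

Lemma uniq_boxes la : uniq (boxes la).
Proof.
apply: allpairs_uniq_dep => [|i _|]; rewrite ?iota_uniq //.
by move=> [i j] [i' j'] _ _ /= [-> ->].
Qed.

Lemma part_inclE la mu :
  part_incl la mu = [forall i : 'I_(size la), part la i <= part mu i]%N.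
Proof.
apply/allP/forallP => [sub i|le_lm [i j]].
  rewrite leqNgt; apply/negP => lt_i.
  have {}sub b : b \in boxes la -> b \in boxes mu := sub b.
  by have := sub (i : nat, part mu i); rewrite !mem_boxes ltnn => /(_ lt_i).
move=> ij_la; change ((i, j) \in boxes mu); move: ij_la.
rewrite !mem_boxes => lt_j; have lt_i : (i < size la)%N.
  by rewrite -part_gt0 (leq_ltn_trans _ lt_j).
exact: leq_trans lt_j (le_lm (Ordinal lt_i)).
Qed.

Lemma part_inclP la mu :
  reflect (forall i, (part la i <= part mu i)%N) (part_incl la mu).
Proof.
rewrite part_inclE; apply: (iffP forallP) => [le_lm i|//].
have [lt_i|le_i] := ltnP i (size la); last by rewrite part_default.
exact: (le_lm (Ordinal lt_i)).
Qed.

Definition mkpart n (f : nat -> nat) : intpart :=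
  insubd empty_part [seq x <- mkseq f n | x != 0%N].

Lemma nth_filter_geq (s : seq nat) i :
  sorted geq s -> nth 0%N [seq x <- s | x != 0%N] i = nth 0%N s i.
Proof.
elim: s i => //= x s IHs i path_s.
have [x0|_] := eqVneq x 0%N; last by case: i => //= i; rewrite IHs ?(path_sorted path_s).
have : all (fun y => y == 0)%N s.
  have /(order_path_min (rev_trans leq_trans)) := path_s.
  by apply: sub_all => y; rewrite x0 leqn0.
move=> s0; rewrite (_ : [seq y <- s | _] = [::]) ?nth_nil.
  case: i => //= i; have [lt_i|le_i] := ltnP i (size s); last by rewrite nth_default.
  by rewrite (eqP (all_nthP 0%N s0 i lt_i)).
by apply/eqP; rewrite -[_ == _]negbK -has_filter -all_predC; apply: sub_all s0 => y /=; rewrite negbK.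
Qed.

Lemma part_mkpart n f i : (forall j, (j.+1 < n)%N -> (f j.+1 <= f j)%N) ->
  part (mkpart n f) i = if (i < n)%N then f i else 0%N.
Proof.
move=> f_geq; have sorted_f : sorted geq (mkseq f n).
  apply/(sortedP 0%N) => j; rewrite size_mkseq => lt_j.
  by rewrite !nth_mkseq ?(ltnW lt_j) //; apply: f_geq.
rewrite /part /mkpart -[parts _]/(val _) insubdK.
  rewrite nth_filter_geq //; case: ltnP => [lt_i|le_i]; first exact: nth_mkseq.
  by rewrite nth_default // size_mkseq.
apply/andP; split; last by rewrite mem_filter eqxx.
exact: sorted_filter (rev_trans leq_trans) _ _ sorted_f.
Qed.

Lemma count_sorted_geq (s : seq nat) i j :
  sorted geq s -> (i < count (ltn j) s)%N = (j < nth 0%N s i)%N.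
Proof.
elim: s i => [|x s IHs] i path_s; first by rewrite nth_nil.
have sorted_s := path_sorted path_s.
rewrite [count _ _]/=; case: (ltnP j x) => [lt_jx|le_xj].
  by case: i => [|i] //=; rewrite add1n ltnS IHs.
have: all (fun y => y <= x)%N s by apply: (order_path_min (rev_trans leq_trans)).
move=> le_s; have -> : count (ltn j) s = 0%N.
  apply/eqP; rewrite -leqn0 leqNgt -has_count -all_predC.
  by apply: sub_all le_s => y /= le_yx; rewrite -leqNgt (leq_trans le_yx).
rewrite addn0 ltn0; apply/esym/negbTE; rewrite -leqNgt.
case: i => //= i; have [lt_i|le_i] := ltnP i (size s); last by rewrite nth_default.
exact: leq_trans (all_nthP 0%N le_s i lt_i) le_xj.
Qed.

Lemma part_transpose la j : part (transpose la) j = count (ltn j) la.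
Proof.
rewrite /part /= /transpose_seq; set m := head _ _.
have [lt_j|le_j] := ltnP j m.
  by rewrite (nth_map 0%N) ?size_iota // nth_iota.
rewrite nth_default ?size_map ?size_iota //; apply/esym/eqP.
rewrite -leqn0 leqNgt count_sorted_geq; last by case: (la) => ? /= /andP[].
by rewrite nth0 -leqNgt.
Qed.

Lemma ltn_part_transpose la i j :
  (j < part (transpose la) i)%N = (i < part la j)%N.
Proof.
by rewrite part_transpose count_sorted_geq //; case: la => ? /= /andP[].
Qed.

Lemma transposeK : involutive transpose.
Proof.
by move=> la; apply: part_inj => i; apply: eq_ltnl => l; rewrite !ltn_part_transpose.
Qed.

Lemma perm_boxes_transpose la :
  perm_eq (boxes (transpose la)) [seq (b.2, b.1) | b <- boxes la].
Proof.
apply: uniq_perm; rewrite ?uniq_boxes //.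
  by rewrite map_inj_uniq ?uniq_boxes // => -[i j] [i' j'] [-> ->].
move=> [i j]; rewrite mem_boxes ltn_part_transpose -mem_boxes.
by apply/idP/mapP => [ji_la|[[j' i'] + [-> ->]] //]; exists (j, i).
Qed.

Lemma psizeE la : psize la = size (boxes la).
Proof.
rewrite size_allpairs_dep /psize; congr sumn.
apply: (@eq_from_nth _ 0%N) => [|i lt_i]; first by rewrite size_map size_iota.
by rewrite (nth_map 0%N) ?size_iota // nth_iota.
Qed.

Lemma psize_transpose la : psize (transpose la) = psize la.
Proof. by rewrite !psizeE (perm_size (perm_boxes_transpose la)) size_map. Qed.

Lemma kappa_transpose la : kappa (transpose la) = - kappa la.
Proof.
rewrite /kappa (perm_big _ (perm_boxes_transpose la)) big_map -mulrN -sumrN.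
by congr (_ * _); apply: eq_bigr => b _; rewrite opprB.
Qed.

Definition addable la i := (i == 0)%N || (part la i < part la i.-1)%N.
Definition removable la i := (part la i.+1 < part la i)%N.
Definition addrow la i :=
  mkpart (maxn (size la) i.+1) (fun k => part la k + (k == i))%N.
Definition remrow la i := mkpart (size la) (fun k => part la k - (k == i))%N.

Lemma part_addrow la i k : addable la i ->
  part (addrow la i) k = (part la k + (k == i))%N.
Proof.
move=> add_i; rewrite part_mkpart => [|j _].
  case: ltnP => //; rewrite geq_max => /andP[le_k lt_k].
  by rewrite part_default // gtn_eqF.
have := part_geq la (leqnSn j).
by case: eqVneq add_i => [<-|_ _]; rewrite /addable /=; lia.
Qed.

Lemma part_remrow la i k : removable la i ->
  part (remrow la i) k = (part la k - (k == i))%N.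
Proof.
move=> rem_i; rewrite part_mkpart => [|j _].
  by case: ltnP => // le_k; rewrite part_default.
have := part_geq la (leqnSn j).
by case: (eqVneq j i) rem_i => [->|_ _]; rewrite /removable /=; lia.
Qed.

Lemma addable_lt la i n : (size la < n)%N -> addable la i -> (i < n)%N.
Proof.
move=> lt_n; rewrite /addable; case: i => [|i] /=; first by lia.
by case: (ltnP i (size la)) => [|le_i]; [lia | rewrite (part_default le_i)].
Qed.

Lemma removable_lt la i n : (size la <= n)%N -> removable la i -> (i < n)%N.
Proof.
move=> le_n; rewrite /removable => lt_i; apply: leq_trans le_n.
by rewrite -part_gt0 (leq_ltn_trans _ lt_i).
Qed.

Lemma add_boxP la ga :
  add_box la ga <-> exists2 i, addable la i & ga = addrow la i.
Proof.
split=> [[[i j]]|[i add_i ->]]; last first.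
  exists (i, part la i); first by rewrite mem_boxes ltnn.
  move=> [k l]; rewrite in_cons !mem_boxes part_addrow // -pair_eqE /=.
  by case: (eqVneq k i) => [->|_] /=; rewrite ?addn0 // addn1 ltnS leq_eqVlt.
rewrite mem_boxes -leqNgt => le_j eq_b.
have gaE k l : (l < part ga k)%N = ((k == i) && (l == j)) || (l < part la k)%N.
  by rewrite -!mem_boxes eq_b in_cons -pair_eqE.
have ji : j = part la i.
  have gt_j : (j < part ga i)%N by rewrite gaE !eqxx.
  have := gaE i (part la i); rewrite eqxx ltnn orbF (leq_ltn_trans le_j gt_j).
  by move/esym/eqP.
have ga_i k : part ga k = (part la k + (k == i))%N.
  apply: eq_ltnl => l; rewrite gaE; case: (eqVneq k i) => [->|_] /=.
    by rewrite ji addn1 ltnS [RHS]leq_eqVlt.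
  by rewrite addn0.
have add_i : addable la i.
  rewrite /addable; case: i {gaE eq_b le_j ji} ga_i => //= i ga_i.
  by have := part_geq ga (leqnSn i); rewrite !ga_i eqxx; lia.
by exists i => //; apply: part_inj => k; rewrite part_addrow.
Qed.

Lemma addrow_remrow la i : removable la i ->
  addable (remrow la i) i /\ addrow (remrow la i) i = la.
Proof.
move=> rem_i; have add_i : addable (remrow la i) i.
  rewrite /addable; case: i rem_i => //= i rem_i; rewrite !part_remrow // eqxx.
  by have := part_geq la (leqnSn i); move: rem_i; rewrite /removable; lia.
split=> //; apply: part_inj => k; rewrite part_addrow // part_remrow //.
by move: rem_i; rewrite /removable; case: eqVneq => [->|_]; lia.
Qed.

Lemma rem_boxP la be :
  rem_box la be <-> exists2 i, removable la i & be = remrow la i.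
Proof.
split=> [/add_boxP[i add_i laE]|[i rem_i ->]]; last first.
  by apply/add_boxP; exists i; case: (addrow_remrow rem_i).
have rem_i : removable la i.
  rewrite /removable laE !part_addrow // eqxx.
  by have := part_geq be (leqnSn i); lia.
exists i => //; apply: part_inj => k.
by rewrite part_remrow // laE part_addrow //; lia.
Qed.

Lemma perm_boxes_addrow la i : addable la i ->
  perm_eq (boxes (addrow la i)) ((i, part la i) :: boxes la).
Proof.
move=> add_i; apply: uniq_perm; rewrite ?uniq_boxes //=.
  by rewrite mem_boxes ltnn uniq_boxes.
move=> [k l]; rewrite in_cons !mem_boxes part_addrow // -pair_eqE /=.
by case: (eqVneq k i) => [->|_] /=; rewrite ?addn0 // addn1 ltnS leq_eqVlt.
Qed.

Lemma psize_add_box la ga : add_box la ga -> psize ga = (psize la).+1.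
Proof.
by case/add_boxP=> i /perm_boxes_addrow/perm_size + ->; rewrite !psizeE.
Qed.

Lemma kappa_addrow la i : addable la i ->
  kappa (addrow la i) = kappa la + 2 * ((part la i)%:Z - i%:Z).
Proof.
move=> /perm_boxes_addrow perm_b; rewrite /kappa (perm_big _ perm_b) big_cons /=.
by rewrite mulrDr addrC.
Qed.

Lemma kappa_remrow la i : removable la i ->
  kappa la = kappa (remrow la i) + 2 * ((part la i)%:Z - 1 - i%:Z).
Proof.
move=> rem_i; have [add_i {1}<-] := addrow_remrow rem_i.
rewrite kappa_addrow // part_remrow // eqxx.
by move: rem_i; rewrite /removable; lia.
Qed.

Lemma add_box_transpose la ga :
  add_box la ga -> add_box (transpose la) (transpose ga).
Proof.
case=> -[i j] ij_la eq_b; exists (j, i).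
  by move: ij_la; rewrite !mem_boxes ltn_part_transpose.
move=> [k l]; move: (eq_b (l, k)).
by rewrite !in_cons !mem_boxes !ltn_part_transpose -!pair_eqE /= andbC.
Qed.

Lemma intpart_ind (P : intpart -> Prop) :
  P empty_part -> (forall la ga, add_box la ga -> P la -> P ga) ->
  forall la, P la.
Proof.
move=> P0 Padd la; have [n] := ubnP (psize la); elim: n la => // n IHn la lt_n.
have [la0|] := posnP (size la).
  by rewrite (_ : la = empty_part) //; apply/val_inj/size0nil.
case m_eq: (size la) => [//|m] _.
have rem_m : removable la m.
  by rewrite /removable part_default ?m_eq // part_gt0 m_eq.
have add_m : add_box (remrow la m) la by apply/(rem_boxP la); exists m.
apply: (Padd _ _ add_m); apply: IHn; move: lt_n;
by rewrite (psize_add_box add_m).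
Qed.

Definition addseq la := [seq addrow la i | i <- iota 0 (size la).+1 & addable la i].
Definition remseq la := [seq remrow la i | i <- iota 0 (size la) & removable la i].

Lemma mem_addseq la ga : (ga \in addseq la) <-> add_box la ga.
Proof.
rewrite add_boxP; split=> [/mapP[i]|[i add_i ->]].
  by rewrite mem_filter => /andP[add_i _] ->; exists i.
by apply: map_f; rewrite mem_filter add_i mem_iota /= add0n (addable_lt _ add_i).
Qed.

Lemma mem_remseq la be : (be \in remseq la) <-> rem_box la be.
Proof.
rewrite rem_boxP; split=> [/mapP[i]|[i rem_i ->]].
  by rewrite mem_filter => /andP[rem_i _] ->; exists i.
by apply: map_f; rewrite mem_filter rem_i mem_iota /= add0n (removable_lt _ rem_i).
Qed.

Lemma addrow_inj la i j : addable la i -> addable la j ->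
  addrow la i = addrow la j -> i = j.
Proof.
move=> add_i add_j /(congr1 (fun nu => part nu i)).
by rewrite !part_addrow // eqxx; case: eqP => // _; lia.
Qed.

Lemma remrow_inj la i j : removable la i -> removable la j ->
  remrow la i = remrow la j -> i = j.
Proof.
move=> rem_i rem_j /(congr1 (fun nu => part nu i)).
by rewrite !part_remrow // eqxx; case: eqP rem_i => //; rewrite /removable; lia.
Qed.

Lemma uniq_addseq la : uniq (addseq la).
Proof.
rewrite map_inj_in_uniq ?filter_uniq ?iota_uniq // => i j.
by rewrite !mem_filter => /andP[add_i _] /andP[add_j _]; apply: addrow_inj.
Qed.

Lemma uniq_remseq la : uniq (remseq la).
Proof.
rewrite map_inj_in_uniq ?filter_uniq ?iota_uniq // => i j.
by rewrite !mem_filter => /andP[rem_i _] /andP[rem_j _]; apply: remrow_inj.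
Qed.

Lemma sum_add_box (V : nmodType) la (F : intpart -> V) :
  \sum_(ga \in add_box la) F ga = \sum_(ga <- addseq la) F ga.
Proof.
rewrite [RHS]fsbig_seq ?uniq_addseq //; apply: eq_fsbigl.
by apply/seteqP; split=> ga /= /mem_addseq.
Qed.

Lemma sum_rem_box (V : nmodType) la (F : intpart -> V) :
  \sum_(be \in rem_box la) F be = \sum_(be <- remseq la) F be.
Proof.
rewrite [RHS]fsbig_seq ?uniq_remseq //; apply: eq_fsbigl.
by apply/seteqP; split=> be /= /mem_remseq.
Qed.

Lemma big_addseq (V : nmodType) n la (F : intpart -> V) : (size la < n)%N ->
  \sum_(ga <- addseq la) F ga = \sum_(i < n | addable la i) F (addrow la i).
Proof.
move=> lt_n; rewrite big_map big_filter -(big_mkord (addable la) (F \o addrow la)).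
rewrite /index_iota subn0 -(subnKC lt_n) iotaD big_cat /=.
rewrite [X in _ + X]big1_seq ?addr0 // => i; rewrite mem_iota add0n.
by case/and3P=> /(addable_lt (leqnn _)) lt_i; rewrite leqNgt lt_i.
Qed.

Lemma big_remseq (V : nmodType) n la (F : intpart -> V) : (size la <= n)%N ->
  \sum_(be <- remseq la) F be = \sum_(i < n | removable la i) F (remrow la i).
Proof.
move=> le_n; rewrite big_map big_filter -(big_mkord (removable la) (F \o remrow la)).
rewrite /index_iota subn0 -(subnKC le_n) iotaD big_cat /=.
rewrite [X in _ + X]big1_seq ?addr0 // => i; rewrite mem_iota add0n.
by case/and3P=> /(removable_lt (leqnn _)) lt_i; rewrite leqNgt lt_i.
Qed.

End Partitions.

(** * Power series, Laurent series and limits *)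

Section FpsRing.
Variable R : idomainType.
Implicit Types (f g : fps R) (c : R) (n : nat).

Lemma fps_coefD f g n : fps_coef (f + g) n = fps_coef f n + fps_coef g n.
Proof. by []. Qed.
Lemma fps_coef0 n : fps_coef (0 : fps R) n = 0.
Proof. by []. Qed.
Lemma fps_coefN f n : fps_coef (- f) n = - fps_coef f n.
Proof. by []. Qed.
Lemma fps_coef1 n : fps_coef (1 : fps R) n = (n == 0%N)%:R.
Proof. by []. Qed.
Lemma fps_coefM f g n :
  fps_coef (f * g) n = \sum_(i < n.+1) fps_coef f i * fps_coef g (n - i)%N.
Proof. by []. Qed.
Lemma fps_coef_sum I (r : seq I) (P : pred I) (F : I -> fps R) n :
  fps_coef (\sum_(i <- r | P i) F i) n = \sum_(i <- r | P i) fps_coef (F i) n.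
Proof. by apply: (big_morph (fun f => fps_coef f n)). Qed.

Definition fps_of_poly (p : {poly R}) : fps R := Fps (fun n => p`_n).

Fact fps_of_poly_is_zmod_morphism : zmod_morphism fps_of_poly.
Proof. by move=> p q; apply: fpsP => n; rewrite /= coefB. Qed.
Fact fps_of_poly_is_monoid_morphism : monoid_morphism fps_of_poly.
Proof.
split=> [|p q]; apply: fpsP => n; first by rewrite /= coef1.
by rewrite /= coefM.
Qed.
HB.instance Definition _ :=
  GRing.isZmodMorphism.Build _ _ fps_of_poly fps_of_poly_is_zmod_morphism.
HB.instance Definition _ :=
  GRing.isMonoidMorphism.Build _ _ fps_of_poly fps_of_poly_is_monoid_morphism.

Definition fpsC c : fps R := fps_of_poly c%:P.

Lemma fps_coefCM c f n : fps_coef (fpsC c * f) n = c * fps_coef f n.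
Proof.
rewrite fps_coefM big_ord_recl big1 ?addr0 => [|i _]; rewrite /= coefC.
  by rewrite eqxx subn0.
by rewrite mul0r.
Qed.

Definition lin c : fps R := fps_of_poly (1 - c *: 'X).
Definition geo c : fps R := Fps (fun n => c ^+ n).

Lemma fps_coef_lin c f n :
  fps_coef (lin c * f) n =
    fps_coef f n - (if n is m.+1 then c * fps_coef f m else 0).
Proof.
rewrite fps_coefM; case: n => [|n].
  by rewrite big_ord1 /= coefB coefZ coefX coef1 mulr0 subr0 mul1r subr0.
rewrite !big_ord_recl big1 => [|i _]; rewrite /= !(coefB, coefZ, coefX, coef1) /=.
  by rewrite mulr0 subr0 mul1r subn0 mulr1 sub0r addr0 mulNr /bump /= subn1.
by rewrite mulr0 subr0 mul0r.
Qed.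

Lemma lin_geo c : lin c * geo c = 1.
Proof.
apply: fpsP => n; rewrite fps_coef_lin /=; case: n => [|n] /=.
  by rewrite subr0.
by rewrite exprS subrr.
Qed.

Lemma fps_coef_geo c f n : fps_coef (f * geo c) n =
  fps_coef f n + (if n is m.+1 then c * fps_coef (f * geo c) m else 0).
Proof.
have -> : fps_coef f n = fps_coef (lin c * (f * geo c)) n.
  by rewrite mulrCA lin_geo mulr1.
by rewrite fps_coef_lin subrK.
Qed.

Definition fscale c f : fps R := Fps (fun n => c ^+ n * fps_coef f n).

Lemma fscaleM c f g : fscale c (f * g) = fscale c f * fscale c g.
Proof.
apply: fpsP => n /=; rewrite big_distrr; apply: eq_bigr => i _ /=.
have le_in : (i <= n)%N by rewrite -ltnS.
by rewrite -{1}(subnKC le_in) exprD; ring.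
Qed.

Lemma fscale1 c : fscale c 1 = 1.
Proof. by apply: fpsP => -[|n] /=; rewrite ?mulr0 // expr0 mul1r. Qed.

Lemma fscale_lin c d : fscale c (lin d) = lin (c * d).
Proof.
apply: fpsP => n /=; rewrite !(coefB, coefZ, coefX, coef1).
by case: n => [|[|n]] /=; ring.
Qed.

Lemma fscale_geo c d : fscale c (geo d) = geo (c * d).
Proof. by apply: fpsP => n /=; rewrite exprMn. Qed.

Lemma fscale_prod I (r : seq I) (P : pred I) c (F : I -> fps R) :
  fscale c (\prod_(i <- r | P i) F i) = \prod_(i <- r | P i) fscale c (F i).
Proof. by apply: (big_morph _ (fscaleM c) (fscale1 c)). Qed.

Lemma fps_coef_shift f (m n : nat) : fps_coef (fpsX R ^+ m * f) n =
  if (m <= n)%N then fps_coef f (n - m)%N else 0.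
Proof.
have -> : fpsX R = fps_of_poly 'X by apply: fpsP => i; rewrite /= coefX.
rewrite -rmorphXn; case: leqP => [le_mn|lt_nm]; last first.
  rewrite fps_coefM big1 // => i _; rewrite /= coefXn.
  by rewrite ltn_eqF ?mul0r // (leq_trans (ltn_ord i)).
have lt_m : (m < n.+1)%N by [].
rewrite fps_coefM (bigD1 (Ordinal lt_m)) //= coefXn eqxx mul1r big1 ?addr0 //.
by move=> i /negPf; rewrite -val_eqE /= coefXn => ->; rewrite mul0r.
Qed.

End FpsRing.

Section FpsUnit.
Variable F : fieldType.
Implicit Types f g : fps F.

Lemma fps_coef_expr0 f n m :
  fps_coef f 0 = 0 -> (m < n)%N -> fps_coef (f ^+ n) m = 0.
Proof.
move=> f0 lt_m; pose g := Fps (fun i => fps_coef f i.+1).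
have -> : f = fpsX F ^+ 1 * g.
  by apply: fpsP => -[|i]; rewrite fps_coef_shift /= ?subn1.
by rewrite expr1 exprMn coef_fpsXnM.
Qed.

Lemma fps_inverse f : fps_coef f 0 != 0 -> exists g, g * f = 1.
Proof.
move=> f0; pose c := (fps_coef f 0)^-1; pose h := 1 - fpsC c * f.
have h0 : fps_coef h 0 = 0.
  by rewrite fps_coefD fps_coefN fps_coefCM fps_coef1 mulVf // subrr.
pose S m := \sum_(k < m) h ^+ k.
have S_stable n m : (n < m)%N -> fps_coef (S m) n = fps_coef (S n.+1) n.
  move=> /subnKC <-; elim: (m - n.+1)%N => [|d IHd]; first by rewrite addn0.
  by rewrite addnS /S big_ord_recr fps_coefD IHd fps_coef_expr0 ?addr0 // leq_addr.
pose g := Fps (fun n => fps_coef (S n.+1) n); exists (fpsC c * g).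
rewrite mulrAC; have -> : fpsC c * f = 1 - h by rewrite /h opprB addrC subrK.
have S_geom m : (1 - h) * S m = 1 - h ^+ m.
  by rewrite -opprB mulNr -subrX1 opprB.
apply: fpsP => n; transitivity (fps_coef ((1 - h) * S n.+1) n).
  rewrite !fps_coefM; apply: eq_bigr => i _; congr (_ * _).
  by rewrite [LHS]/= [RHS]S_stable // ltnS leq_subr.
by rewrite S_geom fps_coefD fps_coefN fps_coef_expr0 // subr0.
Qed.

End FpsUnit.

Local Notation "x %:F" := (@FracField.tofrac _ x).
Local Notation t := tvar.

Lemma tvar_neq0 : t != 0.
Proof.
rewrite tofrac_eq0; apply/eqP => /(congr1 (fun f => fps_coef f 1)) /eqP.
by rewrite fps_coef0 oner_eq0.
Qed.

Lemma frac_denom (R : idomainType) (x : {fraction R}) :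
  exists n d : R, d != 0 /\ x * d%:F = n%:F.
Proof.
elim/quotW: x => x; exists (frac x).1, (frac x).2; split; first exact: denom_ratioP.
unlock FracField.tofrac; rewrite -[LHS]FracField.pi_mul; apply/eqmodP.
rewrite /= FracField.equivfE /FracField.mulf.
by rewrite !numden_Ratio ?(oner_neq0, mulf_neq0, denom_ratioP) // !mulr1 mulrC.
Qed.

(** A denominator is a power of t times a series with nonzero constant term.  This
    bounds the factors of a product, so that limits can be multiplied. *)
Lemma K_bounded (x : K) : exists p (f : fps rat), t ^+ p * x = f%:F.
Proof.
have [a [b [b_neq0 xb]]] := frac_denom x.
have [m bm min_m] : exists2 m, fps_coef b m != 0 & forall i, (i < m)%N -> fps_coef b i = 0.
  have exb : exists n, fps_coef b n != 0.
    apply: contrapT => nex; case/eqP: b_neq0; apply: fpsP => n /=.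
    by apply/eqP/negPn/negP => bn; apply: nex; exists n.
  case: (ex_minnP exb) => m bm min_m; exists m => // i lt_i.
  by apply/eqP; apply: contraLR lt_i; rewrite -leqNgt; apply: min_m.
pose b' := Fps (fun i => fps_coef b (i + m)%N).
have bE : b = fpsX rat ^+ m * b'.
  apply: fpsP => n; rewrite fps_coef_shift; case: leqP => [le_m|/min_m //].
  by rewrite /= subnK.
have [g gb] : exists g, g * b' = 1 by apply: fps_inverse.
exists m, (a * g); have -> : (a * g)%:F = x * b%:F * g%:F by rewrite xb -rmorphM.
have -> : b%:F = t ^+ m * b'%:F by rewrite bE rmorphM rmorphXn.
rewrite -!mulrA [x * _]mulrC -!mulrA; congr (_ * _).
by rewrite mulrA -rmorphM [b' * g]mulrC gb rmorph1 mul1r.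
Qed.

Lemma qhalf_neq0 : qhalf != 0.
Proof. by rewrite invr_neq0 // tvar_neq0. Qed.

Lemma tvarX_inj m n : t ^+ m = t ^+ n -> m = n.
Proof.
rewrite -!rmorphXn => /eqP; rewrite tofrac_eq => /eqP /(congr1 (fun f => fps_coef f m)).
rewrite -[X in fps_coef X _]mulr1 -[X in _ = fps_coef X _]mulr1 !fps_coef_shift.
rewrite leqnn subnn fps_coef1 eqxx; case: leqP => [le_n|_ /eqP]; last by rewrite oner_eq0.
rewrite fps_coef1 subn_eq0; case: leqP => [le_m _|_ /eqP]; last by rewrite oner_eq0.
by apply/eqP; rewrite eqn_leq le_m.
Qed.

Section Limits.
Implicit Types (u v : nat -> K) (x y : K).

Definition tadic m x := exists f : fps rat, x = t ^+ m * f%:F.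

Lemma tadicD m x y : tadic m x -> tadic m y -> tadic m (x + y).
Proof. by case=> f -> [g ->]; exists (f + g); rewrite rmorphD mulrDr. Qed.

Lemma tadicM m n x y : tadic m x -> tadic n y -> tadic (m + n) (x * y).
Proof. by case=> f -> [g ->]; exists (f * g); rewrite rmorphM exprD mulrACA. Qed.

Lemma tadicW m n x : (m <= n)%N -> tadic n x -> tadic m x.
Proof.
move=> le_mn [f ->]; exists (fpsX rat ^+ (n - m) * f).
by rewrite rmorphM rmorphXn mulrA -exprD subnKC.
Qed.

Lemma cvgK_eventually u v x n0 : (forall n, (n0 <= n)%N -> u n = v n) ->
  converges_to u x -> converges_to v x.
Proof.
move=> eq_uv ux m; have [n1 ux_n1] := ux m; exists (maxn n0 n1) => n.
by rewrite geq_max => /andP[le_n0 le_n1]; rewrite -eq_uv //; apply: ux_n1.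
Qed.

Lemma cvgK_cst x : converges_to (fun=> x) x.
Proof. by move=> m; exists 0%N => n _; exists 0; rewrite rmorph0 mulr0 subrr. Qed.

Lemma cvgKD u v x y : converges_to u x -> converges_to v y ->
  converges_to (fun n => u n + v n) (x + y).
Proof.
move=> ux vy m; have [n0 ux_n0] := ux m; have [n1 vy_n1] := vy m.
exists (maxn n0 n1) => n; rewrite geq_max => /andP[le_n0 le_n1].
by rewrite opprD addrACA; apply: tadicD; [apply: ux_n0 | apply: vy_n1].
Qed.

Lemma cvgKM u v x y : converges_to u x -> converges_to v y ->
  converges_to (fun n => u n * v n) (x * y).
Proof.
move=> ux vy m; have [p [f xE]] := K_bounded x; have [r [g yE]] := K_bounded y.
have [n0 ux_n0] := ux (m + r)%N; have [n1 vy_n1] := vy (m + p)%N.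
exists (maxn n0 n1) => n; rewrite geq_max => /andP[le_n0 le_n1].
have [f1 uE] := ux_n0 n le_n0; have [g1 vE] := vy_n1 n le_n1.
have -> : u n * v n - x * y =
  (u n - x) * (v n - y) + x * (v n - y) + (u n - x) * y by ring.
rewrite uE vE; apply: tadicD; first apply: tadicD.
- apply: (@tadicW m (m + r + (m + p))%N); first by lia.
  by apply: tadicM; [exists f1 | exists g1].
- exists (f * g1); have -> : (f * g1)%:F = t ^+ p * x * g1%:F by rewrite xE -rmorphM.
  by rewrite exprD; ring.
- exists (g * f1); have -> : (g * f1)%:F = t ^+ r * y * f1%:F by rewrite yE -rmorphM.
  by rewrite exprD; ring.
Qed.

Lemma cvgK_sum I (r : seq I) (P : pred I) (u : I -> nat -> K) (x : I -> K) :
  (forall i, P i -> converges_to (u i) (x i)) ->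
  converges_to (fun n => \sum_(i <- r | P i) u i n) (\sum_(i <- r | P i) x i).
Proof.
move=> ux; elim: r => [|i r IHr].
  by apply: (@cvgK_eventually (fun=> 0) _ _ 0%N) => [n _|]; rewrite ?big_nil //;
    apply: cvgK_cst.
have [Pi|nPi] := boolP (P i).
  apply: (cvgK_eventually (n0 := 0%N) _ (_ : converges_to _ _)); last first.
    by rewrite big_cons Pi; apply: cvgKD (ux i Pi) IHr.
  by move=> n _; rewrite big_cons Pi.
rewrite big_cons (negPf nPi); apply: cvgK_eventually IHr => n _.
by rewrite big_cons (negPf nPi).
Unshelve. exact: 0%N.
Qed.

Lemma cvgK_prod I (r : seq I) (u : I -> nat -> K) (x : I -> K) :
  (forall i, converges_to (u i) (x i)) ->
  converges_to (fun n => \prod_(i <- r) u i n) (\prod_(i <- r) x i).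
Proof.
move=> ux; elim: r => [|i r IHr].
  by apply: (@cvgK_eventually (fun=> 1) _ _ 0%N) => [n _|]; rewrite ?big_nil //;
    apply: cvgK_cst.
rewrite big_cons; apply: cvgK_eventually (cvgKM (ux i) IHr) => n _.
by rewrite big_cons.
Unshelve. exact: 0%N.
Qed.

Lemma cvgK_det m (A : nat -> 'M[K]_m) (B : 'M[K]_m) :
  (forall i j, converges_to (fun n => A n i j) (B i j)) ->
  converges_to (fun n => \det (A n)) (\det B).
Proof.
move=> AB; apply: cvgK_sum => s _; apply: cvgKM; first exact: cvgK_cst.
by apply: cvgK_prod.
Qed.

Lemma cvgK_tadic u x (e : nat -> nat) : (forall n, tadic (e n) (u n - x)) ->
  (forall n, (n <= e n)%N) -> converges_to u x.
Proof.
move=> ux le_e m; exists m => n le_n; apply: tadicW (ux n).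
exact: leq_trans le_n (le_e n).
Qed.

End Limits.

(** * The specialized complete symmetric functions *)

(** The generating series of the complete symmetric polynomials in x_0, ..., x_(n-1). *)
Definition genH (x : nat -> K) (n : nat) : fps K := \prod_(i < n) geo (x i).

(** h_k(q^rho), in the product form given by the q-binomial theorem. *)
Definition hrho (k : nat) : K := \prod_(i < k) (t / (1 - t ^+ (2 * i.+1))).

Lemma tvar1X_neq0 n : (0 < n)%N -> 1 - t ^+ n != 0.
Proof.
by rewrite subr_eq0 -(expr0 t) => n_gt0; apply/eqP => /tvarX_inj; case: n n_gt0.
Qed.

Lemma part_empty i : part empty_part i = 0%N.
Proof. exact: nth_nil. Qed.

Lemma qrho_empty i : qrho empty_part i = t ^+ (2 * i).+1.
Proof.
rewrite /qrho part_empty /qhalf exprz_inv.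
by have -> : - (2 * 0%:Z - 2 * i%:Z - 1) = (2 * i).+1%:Z by lia.
Qed.

Lemma lin_neq0 (c : K) : lin c != 0.
Proof.
by apply: contra_eq_neq (lin_geo c) => ->; rewrite mul0r eq_sym oner_neq0.
Qed.

(** Multiplying u by t^2 shifts the list of variables q^rho by one place, which gives a
    functional equation for the generating series. *)
Lemma genH_rho_rec n k :
  (1 - t ^+ (2 * k.+1)) * fps_coef (genH (qrho empty_part) n) k.+1 =
    t * (1 - t ^+ (2 * (n + k))) * fps_coef (genH (qrho empty_part) n) k.
Proof.
set G := genH _ n; have G_rec : lin t * G = lin (t ^+ (2 * n).+1) * fscale (t ^+ 2) G.
  suff eq_G : lin t * (G * geo (t ^+ (2 * n).+1)) = fscale (t ^+ 2) G.
    by rewrite -eq_G -[in LHS](mulr1 G) -(lin_geo (t ^+ (2 * n).+1)); ring.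
  have -> : G * geo (t ^+ (2 * n).+1) = genH (qrho empty_part) n.+1.
    by rewrite /genH big_ord_recr /= qrho_empty.
  rewrite /genH big_ord_recl fscale_prod qrho_empty expr1 mulrA lin_geo mul1r.
  apply: eq_bigr => i _; rewrite fscale_geo !qrho_empty -exprD.
  by congr (geo (t ^+ _)); rewrite /= /bump; lia.
have := congr1 (fun f => fps_coef f k.+1) G_rec.
rewrite !fps_coef_lin /= -!exprM => /eqP; rewrite subr_eq => /eqP G_k.
rewrite mulrBl mul1r {1}G_k.
have -> : (2 * (n + k) = 2 * n + 2 * k)%N by lia.
by rewrite exprS exprD; ring.
Qed.

Fact genH_step (F : fieldType) (b x y G : F) :
  b != 0 -> y * x * G = b * (G * (y / b * x)).
Proof. by move=> b_neq0; field. Qed.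

Fact hrho_step (F : fieldType) (b y h : F) :
  1 - b != 0 -> b * (h * (y / (1 - b))) = h * (y / (1 - b)) - y * h.
Proof. by move=> b_neq0; field. Qed.

Lemma genH_rho n k : fps_coef (genH (qrho empty_part) n) k =
  \prod_(i < k) (t / (1 - t ^+ (2 * i.+1)) * (1 - t ^+ (2 * (n + i)))).
Proof.
elim: k => [|k IHk].
  rewrite big_ord0 /genH; elim: n => [|n IHn]; first by rewrite big_ord0.
  by rewrite big_ord_recr fps_coef_geo addr0.
rewrite big_ord_recr /= -IHk; apply: (@mulfI _ (1 - t ^+ (2 * k.+1))).
  by rewrite tvar1X_neq0 // muln_gt0.
rewrite genH_rho_rec; set b := 1 - t ^+ (2 * k.+1); set G := fps_coef _ _.
have b_neq0 : b != 0 by rewrite tvar1X_neq0 // muln_gt0.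
exact: genH_step.
Qed.

Definition Hrho : fps K := Fps hrho.

(** The generating series of the h_k(q^(mu + rho)).  The variables differ from q^rho
    only at the rows of mu, hence the finite product. *)
Definition Hq (mu : intpart) : fps K :=
  Hrho * \prod_(i < size mu) (lin (qrho empty_part i) * geo (qrho mu i)).

Lemma genH_rho_cvg k :
  converges_to (fun n => fps_coef (genH (qrho empty_part) n) k) (hrho k).
Proof.
apply: (cvgK_eventually (u := fun n =>
  \prod_(i < k) (t / (1 - t ^+ (2 * i.+1)) * (1 - t ^+ (2 * (n + i)))))).
  by move=> n _; rewrite genH_rho.
rewrite /hrho; apply: cvgK_prod => i.
rewrite -[X in converges_to _ X]mulr1; apply: cvgKM; first exact: cvgK_cst.
apply: (@cvgK_tadic _ _ (fun n => 2 * (n + i))%N) => n; last by lia.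
by exists (-1); rewrite rmorphN rmorph1 addrAC subrr sub0r mulrN1.
Unshelve. exact: 0%N.
Qed.

Lemma qrho_default (mu : intpart) i : (size mu <= i)%N -> qrho mu i = qrho empty_part i.
Proof. by move=> le_i; rewrite /qrho part_default ?part_empty. Qed.

Lemma big_ord_skip (V : comRingType) (m n : nat) (F : nat -> V) : (m <= n)%N ->
  (forall i, (m <= i)%N -> F i = 1) -> \prod_(i < n) F i = \prod_(i < m) F i.
Proof.
move=> le_mn F1; rewrite -!(big_mkord xpredT) (big_cat_nat _ (n := m)) //=.
rewrite [X in _ * X]big_nat [X in _ * X]big1 ?mulr1 // => i /andP[le_i _].
exact: F1.
Qed.

Lemma Hq_widen (mu : intpart) n : (size mu <= n)%N ->
  Hq mu = Hrho * \prod_(i < n) (lin (qrho empty_part i) * geo (qrho mu i)).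
Proof.
move=> le_n; congr (_ * _); apply/esym.
apply: (big_ord_skip (F := fun i => lin (qrho empty_part i) * geo (qrho mu i))) => //.
by move=> i le_i; rewrite qrho_default // lin_geo.
Qed.

Lemma Hq_lin (mu : intpart) n : (size mu <= n)%N ->
  Hq mu * \prod_(i < n) lin (qrho mu i) =
    Hrho * \prod_(i < n) lin (qrho empty_part i).
Proof.
move=> /Hq_widen ->; rewrite -mulrA -big_split; congr (_ * _).
by apply: eq_bigr => i _ /=; rewrite -mulrA [geo _ * _]mulrC lin_geo mulr1.
Qed.

Lemma genH_cvg mu k :
  converges_to (fun n => fps_coef (genH (qrho mu) n) k) (fps_coef (Hq mu) k).
Proof.
set C := \prod_(i < size mu) (lin (qrho empty_part i) * geo (qrho mu i)).
apply: (cvgK_eventually (n0 := size mu)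
  (u := fun n => fps_coef (genH (qrho empty_part) n * C) k)) => [n le_n|].
  congr (fps_coef _ k); rewrite /C -(@big_ord_skip _ _ n
    (fun i => lin (qrho empty_part i) * geo (qrho mu i))) //.
    rewrite /genH -big_split; apply: eq_bigr => i _ /=.
    by rewrite mulrA [geo _ * _]mulrC lin_geo mul1r.
  by move=> i le_i; rewrite qrho_default // lin_geo.
rewrite /Hq -/C fps_coefM; under eq_fun => n do rewrite fps_coefM.
apply: cvgK_sum => i _; apply: cvgKM; [exact: genH_rho_cvg | exact: cvgK_cst].
Qed.

(** A single variable changes, from q^(c - 1/2) to q^(c + 1/2). *)
Lemma Hq_addrow mu i : addable mu i ->
  let c : int := (part mu i)%:Z - i%:Z in
  Hq (addrow mu i) * lin (qhalf ^ (2 * c + 1)) = Hq mu * lin (qhalf ^ (2 * c - 1)).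
Proof.
move=> add_i /=; set c := _ - _; set ga := addrow mu i.
pose n := maxn i.+1 (maxn (size ga) (size mu)).
have lt_in : (i < n)%N by rewrite /n; lia.
have eq_H : Hq ga * \prod_(j < n) lin (qrho ga j) = Hq mu * \prod_(j < n) lin (qrho mu j).
  by rewrite !Hq_lin // /n; lia.
move: eq_H; rewrite (bigD1 (Ordinal lt_in)) //= [in RHS](bigD1 (Ordinal lt_in)) //=.
have -> : qrho mu i = qhalf ^ (2 * c - 1) by congr (_ ^ _); rewrite /c; lia.
have -> : qrho ga i = qhalf ^ (2 * c + 1).
  by congr (_ ^ _); rewrite /c part_addrow // eqxx; lia.
have -> : \prod_(j < n | j != Ordinal lt_in) lin (qrho ga j) =
          \prod_(j < n | j != Ordinal lt_in) lin (qrho mu j).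
  apply: eq_bigr => j; rewrite -val_eqE /= => ne_j.
  by rewrite /qrho part_addrow // (negPf ne_j) addn0.
rewrite !mulrA; apply: mulIf.
by apply/prodf_neq0 => j _; apply: lin_neq0.
Qed.

Lemma Hrho_scale : fscale (t ^+ 2) Hrho = lin t * Hrho.
Proof.
apply: fpsP => -[|k]; rewrite fps_coef_lin /=; first by rewrite mul1r subr0.
rewrite /hrho big_ord_recr /= -/(hrho k) -exprM.
set b := t ^+ _; have b_neq0 : 1 - b != 0 by rewrite tvar1X_neq0 // muln_gt0.
exact: hrho_step.
Qed.

(** * Horizontal strips and determinants in the beta-numbers *)

Section Rectangle.
Implicit Types (la mu nu eta : intpart).

(** All partitions in an n by m rectangle: a finite range for sums over partitions. *)
Definition rect n m : seq intpart :=
  undup [seq mkpart n (fun i => if insub i is Some k then f k : nat else 0%N)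
        | f : {ffun 'I_n -> 'I_m.+1}].

Lemma rect_uniq n m : uniq (rect n m).
Proof. exact: undup_uniq. Qed.

Lemma mem_rect n m la : (size la <= n)%N -> (part la 0 <= m)%N -> la \in rect n m.
Proof.
move=> le_n le_m; rewrite mem_undup; apply/mapP.
have le_m' i : (part la i < m.+1)%N by rewrite ltnS (leq_trans (part_geq la (leq0n i))).
exists [ffun i : 'I_n => Ordinal (le_m' i)]; first by rewrite mem_enum.
apply: part_inj => i.
set f := fun _ => _; have fE k : (k < n)%N -> f k = part la k.
  by move=> lt_k; rewrite /f insubT ffunE.
rewrite part_mkpart => [|k lt_k]; last by rewrite !fE ?part_geq // ltnW.
by case: ltnP => [/fE //|le_i]; rewrite part_default // (leq_trans le_n).
Qed.

Definition hstrip la nu :=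
  part_incl nu la && all (fun i => part la i.+1 <= part nu i)%N (iota 0 (size la)).

Lemma hstripP la nu :
  reflect (forall i, part la i.+1 <= part nu i <= part la i)%N (hstrip la nu).
Proof.
apply: (iffP andP) => [[/part_inclP le_nu /allP le_la] i|strip].
  rewrite le_nu andbT; have [lt_i|le_i] := ltnP i (size la).
    by apply: le_la; rewrite mem_iota.
  by rewrite part_default // (leq_trans le_i).
split; first by apply/part_inclP => i; case/andP: (strip i).
by apply/allP => i _; case/andP: (strip i).
Qed.

Lemma size_part_incl la mu : part_incl la mu -> (size la <= size mu)%N.
Proof.
move/part_inclP=> le_lm; rewrite leqNgt; apply/negP; rewrite -part_gt0.
by rewrite ltnNge (leq_trans (le_lm _)) // part_default.
Qed.

Lemma psize_sum n la : (size la <= n)%N -> psize la = (\sum_(i < n) part la i)%N.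
Proof.
move=> le_n; rewrite -(big_mkord xpredT) (big_cat_nat _ (n := size la)) //=.
rewrite [X in (_ + X)%N]big_nat [X in (_ + X)%N]big1 => [|i /andP[le_i _]]; last exact: part_default.
by rewrite addn0 /psize sumnE (big_nth 0%N).
Qed.

(** The beta-numbers of la.  They decrease strictly, and adding a box in row i raises
    the i-th one by one. *)
Definition beta n la (i : nat) : nat := (part la i + (n - i.+1))%N.

(** Determinants in the beta-numbers (Slater determinants).  Jacobi-Trudi determinants
    and the vertex are of this form for suitable series [Phi]. *)
Definition slater n (Phi : 'I_n -> fps K) la : K :=
  \det (\matrix_(i < n, j < n) fps_coef (Phi j) (beta n la i)).
Global Arguments slater n Phi la : clear implicits.

Lemma fps_coef_geo_sum (f : fps K) x a :
  fps_coef (f * geo x) a = \sum_(c < a.+1) x ^+ (a - c) * fps_coef f c.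
Proof. by rewrite fps_coefM; apply: eq_bigr => c _; rewrite mulrC. Qed.

(** The factor 1/(1 - x u) amounts to a new variable x.  Once the row operations have
    restricted the convolutions, the choice of one term in each row is the choice of
    the beta-numbers of a partition obtained by removing a horizontal strip. *)
Lemma slater_branch n m (Phi : 'I_n -> fps K) x la :
    (size la <= n)%N -> (part la 0 <= m)%N ->
  slater n (fun j => Phi j * geo x) la =
    \sum_(nu <- rect n m | hstrip la nu) x ^+ (psize la - psize nu) * slater n Phi nu.
Proof.
move=> le_n le_m.
pose lo i := (part la i.+1 + (n - i.+1))%N; pose M := (m + n)%N.
have beta_lt i : (beta n la i < M.+1)%N.
  by rewrite /beta /M; have := part_geq la (leq0n i); lia.
pose w (i : 'I_n) (c : 'I_M.+1) : K :=
  if (lo i <= c <= beta n la i)%N then x ^+ (beta n la i - c) else 0.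
transitivity (\det (\matrix_(i < n, j < n) \sum_c w i c * fps_coef (Phi j) (c : nat))).
  transitivity (\det (\matrix_(i < n, j < n) \sum_(0 <= c < (beta n la i).+1)
      x ^+ (beta n la i - c) * fps_coef (Phi j) c)).
    congr (\det _); apply/matrixP => i j; rewrite mxE [RHS]mxE.
    by rewrite fps_coef_geo_sum big_mkord.
  rewrite (@det_geometric_rows _ n (fun c j => fps_coef (Phi j) c) x (beta n la) lo); last first.
  - by move=> i eq_n; rewrite /lo eq_n subnn addn0 part_default.
  - move=> i lt_i; rewrite /lo /beta; have := part_geq la (leqnSn i).
    by split; lia.
  congr (\det _); apply/matrixP => i j; rewrite mxE [RHS]mxE.
  rewrite big_geq_mkord /= (big_ord_widen_cond M.+1 (fun c => lo i <= c)%N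
    (fun c => x ^+ (beta n la i - c) * fps_coef (Phi j) c)) // [LHS]big_mkcond /=.
  by apply: eq_bigr => c _; rewrite /w ltnS; case: ifP; rewrite ?mul0r.
rewrite det_sum_rows.
pose cof nu : {ffun 'I_n -> 'I_M.+1} := [ffun i : 'I_n => inord (beta n nu i)].
have cofE nu i : part_incl nu la -> cof nu i = beta n nu i :> nat.
  move/part_inclP=> le_nu; rewrite ffunE inordK //; apply: leq_ltn_trans (beta_lt i).
  by rewrite leq_add2r.
pose ok (f : {ffun 'I_n -> 'I_M.+1}) := [forall i : 'I_n, lo i <= f i <= beta n la i]%N.
transitivity (\sum_(f | ok f) (\prod_i w i (f i)) *
    \det (\matrix_(i, j) fps_coef (Phi j) (f i : nat))).
  rewrite [RHS]big_mkcond; apply: eq_bigr => f _; case: ifP => // /negbT.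
  by case/forallPn=> i /negPf nle; rewrite (bigD1 i) //= /w nle !mul0r.
have perm_f : perm_eq [seq f <- index_enum {ffun 'I_n -> 'I_M.+1} | ok f]
    [seq cof nu | nu <- rect n m & hstrip la nu].
  apply: uniq_perm; first by rewrite filter_uniq ?index_enum_uniq.
    rewrite map_inj_in_uniq ?filter_uniq ?rect_uniq // => nu nu'.
    rewrite !mem_filter => /andP[/andP[sub_nu _] _] /andP[/andP[sub_nu' _] _] eq_c.
    apply: part_inj => i; have [lt_i|le_i] := ltnP i n; last first.
      have le_la := leq_trans le_n le_i.
      rewrite (part_default (leq_trans (size_part_incl sub_nu) le_la)).
      by rewrite (part_default (leq_trans (size_part_incl sub_nu') le_la)).
    have := congr1 (fun f : {ffun 'I_n -> 'I_M.+1} => f (Ordinal lt_i) : nat) eq_c.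
    by rewrite /= !cofE // /beta /=; lia.
  move=> f; rewrite mem_filter mem_index_enum andbT.
  apply/forallP/mapP => [ok_f|[nu]]; last first.
    rewrite mem_filter => /andP[/andP[sub_nu +] _] -> i.
    move=> /(conj sub_nu)/andP/hstripP/(_ i); rewrite cofE // /lo /beta; lia.
  pose p k := if insub k is Some i then (f i - (n - (i : 'I_n).+1))%N else 0%N.
  have pE (i : 'I_n) : p i = (f i - (n - i.+1))%N by rewrite /p valK.
  have p_strip i : (part la i.+1 <= p i <= part la i)%N.
    have [lt_i|le_i] := ltnP i n; last first.
      by rewrite /p insubN -?leqNgt // !part_default ?(leq_trans le_n) // ltnW.
    by have := ok_f (Ordinal lt_i); have := pE (Ordinal lt_i); rewrite /lo /beta /=; lia.
  have nuE i : part (mkpart n p) i = p i.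
    rewrite part_mkpart => [|j _]; last by have := p_strip j; have := p_strip j.+1; lia.
    by case: ltnP => // le_i; rewrite /p insubN -?leqNgt.
  have nu_strip : hstrip la (mkpart n p) by apply/hstripP => i; rewrite nuE.
  have sub_nu : part_incl (mkpart n p) la by case/andP: nu_strip.
  exists (mkpart n p).
    rewrite mem_filter nu_strip mem_rect //; first exact: leq_trans (size_part_incl sub_nu) _.
    by rewrite (leq_trans _ le_m) //; move/part_inclP: sub_nu.
  apply/ffunP => i; apply/val_inj; rewrite /= cofE // /beta nuE pE.
  by rewrite subnK //; have /andP[+ _] := ok_f i; apply: leq_trans; rewrite leq_addl.
rewrite -big_filter (perm_big _ perm_f) big_map big_filter.
apply: eq_bigr => nu /andP[sub_nu]; move=> /(conj sub_nu)/andP/hstripP strip.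
congr (_ * _); last first.
  by congr (\det _); apply/matrixP => i j; rewrite !mxE cofE.
transitivity (\prod_(i < n) x ^+ (part la i - part nu i)).
  apply: eq_bigr => i _; rewrite /w cofE // ifT; last by have := strip i; rewrite /lo /beta; lia.
  by congr (_ ^+ _); rewrite /beta; lia.
have le_nu : (size nu <= n)%N := leq_trans (size_part_incl sub_nu) le_n.
rewrite -expr_sum (psize_sum le_n) (psize_sum le_nu) -sumnB // => i _.
by case/andP: (strip i).
Qed.

End Rectangle.

(** * Tableaux and the Jacobi-Trudi formula *)

Section Tableaux.
Implicit Types (la mu nu eta : intpart).

Lemma mem_skew_boxes la eta i j :
  ((i, j) \in skew_boxes la eta) = (part eta i <= j < part la i)%N.
Proof. by rewrite mem_filter !mem_boxes -leqNgt. Qed.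

Lemma uniq_skew_boxes la eta : uniq (skew_boxes la eta).
Proof. by rewrite filter_uniq ?uniq_boxes. Qed.

Lemma size_skew_boxes la eta : part_incl eta la ->
  size (skew_boxes la eta) = (psize la - psize eta)%N.
Proof.
move=> /part_inclP le_el; rewrite !psizeE.
have -> : size (boxes eta) = size [seq b <- boxes la | b \in boxes eta].
  apply/perm_size/uniq_perm; rewrite ?filter_uniq ?uniq_boxes // => -[i j].
  by rewrite mem_filter !mem_boxes; have := le_el i; lia.
by rewrite !size_filter -(count_predC [in boxes eta] (boxes la)) addKn.
Qed.

Lemma prod_seq_sub (s : seq (nat * nat)) (F : nat * nat -> K) : uniq s ->
  \prod_(b : seq_sub s) F (val b) = \prod_(b <- s) F b.
Proof.
move=> uniq_s; rewrite -(big_map val xpredT F); apply/perm_big/uniq_perm => //.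
  by rewrite map_inj_uniq ?index_enum_uniq //; apply: val_inj.
move=> b; apply/mapP/idP => [[b' _ ->]|bs]; first exact: (ssvalP b').
by exists (SeqSub bs); rewrite ?mem_index_enum.
Qed.

Section Fillings.
Variables (N : nat) (la eta : intpart).
Implicit Types (T : filling N la eta).

Definition entry T (b : nat * nat) : nat :=
  if insub b is Some b' then T b' else 0%N.

Lemma entry_val T (b : seq_sub (skew_boxes la eta)) : entry T (val b) = T b.
Proof. by rewrite /entry valK. Qed.

Lemma entry_lt T b : b \in skew_boxes la eta -> (entry T b < N)%N.
Proof. by move=> b_s; rewrite -[b]/(val (SeqSub b_s)) entry_val. Qed.

Lemma entry_inj T T' :
  {in skew_boxes la eta, entry T =1 entry T'} -> T = T'.
Proof.
move=> eqT; apply/ffunP => b; apply: val_inj.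
by rewrite /= -!entry_val eqT ?(ssvalP b).
Qed.

Lemma prod_entry T (x : nat -> K) :
  \prod_b x (T b) = \prod_(b <- skew_boxes la eta) x (entry T b).
Proof.
rewrite -(prod_seq_sub (fun b => x (entry T b)) (uniq_skew_boxes la eta)).
by apply: eq_bigr => b _; rewrite entry_val.
Qed.

Lemma semistandardP T : reflect
  (forall i j i' j', (i, j) \in skew_boxes la eta -> (i', j') \in skew_boxes la eta ->
     (i = i' -> (j < j')%N -> (entry T (i, j) <= entry T (i', j'))%N) /\
     (j = j' -> (i < i')%N -> (entry T (i, j) < entry T (i', j'))%N))
  (semistandard T).
Proof.
apply: (iffP forallP) => [ssT i j i' j' b_s c_s|ssT [[i j] b_s]].
  have /forallP/(_ (SeqSub c_s))/andP[/= row col] := ssT (SeqSub b_s).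
  rewrite -[(i, j)]/(val (SeqSub b_s)) -[(i', j')]/(val (SeqSub c_s)) !entry_val.
  by split=> [eqi lt_j|eqj lt_i]; [apply: (implyP row) | apply: (implyP col)];
    rewrite ?eqi ?eqj eqxx.
apply/forallP => -[[i' j'] c_s] /=; have [row col] := ssT i j i' j' b_s c_s.
rewrite -(entry_val T (SeqSub b_s)) -(entry_val T (SeqSub c_s)).
by apply/andP; split; apply/implyP => /andP[/eqP]; [apply: row | apply: col].
Qed.

Lemma exists_filling (f : nat * nat -> nat) :
  (forall b, b \in skew_boxes la eta -> (f b < N)%N) ->
  exists T, {in skew_boxes la eta, entry T =1 f}.
Proof.
move=> lt_f; exists [ffun b => Ordinal (lt_f _ (ssvalP b))] => b b_s.
by rewrite -[b]/(val (SeqSub b_s)) entry_val ffunE.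
Qed.

End Fillings.

Lemma initial_segment (P : pred nat) m :
  (forall j j', (j' <= j)%N -> (j < m)%N -> P j -> P j') ->
  exists2 c, (c <= m)%N & forall j, (j < m)%N -> P j = (j < c)%N.
Proof.
elim: m => [|m IHm] downP; first by exists 0%N.
have [c le_c Pc] := IHm (fun j j' le_j lt_j => downP j j' le_j (ltnW lt_j)).
have [Pm|nPm] := boolP (P m).
  by exists m.+1 => // j lt_j; rewrite lt_j; apply: downP Pm.
exists c => [|j]; first exact: leqW.
rewrite ltnS leq_eqVlt => /predU1P[->|/Pc //].
by rewrite (negPf nPm) ltnNge le_c.
Qed.

Section Branching.
Variables (N : nat) (la eta : intpart).
Hypothesis incl_eta : part_incl eta la.

(** [nu] is the union of [eta] and of the boxes of [T] with an entry below [N]. *)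
Definition below (T : filling N.+1 la eta) nu :=
  [&& part_incl eta nu, hstrip la nu
    & all (fun b => (entry T b < N)%N == (b \in boxes nu)) (skew_boxes la eta)].

Lemma belowP (T : filling N.+1 la eta) nu i j : below T nu ->
  (part eta i <= j < part la i)%N -> (entry T (i, j) < N)%N = (j < part nu i)%N.
Proof.
case/and3P=> _ _ /allP; rewrite -mem_skew_boxes => lowT /lowT /eqP ->.
exact: mem_boxes.
Qed.

Lemma below_unique (T : filling N.+1 la eta) nu nu' :
  below T nu -> below T nu' -> nu = nu'.
Proof.
move=> low low'; apply: part_inj => i; apply: eq_ltnl => j.
have [/part_inclP/(_ i) le_eta /hstripP/(_ i) strip _] := and3P low.
have [/part_inclP/(_ i) le_eta' /hstripP/(_ i) strip' _] := and3P low'.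
have [le_j|lt_j] := leqP (part eta i) j; last by lia.
have [lt_j|ge_j] := ltnP j (part la i); last by lia.
by rewrite -(belowP low) ?(belowP low') ?le_j.
Qed.

(** Since the rows of [T] increase, the boxes with an entry below [N] begin each row;
    since the columns increase strictly, those with entry [N] form a horizontal strip. *)
Lemma below_exists (T : filling N.+1 la eta) : semistandard T ->
  exists nu, below T nu.
Proof.
move/semistandardP=> ssT; move/part_inclP: (incl_eta) => le_eta.
pose P i j := (j < part eta i)%N || (entry T (i, j) < N)%N.
have rowT i j j' : (part eta i <= j)%N -> (j <= j')%N -> (j' < part la i)%N ->
    (entry T (i, j) <= entry T (i, j'))%N.
  move=> le_j; rewrite leq_eqVlt => /predU1P[-> //|lt_j] lt_j'.
  by apply: (proj1 (ssT i j i j' _ _)) => //; rewrite mem_skew_boxes; lia.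
have colT i j : (part eta i <= j < part la i.+1)%N ->
    (entry T (i, j) < entry T (i.+1, j))%N.
  have := part_geq la (leqnSn i); have := part_geq eta (leqnSn i) => ? ? ?.
  by apply: (proj2 (ssT i j i.+1 j _ _)) => //; rewrite mem_skew_boxes; lia.
have ltT i j : (part eta i <= j < part la i)%N -> (entry T (i, j) < N.+1)%N.
  by rewrite -mem_skew_boxes; apply: entry_lt.
have /choice[c cP] i : exists c, (c <= part la i)%N /\
    forall j, (j < part la i)%N -> P i j = (j < c)%N.
  have [j j' le_j lt_j Pj|c le_c cP] := @initial_segment (P i) (part la i).
    move: Pj; rewrite /P; case: (ltnP j' (part eta i)) => //= le_j'.
    by have := rowT i j' j le_j' le_j lt_j; lia.
  by exists c.
have le_ec i : (part eta i <= c i)%N.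
  have [_ cPi] := cP i; rewrite leqNgt; apply/negP => lt_c.
  by have := cPi (c i) (leq_trans lt_c (le_eta i)); rewrite /P lt_c ltnn.
have c_lt i : (part la i.+1 <= c i)%N.
  have [_ cPi] := cP i; rewrite leqNgt; apply/negP => lt_c.
  have lt_la : (c i < part la i)%N := leq_trans lt_c (part_geq la (leqnSn i)).
  have := cPi (c i) lt_la; rewrite ltnn /P => /norP[_].
  have lt_T := colT i (c i); have := ltT i.+1 (c i); have := lt_T.
  by have := part_geq eta (leqnSn i); have := le_ec i; lia.
have nuE i : part (mkpart (size la) c) i = c i.
  rewrite part_mkpart => [|j _]; last by have := cP j.+1; have := c_lt j; lia.
  case: ltnP => // le_i; have := cP i; rewrite part_default // => -[].
  by rewrite leqn0 => /eqP ->.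
exists (mkpart (size la) c); apply/and3P; split.
- by apply/part_inclP => i; rewrite nuE.
- by apply/hstripP => i; rewrite nuE c_lt; case: (cP i).
apply/allP => -[i j]; rewrite mem_skew_boxes mem_boxes nuE => /andP[le_j lt_j].
by have [_ /(_ j lt_j) <-] := cP i; rewrite /P [(j < part eta i)%N]ltnNge le_j.
Qed.

(** Filling with [N] the boxes of the strip [la/nu]. *)
Lemma below_fillings nu (x : nat -> K) : hstrip la nu -> part_incl eta nu ->
  \sum_(T : filling N.+1 la eta | semistandard T && below T nu) \prod_b x (T b) =
  x N ^+ (psize la - psize nu) *
    \sum_(T : filling N nu eta | semistandard T) \prod_b x (T b).
Proof.
move=> strip_nu incl_nu.
have /part_inclP le_nu := incl_nu; have /hstripP strip := strip_nu.
have lt_ext (T : filling N nu eta) b : b \in skew_boxes la eta ->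
    ((if b \in boxes nu then entry T b else N) < N.+1)%N.
  case: b => i j; rewrite mem_skew_boxes mem_boxes => /andP[le_j _].
  case: (ltnP j (part nu i)) => // lt_j; rewrite ltnS ltnW // entry_lt // mem_skew_boxes.
  by rewrite le_j.
have /choice[ext extE] := fun T => exists_filling (lt_ext T).
have extE' T i j : (part eta i <= j < part la i)%N ->
    entry (ext T) (i, j) = if (j < part nu i)%N then entry T (i, j) else N.
  by rewrite -mem_skew_boxes -mem_boxes => /extE.
have ext_lt (T : filling N nu eta) i j : (part eta i <= j < part nu i)%N -> (entry T (i, j) < N)%N.
  by rewrite -mem_skew_boxes; apply: entry_lt.
have ext_inj : injective ext.
  move=> T T' eq_ext; apply: entry_inj => -[i j]; rewrite mem_skew_boxes => /andP[le_j lt_j].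
  have := extE' T i j; rewrite eq_ext extE' ?le_j ?lt_j.
    by move=> -> //; have := strip i; lia.
  by have := strip i; lia.
have ext_below T : below (ext T) nu.
  apply/and3P; split=> //; apply/allP => -[i j].
  rewrite mem_skew_boxes mem_boxes => ij; rewrite extE' //.
  case: (ltnP j (part nu i)) => [lt_j|_]; last by rewrite ltnn.
  by rewrite ext_lt //; move: ij; lia.
have ext_ss T : semistandard (ext T) = semistandard T.
  apply/semistandardP/semistandardP => ssT i j i' j'; rewrite !mem_skew_boxes => ij ij'.
    have ij_la : (part eta i <= j < part la i)%N by have := strip i; lia.
    have ij_la' : (part eta i' <= j' < part la i')%N by have := strip i'; lia.
    have [] := ssT i j i' j'; rewrite ?mem_skew_boxes // !extE' //.
    by case/andP: ij => _ ->; case/andP: ij' => _ ->.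
  rewrite !extE' //; split=> [eq_i lt_j|eq_j lt_i].
    subst i'; case: (ltnP j' (part nu i)) => [lt_j'|_]; last first.
      by case: (ltnP j (part nu i)) => // lt_nu; rewrite ltnW // ext_lt //; lia.
    rewrite ifT; last by lia.
    by apply: (proj1 (ssT i j i j' _ _)) => //; rewrite mem_skew_boxes; lia.
  subst j'; case: (ltnP j (part nu i')) => [lt_j'|ge_j'].
    have := part_geq nu (ltnW lt_i) => ?; rewrite ifT; last by lia.
    by apply: (proj2 (ssT i j i' j _ _)) => //; rewrite mem_skew_boxes; lia.
  have := part_geq la lt_i; have := strip i => ? ?.
  by rewrite ifT ?ext_lt //; lia.
have ext_onto (T : filling N.+1 la eta) : below T nu -> exists T', T = ext T'.
  move=> low; have [b b_s|T' T'E] := @exists_filling N nu eta (entry T).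
    case: b b_s => i j; rewrite mem_skew_boxes => ij.
    by rewrite (belowP low); have := strip i; lia.
  exists T'; apply: entry_inj => -[i j]; rewrite mem_skew_boxes => ij.
  rewrite extE' //; case: (ltnP j (part nu i)) => [lt_j|ge_j].
    by rewrite T'E // mem_skew_boxes; lia.
  have : ~~ (entry T (i, j) < N)%N by rewrite (belowP low) // -leqNgt.
  have : (entry T (i, j) < N.+1)%N by apply: entry_lt; rewrite mem_skew_boxes.
  lia.
transitivity (\sum_(T in [set ext T' | T' : filling N nu eta & semistandard T'])
    \prod_b x (T b)).
  apply: eq_bigl => T; apply/andP/finset.imsetP => [[ssT /[dup] low /ext_onto[T' TE]]|[T' ]].
    by exists T' => //; rewrite inE -ext_ss -TE.
  by rewrite inE => ssT' ->; rewrite ext_ss.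
rewrite big_imset /=; last by move=> T T' _ _; apply: ext_inj.
rewrite big_distrr /=; apply: eq_big => [T|T _]; first by rewrite inE.
rewrite !prod_entry.
have perm_s : perm_eq (skew_boxes la eta) (skew_boxes la nu ++ skew_boxes nu eta).
  apply: uniq_perm => [||[i j]]; first exact: uniq_skew_boxes.
    rewrite cat_uniq !uniq_skew_boxes andbT /=; apply/hasPn => -[i j].
    by rewrite !mem_skew_boxes; lia.
  rewrite mem_cat !mem_skew_boxes; have := le_nu i; have := strip i; lia.
rewrite (perm_big _ perm_s) big_cat /=; congr (_ * _).
  rewrite -size_skew_boxes; last by case/andP: strip_nu.
  rewrite (eq_big_seq (fun=> x N)) => [|[i j]].
    by rewrite big_const_seq count_predT iter_mulr_1.
  rewrite mem_skew_boxes => ij; rewrite extE'; last by have := le_nu i; lia.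
  by rewrite ifF //; lia.
rewrite big_seq [RHS]big_seq; apply: eq_bigr => -[i j]; rewrite mem_skew_boxes => ij.
by rewrite extE' ?ifT //; have := strip i; lia.
Qed.

End Branching.

(** Splitting a tableau into the boxes holding the largest entry, which form a
    horizontal strip, and the others. *)
Lemma skew_schur_poly_branch n m N la eta (x : nat -> K) :
    (size la <= n)%N -> (part la 0 <= m)%N ->
  skew_schur_poly N.+1 la eta x =
    \sum_(nu <- rect n m | hstrip la nu)
      x N ^+ (psize la - psize nu) * skew_schur_poly N nu eta x.
Proof.
move=> le_n le_m; rewrite {1}/skew_schur_poly.
have [incl_eta|nincl] := boolP (part_incl eta la); last first.
  rewrite big1 // => nu /andP[/part_inclP incl_nu _]; rewrite /skew_schur_poly.
  case: ifP => [/part_inclP incl_eta|]; last by rewrite mulr0.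
  case/negP: nincl; apply/part_inclP => i; exact: leq_trans (incl_nu i).
transitivity (\sum_(T : filling N.+1 la eta | semistandard T)
    \sum_(nu <- rect n m | below T nu) \prod_b x (T b)).
  apply: eq_bigr => T /(below_exists incl_eta)[nu low].
  have nu_r : nu \in rect n m.
    case/and3P: low => _ /andP[incl_nu _] _; apply: mem_rect.
      exact: leq_trans (size_part_incl incl_nu) le_n.
    by move/part_inclP: incl_nu => /(_ 0%N)/leq_trans; apply.
  have -> : \sum_(nu <- rect n m | below T nu) \prod_b x (T b) =
      \sum_(nu <- [:: nu]) \prod_b x (T b).
    rewrite -[LHS]big_filter; apply: perm_big; apply: uniq_perm => //.
      by rewrite filter_uniq ?rect_uniq.
    move=> nu'; rewrite mem_filter inE; apply/andP/eqP => [[low' _]|->//].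
    exact: below_unique low' low.
  by rewrite big_seq1.
rewrite (exchange_big_dep xpredT) //= [RHS]big_mkcond /=; apply: eq_bigr => nu _.
have [/andP[incl_nu strip]|nok] := boolP (part_incl eta nu && hstrip la nu).
  by rewrite strip (below_fillings _ incl_eta) // /skew_schur_poly incl_nu.
rewrite big_pred0 => [|T]; last first.
  by apply: contraNF nok => /andP[_ /and3P[-> -> _]].
by move: nok; case: ifP; rewrite ?andbF ?andbT // /skew_schur_poly => _ /negPf ->;
  rewrite mulr0.
Qed.

Lemma skew_schur_poly0 la eta (x : nat -> K) :
  skew_schur_poly 0 la eta x = (la == eta)%:R.
Proof.
rewrite /skew_schur_poly; case: ifP => [/part_inclP le_eta|/negP nincl]; last first.
  case: eqVneq => // eq_la; case: nincl; rewrite eq_la; exact/part_inclP.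
case: eqVneq => [eq_la|ne_la].
  have no_box b : b \in skew_boxes la eta -> False.
    by case: b => i j; rewrite eq_la mem_skew_boxes; lia.
  have no_ord (b : seq_sub (skew_boxes la eta)) : 'I_0 by case: (no_box _ (ssvalP b)).
  rewrite (big_pred1 (finfun no_ord)) => [|T].
    by rewrite big1 // => b _; case: (no_box _ (ssvalP b)).
  rewrite /= (_ : T = finfun no_ord) ?eqxx; last first.
    by apply/ffunP => b; case: (no_box _ (ssvalP b)).
  by apply/forallP => b; case: (no_box _ (ssvalP b)).
have [b b_s] : exists b, b \in skew_boxes la eta.
  apply: contrapT => no_box; case/eqP: ne_la; apply: part_inj => i.
  apply/eqP; rewrite eqn_leq le_eta andbT leqNgt; apply/negP => lt_i.
  by apply: no_box; exists (i, part eta i); rewrite mem_skew_boxes leqnn.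
by rewrite big1 // => T; case: (T (SeqSub b_s)).
Qed.

End Tableaux.

Section JacobiTrudi.
Implicit Types (la mu nu eta : intpart).

(** Determinants indexed by beta-numbers are transported along skew Schur
    polynomials: multiplying every generating function by the one of the complete
    symmetric polynomials amounts to summing over sub-diagrams. *)
Lemma slater_genH n m (Phi : 'I_n -> fps K) N la (x : nat -> K) :
    (size la <= n)%N -> (part la 0 <= m)%N ->
  slater n (fun j => Phi j * genH x N) la =
    \sum_(eta <- rect n m) skew_schur_poly N la eta x * slater n Phi eta.
Proof.
elim: N la => [|N IHN] la le_n le_m.
  rewrite (bigD1_seq la) ?mem_rect ?rect_uniq //= skew_schur_poly0 eqxx mul1r.
  rewrite big1 ?addr0 => [|eta ne_eta].
    by congr (\det _); apply/matrixP => i j; rewrite !mxE /genH big_ord0 mulr1.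
  by rewrite skew_schur_poly0 eq_sym (negPf ne_eta) mul0r.
transitivity (slater n (fun j => Phi j * genH x N * geo (x N)) la).
  by congr (\det _); apply/matrixP => i j; rewrite !mxE /genH big_ord_recr mulrA.
rewrite (slater_branch _ _ le_n le_m).
under [RHS]eq_bigr => eta _ do rewrite (skew_schur_poly_branch _ _ _ le_n le_m) big_distrl.
rewrite exchange_big /=; apply: eq_bigr => nu /andP[incl_nu _].
rewrite IHN; last by move/part_inclP: incl_nu => /(_ 0%N)/leq_trans; apply.
  by rewrite big_distrr; apply: eq_bigr => eta _ /=; rewrite mulrA.
exact: leq_trans (size_part_incl incl_nu) le_n.
Qed.

Lemma slater_cvg n (Phi : 'I_n -> fps K) mu la :
  converges_to (fun N => slater n (fun j => Phi j * genH (qrho mu) N) la)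
               (slater n (fun j => Phi j * Hq mu) la).
Proof.
apply: cvgK_det => i j; rewrite mxE fps_coefM.
under eq_fun => N do rewrite mxE fps_coefM.
apply: cvgK_sum => k _; apply: cvgKM; [exact: cvgK_cst | exact: genH_cvg].
Qed.

Definition monom n eta (j : 'I_n) : fps K := fpsX K ^+ (beta n eta j).
Global Arguments monom n eta j : clear implicits.

Lemma beta_lt n la i j : (i < j < n)%N -> (beta n la j < beta n la i)%N.
Proof. by rewrite /beta; have := @part_geq la i j; lia. Qed.

Lemma beta_inj n la (i j : 'I_n) : beta n la i = beta n la j -> i = j.
Proof.
move=> eq_b; apply: val_inj; apply/eqP; rewrite /= eqn_leq.
apply/andP; split; rewrite leqNgt; apply/negP => lt.
  by have := @beta_lt n la j i; rewrite lt ltn_ord eq_b ltnn => /(_ isT).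
by have := @beta_lt n la i j; rewrite lt ltn_ord eq_b ltnn => /(_ isT).
Qed.

Lemma det_row0 (R : comNzRingType) n (A : 'M[R]_n) i : (forall j, A i j = 0) -> \det A = 0.
Proof.
by move=> Ai; rewrite (expand_det_row _ i) big1 // => j _; rewrite Ai mul0r.
Qed.

Lemma slater_monom n eta nu : (size eta <= n)%N -> (size nu <= n)%N ->
  slater n (monom n eta) nu = (nu == eta)%:R.
Proof.
move=> le_eta le_nu.
have monE (i j : 'I_n) : fps_coef (monom n eta j) (beta n nu i) = (beta n nu i == beta n eta j)%:R.
  rewrite /monom -[_ ^+ _]mulr1 fps_coef_shift fps_coef1 subn_eq0 eqn_leq.
  by case: ltngtP.
rewrite /slater; case: eqVneq => [eq_nu|ne_nu].
  rewrite (_ : \matrix_(i, j) _ = 1%:M) ?det1 //; apply/matrixP => i j.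
  rewrite !mxE monE eq_nu; congr (_%:R); congr nat_of_bool.
  by apply/eqP/eqP => [/beta_inj|->].
pose ne i := (i < n)%N && (part nu i != part eta i).
have ex_ne : exists i, ne i.
  apply: contrapT => no_ne; case/eqP: ne_nu; apply: part_inj => i.
  have [lt_i|le_i] := ltnP i n; last by rewrite !part_default // (leq_trans _ le_i).
  by apply/eqP/negPn/negP => ne_i; apply: no_ne; exists i; rewrite /ne lt_i.
case: (ex_minnP ex_ne) => i /andP[lt_i ne_i] min_i.
have eq_lt k : (k < i)%N -> beta n nu k = beta n eta k.
  move=> lt_k; congr (_ + _)%N; apply/eqP/negPn/negP => ne_k.
  by have := min_i k; rewrite /ne ne_k (ltn_trans lt_k lt_i) /= leqNgt lt_k => /(_ isT).
(* Both sequences decrease strictly, so at the first place where they differ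
   the larger of the two values does not occur in the other sequence. *)
have [lt_b|gt_b] : (beta n eta i < beta n nu i)%N \/ (beta n nu i < beta n eta i)%N.
  by rewrite /beta; lia.
- apply: (@det_row0 _ _ _ (Ordinal lt_i)) => j; rewrite mxE monE /=.
  case: eqP => // eq_b; have [lt_j|le_j] := ltnP j i.
    by have := @beta_lt n nu j i; rewrite lt_j lt_i (eq_lt j lt_j) eq_b ltnn => /(_ isT).
  have : (beta n eta j <= beta n eta i)%N.
    by rewrite /beta; have := part_geq eta le_j; have := ltn_ord j; lia.
  by rewrite -eq_b leqNgt lt_b.
rewrite -det_tr; apply: (@det_row0 _ _ _ (Ordinal lt_i)) => j; rewrite mxE mxE monE /=.
case: eqP => // eq_b; have [lt_j|le_j] := ltnP j i.
  by have := @beta_lt n eta j i; rewrite lt_j lt_i -(eq_lt j lt_j) eq_b ltnn => /(_ isT).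
have : (beta n nu j <= beta n nu i)%N.
  by rewrite /beta; have := part_geq nu le_j; have := ltn_ord j; lia.
by rewrite eq_b leqNgt gt_b.
Qed.

Lemma skew_schur_poly_jt n la eta N (x : nat -> K) :
    (size la <= n)%N -> (size eta <= n)%N ->
  skew_schur_poly N la eta x = slater n (fun j => monom n eta j * genH x N) la.
Proof.
move=> le_la le_eta; pose m := maxn (part la 0) (part eta 0).
rewrite (@slater_genH n m) ?leq_maxl // (bigD1_seq eta) ?rect_uniq ?mem_rect ?leq_maxr //=.
rewrite slater_monom // eqxx mulr1 big1_seq ?addr0 // => nu /andP[ne_nu nu_r].
have [incl_nu|nincl] := boolP (part_incl nu la).
  by rewrite slater_monom ?(negPf ne_nu) ?mulr0 // (leq_trans (size_part_incl incl_nu)).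
by rewrite /skew_schur_poly (negPf nincl) mul0r.
Qed.

Lemma skew_schur_jt n la eta mu : (size la <= n)%N -> (size eta <= n)%N ->
  skew_schur la eta (qrho mu) = slater n (fun j => monom n eta j * Hq mu) la.
Proof.
move=> le_la le_eta; apply: limK_eq.
apply: (cvgK_eventually (n0 := 0%N)) (@slater_cvg n (monom n eta) mu la) => N _.
by rewrite (@skew_schur_poly_jt n).
Qed.

Lemma skew_schur_cvg la eta mu :
  converges_to (fun N => skew_schur_poly N la eta (qrho mu)) (skew_schur la eta (qrho mu)).
Proof.
pose n := maxn (size la) (size eta).
rewrite (@skew_schur_jt n) ?leq_maxl ?leq_maxr //.
apply: (cvgK_eventually (n0 := 0%N)) (@slater_cvg n (monom n eta) mu la) => N _.
by rewrite (@skew_schur_poly_jt n) ?leq_maxl ?leq_maxr.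
Qed.

(** The limit of [slater_genH] for infinitely many variables; with monomials for
    [Phi] it is the Jacobi-Trudi formula, and in general a form of Cauchy-Binet. *)
Lemma slater_skew_schur n m (Phi : 'I_n -> fps K) mu la :
    (size la <= n)%N -> (part la 0 <= m)%N ->
  slater n (fun j => Phi j * Hq mu) la =
    \sum_(eta <- rect n m) skew_schur la eta (qrho mu) * slater n Phi eta.
Proof.
move=> le_n le_m; apply: converges_to_unique (@slater_cvg n Phi mu la) _.
apply: (cvgK_eventually (n0 := 0%N)
  (u := fun N => \sum_(eta <- rect n m) skew_schur_poly N la eta (qrho mu) * slater n Phi eta)).
  by move=> N _; rewrite (@slater_genH n m).
apply: cvgK_sum => eta _; apply: cvgKM; [exact: skew_schur_cvg | exact: cvgK_cst].
Qed.

End JacobiTrudi.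

(** * The Cauchy kernel *)

Section CauchyKernel.
Variable F : fieldType.
Implicit Types (f g : fps F) (a b s z : F).

Definition prev (u : nat -> F) (n : nat) : F := if n is m.+1 then u m else 0.

Lemma fps_coef_lin_prev a f n :
  fps_coef (lin a * f) n = fps_coef f n - a * prev (fps_coef f) n.
Proof. by rewrite fps_coef_lin; case: n => //; rewrite mulr0. Qed.

(** The coefficient of u^k v^l in f(u) g(v) / (1 - uv). *)
Definition ck f g (k l : nat) : F :=
  \sum_(e < (minn k l).+1) fps_coef f (k - e)%N * fps_coef g (l - e)%N.

Lemma ck0n f g l : ck f g 0 l = fps_coef f 0 * fps_coef g l.
Proof. by rewrite /ck min0n big_ord1 !subn0. Qed.

Lemma ckn0 f g k : ck f g k 0 = fps_coef f k * fps_coef g 0.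
Proof. by rewrite /ck minn0 big_ord1 !subn0. Qed.

Lemma ckSS f g k l :
  ck f g k.+1 l.+1 = fps_coef f k.+1 * fps_coef g l.+1 + ck f g k l.
Proof. by rewrite /ck minnSS big_ord_recl !subn0. Qed.

Lemma diag_ind (P : nat -> nat -> Prop) :
  (forall l, P 0 l) -> (forall k, P k.+1 0) -> (forall k l, P k l -> P k.+1 l.+1) ->
  forall k l, P k l.
Proof. by move=> P0 PS0 PSS; elim=> [//|k IHk] [|l]; [apply: PS0|apply/PSS/IHk]. Qed.

Lemma ck_shift f g k l :
  ck f g k l.+1 = fps_coef f k * fps_coef g l.+1 + prev (ck f g ^~ l) k.
Proof. by case: k => [|k]; rewrite ?ck0n ?addr0 // ckSS. Qed.

(** Multiplying the kernel (f(u)g(v))/(1 - uv) by the cross-ratio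
    (1 - bu)(1 - v/a)/((1 - au)(1 - v/b)) is a rank one perturbation, because this
    factor is constant on the curve uv = 1. *)
Lemma ck_update (r l : fps F) a b k n : a != 0 -> b != 0 ->
  a / b * ck (lin b * r) (lin a^-1 * l) k n =
    ck (lin a * r) (lin b^-1 * l) k n
    + (a / b - 1) * (fps_coef r k * fps_coef l n).
Proof.
move=> a_neq0 b_neq0; move: k n; apply: diag_ind => [n|k|k n IH].
- by rewrite !ck0n !fps_coef_lin_prev /=; field; rewrite a_neq0 b_neq0.
- by rewrite !ckn0 !fps_coef_lin_prev /=; field; rewrite a_neq0 b_neq0.
rewrite !ckSS mulrDr IH !fps_coef_lin_prev /=.
by field; rewrite a_neq0 b_neq0.
Qed.

Section AddBoxes.
Variables (I : Type) (c : seq I) (w y : I -> F) (f g : fps F) (s G : F).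
Let q := s ^+ 2.
Let z := s - s^-1.
Hypothesis s_neq0 : s != 0.
Hypothesis y_neq0 : forall i, y i != 0.
Variables r l : I -> fps F.
Hypothesis lin_r : forall i, lin (y i * s) * r i = f.
Hypothesis lin_l : forall i, lin ((y i)^-1 * s) * l i = g.
Hypothesis sum_r : forall k,
  z * \sum_(i <- c) w i * fps_coef (r i) k = G * (q ^+ k * fps_coef f k).
Hypothesis sum_l : forall k,
  z * \sum_(i <- c) w i / y i * fps_coef (l i) k = G * (q ^+ k * fps_coef g k).

(** Both sides are given on the first row and the first column by the hypotheses, and
    satisfy the same recursion along the diagonals: by [lin_r] and [lin_l],
    r_(k+1) l_(n+1) = r_(k+1) g_(n+1) + (s / y) f_(k+1) l_n + s^2 r_k l_n,
    and the sums of the first two terms are known. *)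
Lemma add_kernel k n :
  z * \sum_(i <- c) w i * (fps_coef (r i) k * fps_coef (l i) n) =
  G * (q ^+ k * ck f g k n + s^-1 * q ^+ n * prev (ck f g k) n).
Proof.
have r0 i : fps_coef (r i) 0 = fps_coef f 0.
  by rewrite -(lin_r i) fps_coef_lin_prev mulr0 subr0.
have l0 i : fps_coef (l i) 0 = fps_coef g 0.
  by rewrite -(lin_l i) fps_coef_lin_prev mulr0 subr0.
have rS i m : fps_coef (r i) m.+1 = fps_coef f m.+1 + y i * s * fps_coef (r i) m.
  by rewrite -(lin_r i) fps_coef_lin_prev subrK.
have lS i m : fps_coef (l i) m.+1 = fps_coef g m.+1 + (y i)^-1 * s * fps_coef (l i) m.
  by rewrite -(lin_l i) fps_coef_lin_prev subrK.
pose R m := \sum_(i <- c) w i * fps_coef (r i) m.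
pose L m := \sum_(i <- c) w i / y i * fps_coef (l i) m.
have zD A B C : z * (A + B + C) = z * A + z * B + z * C by ring.
have col0 m : z * \sum_(i <- c) w i * (fps_coef (r i) m * fps_coef (l i) 0) =
    (z * R m) * fps_coef g 0.
  rewrite -mulrA /R mulr_suml; congr (_ * _); apply: eq_bigr => i _.
  by rewrite l0; ring.
move: k n; apply: diag_ind => [[|n]|k|k n IH].
- by rewrite col0 sum_r !ck0n /=; ring.
- have -> : \sum_(i <- c) w i * (fps_coef (r i) 0 * fps_coef (l i) n.+1) =
      R 0 * fps_coef g n.+1 + fps_coef f 0 * s * L n + 0.
    rewrite addr0 /R /L mulr_suml mulr_sumr -big_split; apply: eq_bigr => i _ /=.
    by rewrite lS r0; ring.
  rewrite zD mulrA sum_r [z * (_ * L n)]mulrCA sum_l !ck0n /= ck0n exprS /q.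
  by field.
- by rewrite col0 sum_r !ckn0 /=; ring.
have -> : \sum_(i <- c) w i * (fps_coef (r i) k.+1 * fps_coef (l i) n.+1) =
    R k.+1 * fps_coef g n.+1 + fps_coef f k.+1 * s * L n +
    q * \sum_(i <- c) w i * (fps_coef (r i) k * fps_coef (l i) n).
  rewrite /R /L mulr_suml !mulr_sumr -!big_split; apply: eq_bigr => i _ /=.
  by rewrite rS lS /q; field.
rewrite zD mulrA sum_r [z * (_ * L n)]mulrCA sum_l [z * (q * _)]mulrCA IH !ckSS /=.
case: n {IH} => [|n] /=; first by rewrite !ckn0 !exprS /q; field.
by rewrite !ckSS !exprS /q; field.
Qed.

End AddBoxes.

Section RemoveBoxes.
Variables (I : Type) (c : seq I) (v y : I -> F) (f g : fps F) (s G : F).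
Let q := s ^+ 2.
Let z := s - s^-1.
Hypothesis s_neq0 : s != 0.
Hypothesis y_neq0 : forall i, y i != 0.
Variables r l : I -> fps F.
Hypothesis lin_r : forall i, lin (y i / s) * r i = f.
Hypothesis lin_l : forall i, lin ((y i)^-1 / s) * l i = g.
Hypothesis sum_r : forall k,
  z * \sum_(i <- c) v i * fps_coef (r i) k =
    (G + z * \sum_(i <- c) v i) * fps_coef f k
    - G * (s^-1 * prev (fps_coef f) k + q ^- k * fps_coef f k).
Hypothesis sum_l : forall k,
  z * \sum_(i <- c) v i * y i * fps_coef (l i) k =
    (G + z * \sum_(i <- c) v i * y i) * fps_coef g k
    - G * (s^-1 * prev (fps_coef g) k + q ^- k * fps_coef g k).

(** The same argument as for [add_kernel], with 1 / s in place of s in the series. *)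
Lemma remove_kernel k n :
  G * (q ^- k * s^-1 * ck f g k n + q^-1 * q ^- n * ck f g k n.+1)
  + z / s * (\sum_(i <- c) v i * (fps_coef (r i) k * fps_coef (l i) n)) =
  G * (fps_coef f k * fps_coef g n.+1).
Proof.
have r0 i : fps_coef (r i) 0 = fps_coef f 0.
  by rewrite -(lin_r i) fps_coef_lin_prev mulr0 subr0.
have l0 i : fps_coef (l i) 0 = fps_coef g 0.
  by rewrite -(lin_l i) fps_coef_lin_prev mulr0 subr0.
have rS i m : fps_coef (r i) m.+1 = fps_coef f m.+1 + y i / s * fps_coef (r i) m.
  by rewrite -(lin_r i) fps_coef_lin_prev subrK.
have lS i m : fps_coef (l i) m.+1 = fps_coef g m.+1 + (y i)^-1 / s * fps_coef (l i) m.
  by rewrite -(lin_l i) fps_coef_lin_prev subrK.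
pose A := G + z * \sum_(i <- c) v i.
pose R m := \sum_(i <- c) v i * fps_coef (r i) m.
pose L m := \sum_(i <- c) v i / y i * fps_coef (l i) m.
have q_neq0 : q != 0 by rewrite expf_neq0.
have zD B C D : z / s * (B + C + D) = (z * B) / s + (z * C) / s + z / s * D by ring.
(* The weights in [L] are v / y and those in [sum_l] are v y: two steps of the
   recursion [lS] pass from one to the other. *)
have sum_L m : z * L m = s ^+ 2 *
    (G * (1 - q ^- m.+2) * fps_coef g m.+2 - s^-1 * A * fps_coef g m.+1).
  have := sum_l m.+2; set Y := \sum_(i <- c) v i * y i.
  have -> : \sum_(i <- c) v i * y i * fps_coef (l i) m.+2 =
      Y * fps_coef g m.+2 + (\sum_(i <- c) v i) * (s^-1 * fps_coef g m.+1)
      + q^-1 * L m.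
    rewrite /L !mulr_suml mulr_sumr -!big_split; apply: eq_bigr => i _ /=.
    by rewrite !lS /q; field; rewrite s_neq0 y_neq0.
  rewrite /A /=; set V := \sum_(i <- c) v i; set Lm := L m.
  set Q := q ^- m.+2 => eqL.
  have -> : z * Lm = s ^+ 2 * (z * (Y * fps_coef g m.+2 + V * (s^-1 * fps_coef g m.+1)
      + q^-1 * Lm) - z * (Y * fps_coef g m.+2 + V * (s^-1 * fps_coef g m.+1))).
    by rewrite /q; field.
  by rewrite eqL; field.
(* One step of the recursion [lS] already meets the constant terms of the [l i]. *)
have q1 : G * fps_coef g 1 * (1 - q^-1) = s^-1 * A * fps_coef g 0.
  have := sum_l 1; set Y := \sum_(i <- c) v i * y i.
  have -> : \sum_(i <- c) v i * y i * fps_coef (l i) 1 =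
      Y * fps_coef g 1 + (\sum_(i <- c) v i) * (s^-1 * fps_coef g 0).
    rewrite !mulr_suml -!big_split; apply: eq_bigr => i _ /=.
    by rewrite !lS l0; field; rewrite s_neq0 y_neq0.
  rewrite /A /= expr1; set V := \sum_(i <- c) v i => /eqP; rewrite -subr_eq0 => /eqP eqL.
  have -> : G * fps_coef g 1 * (1 - q^-1) = s^-1 * G * fps_coef g 0 +
     (z * (Y * fps_coef g 1 + V * (s^-1 * fps_coef g 0)) - z * Y * fps_coef g 1)
     - (z * (Y * fps_coef g 1 + V * (s^-1 * fps_coef g 0))
        - ((G + z * Y) * fps_coef g 1 -
           G * (s^-1 * fps_coef g 0 + q^-1 * fps_coef g 1))).
    by rewrite /q; field.
  by rewrite eqL subr0; field.
have sum_R m : z * R m = A * fps_coef f m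
    - G * (s^-1 * prev (fps_coef f) m + q ^- m * fps_coef f m) by apply: sum_r.
pose V := \sum_(i <- c) v i.
have zR x m : z * (R m * x) = z * R m * x by rewrite mulrA.
have zL x m : z * (x * L m) = x * (z * L m) by rewrite mulrCA.
have AE : A = G + z * V by [].
have qX m : q ^- m.+1 = q^-1 * q ^- m by rewrite exprS invfM.
have q1' : q^-1 * G * fps_coef g 1 = G * fps_coef g 1 - s^-1 * A * fps_coef g 0.
  by rewrite -q1; ring.
move: k n; apply: diag_ind => [[|n]|k|k n IH].
- have -> : \sum_(i <- c) v i * (fps_coef (r i) 0 * fps_coef (l i) 0) =
      V * fps_coef f 0 * fps_coef g 0.
    by rewrite !mulr_suml; apply: eq_bigr => i _ /=; rewrite r0 l0 mulrA.
  transitivity (fps_coef f 0 * (s^-1 * A * fps_coef g 0 + q^-1 * G * fps_coef g 1)).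
    by rewrite !ck0n AE /= expr0 invr1; ring.
  by rewrite q1'; ring.
- have -> : \sum_(i <- c) v i * (fps_coef (r i) 0 * fps_coef (l i) n.+1) =
      V * fps_coef f 0 * fps_coef g n.+1 + fps_coef f 0 * s^-1 * L n + 0.
    rewrite addr0 /L /V !mulr_suml mulr_sumr -big_split; apply: eq_bigr => i _ /=.
    by rewrite lS r0; ring.
  rewrite zD zL sum_L !ck0n AE !qX expr0 invr1.
  by move: (q ^- n) => Qn; rewrite /q; field.
- have -> : \sum_(i <- c) v i * (fps_coef (r i) k.+1 * fps_coef (l i) 0) =
      R k.+1 * fps_coef g 0 + 0 + 0.
    rewrite !addr0 /R mulr_suml; apply: eq_bigr => i _ /=.
    by rewrite l0; ring.
  rewrite zD zR sum_R ckn0 ckSS ckn0 /= expr0 invr1.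
  transitivity (fps_coef f k.+1 * (s^-1 * A * fps_coef g 0 + q^-1 * G * fps_coef g 1)).
    by rewrite qX; move: (q ^- k) => Qk; rewrite /q; field.
  by rewrite q1'; ring.
have -> : \sum_(i <- c) v i * (fps_coef (r i) k.+1 * fps_coef (l i) n.+1) =
    R k.+1 * fps_coef g n.+1 + fps_coef f k.+1 * s^-1 * L n +
    q^-1 * \sum_(i <- c) v i * (fps_coef (r i) k * fps_coef (l i) n).
  rewrite /R /L mulr_suml !mulr_sumr -!big_split; apply: eq_bigr => i _ /=.
  by rewrite rS lS /q; field; rewrite s_neq0 y_neq0.
move: IH; set S := \sum_(i <- c) _ => IH.
have IH' : z / s * (q^-1 * S) = q^-1 * (G * (fps_coef f k * fps_coef g n.+1)
    - G * (q ^- k * s^-1 * ck f g k n + q^-1 * q ^- n * ck f g k n.+1)).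
  by rewrite -IH; ring.
rewrite zD zR zL sum_R sum_L IH' !ckSS /= !qX.
by move: (q ^- n) (q ^- k) => Qn Qk; rewrite /q; field.
Qed.

End RemoveBoxes.

End CauchyKernel.

(** * Jacobi-Trudi determinants as functions of one row, and Lagrange interpolation *)

Section RowDependence.
Variables (F : fieldType) (h : nat -> F) (p tau : F).
Hypothesis h_rec : forall k, h k.+1 * (1 - p ^+ k.+1) = tau * h k.
Hypothesis h_neq0 : forall k, h k != 0.
Hypothesis tau_neq0 : tau != 0.
Hypothesis p_neq0 : p != 0.
Hypothesis pX_inj : forall i j, p ^+ i = p ^+ j -> i = j.

Definition hshift k b : F := if (b <= k)%N then h (k - b) else 0.

Let R b : {poly F} := \prod_(m < b) (tau^-1 *: (1 - p ^- m *: 'X)).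

Let size_lin (c : F) : (size (1 - c *: 'X)%R <= 2)%N.
Proof.
rewrite (leq_trans (size_polyD _ _)) // size_polyN size_poly1 geq_max /=.
by rewrite (leq_trans (size_scale_leq _ _)) // size_polyX.
Qed.

Let size_R b : (size (R b) <= b.+1)%N.
Proof.
elim: b => [|b IHb]; first by rewrite /R big_ord0 size_poly1.
rewrite /R big_ord_recr -/(R b) /= (leq_trans (size_polyMleq _ _)) //.
have le2 := leq_trans (size_scale_leq tau^-1 _) (size_lin (p ^- b)).
by rewrite -subn1 leq_subLR (leq_trans (leq_add IHb le2)) // addn2.
Qed.

(** The recursion for h expresses each entry of row k as [h k] times a polynomial in
    [p ^+ k] which is the same for all rows. *)
Let hshiftE k b : hshift k b = h k * (R b).[p ^+ k].
Proof.
elim: b => [|b IHb]; first by rewrite /hshift /R big_ord0 hornerC mulr1 subn0.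
rewrite /R big_ord_recr /= -/(R b) hornerM mulrA -IHb /hshift !hornerE /=.
case: ltngtP => [lt_b|lt_k|<-].
- have := h_rec (k - b.+1).
  rewrite -subSn // subSS => rec_h.
  have -> : p ^- b * p ^+ k = p ^+ (k - b).
    by rewrite -{1}(subnKC (ltnW lt_b)) exprD mulKf // expf_neq0.
  by rewrite mulrAC rec_h [tau * _]mulrC mulfK.
- by rewrite !mul0r.
by rewrite mulVf ?expf_neq0 // subrr !mulr0.
Qed.

(** As a function of its row [i0], the Jacobi-Trudi determinant is [h m] times
    a polynomial in [p ^+ m] of degree less than [n].  It vanishes when two rows
    coincide, so all its roots are known. *)
Lemma det_hshift_row n (k b : 'I_n -> nat) (i0 : 'I_n) :
    (forall j, (b j < n)%N) -> injective k ->
  exists B, forall m,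
    \det (\matrix_(i, j) hshift (if i == i0 then m else k i) (b j)) =
    B * h m * \prod_(j | j != i0) (p ^+ k j - p ^+ m).
Proof.
move=> lt_b k_inj.
pose M := \matrix_(i, j) hshift (k i) (b j).
pose P := \sum_j R (b j) * (cofactor M i0 j)%:P.
have detE m : \det (\matrix_(i, j) hshift (if i == i0 then m else k i) (b j)) =
    h m * P.[p ^+ m].
  have -> : \matrix_(i, j) hshift (if i == i0 then m else k i) (b j) =
      row_repl M (fun j => hshift m (b j)) i0.
    by apply/matrixP => i j; rewrite !mxE; case: ifP.
  rewrite det_row_repl horner_sum mulr_sumr; apply: eq_bigr => j _.
  by rewrite hornerM hornerC hshiftE -mulrA.
pose rs := [seq p ^+ k j | j <- enum (predC1 i0)].
have rs_uniq : uniq rs.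
  rewrite map_inj_uniq => [|i j /pX_inj]; last exact: k_inj.
  exact: enum_uniq.
have rs_root : all (root P) rs.
  apply/allP => _ /mapP[j + ->]; rewrite mem_enum !inE => ne_j.
  apply/rootP/(mulfI (h_neq0 (k j))); rewrite mulr0 -detE.
  by apply: (determinant_alternate ne_j) => l; rewrite !mxE eqxx (negPf ne_j).
have size_P : (size P <= n)%N.
  apply/leq_sizeP => m le_m; rewrite coef_sum big1 // => j _.
  rewrite coefMC [X in X * _]nth_default ?mul0r //.
  by rewrite (leq_trans (size_R _)) // (leq_trans (lt_b j)).
have /dvdpP[Q PE] : \prod_(x <- rs) ('X - x%:P) %| P.
  by apply: uniq_roots_dvdp; rewrite // uniq_rootsE.
have size_rs : size rs = n.-1.
  by rewrite size_map -cardE cardC1 card_ord.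
have size_Q : (size Q <= 1)%N.
  have [->|Q_neq0] := eqVneq Q 0; first by rewrite size_poly0.
  have n_gt0 : (0 < n)%N by case: (i0) => i; lia.
  move: size_P; rewrite PE size_Mmonic ?monic_prod_XsubC //.
  by rewrite size_prod_XsubC size_rs; lia.
exists (Q`_0 * \prod_(j : 'I_n | j != i0) -1) => m.
rewrite detE PE (size1_polyC size_Q) coefC eqxx hornerM hornerC.
rewrite horner_prod big_map big_enum /= mulrCA -!mulrA.
congr (_ * _); rewrite mulrCA; congr (_ * _); rewrite -big_split.
by apply: eq_bigr => j _ /=; rewrite hornerXsubC mulN1r opprB.
Qed.

End RowDependence.

Section Lagrange.
Variable F : fieldType.
Implicit Types (y e w : nat -> F) (n N : nat).

Lemma prod_lin_top n (c : nat -> F) :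
  (size (\prod_(j < n) (1 - c j *: 'X))%R <= n.+1)%N /\
  (\prod_(j < n) (1 - c j *: 'X) : {poly F})`_n = \prod_(j < n) (- c j).
Proof.
elim: n => [|n [IHs IHc]]; first by rewrite !big_ord0 size_poly1 coef1.
rewrite !big_ord_recr /=; set P := \prod_(j < n) _ in IHs IHc *.
have PE : P * (1 - c n *: 'X) = P - (c n *: P) * 'X.
  by rewrite mulrBr mulr1 -scalerAr scalerAl.
have Pn1 : P`_n.+1 = 0 by rewrite nth_default.
split; last by rewrite PE coefB coefMX /= coefZ Pn1 IHc; ring.
apply/leq_sizeP => -[|m] // le_m; rewrite PE coefB coefMX coefZ /=.
have P0 i : (n < i)%N -> P`_i = 0 by move=> lt_i; rewrite nth_default // (leq_trans IHs).
by rewrite !P0 ?mulr0 ?subrr // ltnW.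
Qed.

Lemma size_prod_lin_cond n (c : nat -> F) (P : pred 'I_n) :
  (size (\prod_(j < n | P j) (1 - c j *: 'X))%R <= (\sum_(j < n | P j) 1).+1)%N.
Proof.
elim/big_rec2: _ => [|j m p _ IH]; first by rewrite size_poly1.
apply: leq_trans (size_polyMleq (1 - c j *: 'X) p) _.
have le2 : (size (1 - c j *: 'X)%R <= 2)%N.
  rewrite (leq_trans (size_polyD _ _)) // size_polyN size_poly1 geq_max /=.
  by rewrite (leq_trans (size_scale_leq _ _)) // size_polyX.
by rewrite -subn1 leq_subLR (leq_trans (leq_add le2 IH)).
Qed.

Lemma size_prod_lin_neq n (c : nat -> F) (i : 'I_n) :
  (size (\prod_(j < n | j != i) (1 - c j *: 'X))%R <= n)%N.
Proof.
apply: leq_trans (size_prod_lin_cond _ _) _.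
have : (\sum_(j < n) 1 = n)%N by rewrite sum1_card card_ord.
by rewrite (bigD1 i) //= add1n => ->.
Qed.

Lemma horner_prod_lin n (c : nat -> F) (P : pred 'I_n) x :
  (\prod_(j < n | P j) (1 - c j *: 'X) : {poly F}).[x] = \prod_(j < n | P j) (1 - c j * x).
Proof. by rewrite horner_prod; apply: eq_bigr => j _; rewrite !hornerE. Qed.

Lemma poly_zeros_eq0 n (x : nat -> F) (P : {poly F}) : (size P <= n)%N ->
  {in gtn n &, injective x} -> (forall i, (i < n)%N -> P.[x i] = 0) -> P = 0.
Proof.
move=> size_P x_inj Px; apply: (@roots_geq_poly_eq0 _ _ [seq x i | i <- iota 0 n]).
- by apply/allP => _ /mapP[i + ->]; rewrite mem_iota => /Px/rootP.
- rewrite map_inj_in_uniq ?iota_uniq // => i j; rewrite !mem_iota => lt_i lt_j.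
  exact: x_inj.
by rewrite size_map size_iota.
Qed.

(** Interpolation at the nodes 1 / y_i. *)
Lemma lagrange n y w (P : {poly F}) :
    (size P <= n)%N -> (forall i, y i != 0) -> {in gtn n &, injective y} ->
    (forall i : 'I_n, P.[(y i)^-1] = w i * \prod_(j < n | j != i) (1 - y j / y i)) ->
  P = \sum_(i < n) w i *: \prod_(j < n | j != i) (1 - y j *: 'X).
Proof.
move=> size_P y_neq0 y_inj Py; apply/eqP; rewrite -subr_eq0; apply/eqP.
apply: (@poly_zeros_eq0 n (fun i => (y i)^-1)).
- rewrite (leq_trans (size_polyD _ _)) // geq_max size_P size_polyN.
  apply: (leq_trans (size_sum _ _ _)); apply/bigmax_leqP => i _.
  exact: leq_trans (size_scale_leq _ _) (size_prod_lin_neq _ _).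
- by move=> i j lt_i lt_j /invr_inj; apply: y_inj.
move=> i lt_i; rewrite hornerD hornerN horner_sum (bigD1 (Ordinal lt_i)) //=.
rewrite [X in _ - (_ + X)]big1 => [|j ne_j].
  by rewrite addr0 hornerZ horner_prod_lin (Py (Ordinal lt_i)) subrr.
rewrite hornerZ horner_prod_lin (bigD1 (Ordinal lt_i)) 1?eq_sym //=.
by rewrite divff // subrr mul0r mulr0.
Qed.

(** A polynomial of degree N + 1 is interpolated at the N nodes 1 / (p e_i) and at 0;
    the remaining condition is the equality of the leading coefficients, which is
    where the value of [e N] enters. *)
Lemma lagrange_remove N e (v : nat -> F) (G s p z : F) :
    p != 0 -> s != 0 -> (forall i, e i != 0) -> {in gtn N &, injective e} ->
    e N = p ^+ N / s ->
    (forall i : 'I_N, G * \prod_(j < N.+1) (1 - p^-1 * e j / e i) =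
       - z * v i * \prod_(j < N | j != i) (1 - e j / e i)) ->
  G *: \prod_(j < N.+1) (1 - e j *: 'X) =
    ((G + z * \sum_(i < N) v i)%:P - (G / s) *: 'X) * \prod_(j < N) (1 - (p * e j) *: 'X)
    - z *: \sum_(i < N) v i *: \prod_(j < N | j != i) (1 - (p * e j) *: 'X).
Proof.
move=> p_neq0 s_neq0 e_neq0 e_inj eN Ge; apply/eqP; rewrite -subr_eq0; apply/eqP.
set P1 := \prod_(j < N.+1) _; set P0 := \prod_(j < N) _; set S := \sum_(i < N) v i *: _.
have [size_P1 top_P1] := prod_lin_top N.+1 e; rewrite -/P1 in size_P1 top_P1.
have [size_P0 top_P0] := prod_lin_top N (fun j => p * e j); rewrite -/P0 in size_P0 top_P0.
set A := G + _.
have size_S : (size S <= N)%N.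
  apply: (leq_trans (size_sum _ _ _)); apply/bigmax_leqP => i _.
  exact: leq_trans (size_scale_leq _ _) (size_prod_lin_neq (fun j => p * e j) _).
apply: (@poly_zeros_eq0 N.+1 (fun i => if i is j.+1 then (p * e j)^-1 else 0)).
- apply/leq_sizeP => m; rewrite leq_eqVlt => lt_m.
  rewrite !coefB mulrBl coefB !coefZ coefCM -scalerAl coefZ coefXM.
  case: m lt_m => // m /predU1P[[<-]|lt_m].
    rewrite /= top_P1 top_P0 [P0`_N.+1]nth_default // [S`_N.+1]nth_default 1?leqW //.
    rewrite big_ord_recr /= eN.
    have -> : \prod_(j < N) - (p * e j) = p ^+ N * \prod_(j < N) - e j.
      under eq_bigr do rewrite -mulrN.
      by rewrite big_split prodr_const card_ord.
    by field.
  rewrite /= [P1`_ _]nth_default ?(leq_trans size_P1) //.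
  rewrite [P0`_m.+1]nth_default ?(leq_trans size_P0) 1?ltnW //.
  rewrite [P0`_m]nth_default ?(leq_trans size_P0) //.
  rewrite [S`_ _]nth_default ?(leq_trans size_S) ?mulr0 ?subrr //.
  by move: lt_m; lia.
- move=> [|i] [|j] //; rewrite ?inE => lt_i lt_j.
  + by move/esym/eqP; rewrite invr_eq0 mulf_eq0 (negPf p_neq0) (negPf (e_neq0 _)).
  + by move/eqP; rewrite invr_eq0 mulf_eq0 (negPf p_neq0) (negPf (e_neq0 _)).
  by move=> /invr_inj/(mulfI p_neq0)/e_inj ->.
move=> [_|i lt_i].
  rewrite !(hornerD, hornerN, hornerM, hornerZ, hornerC, hornerX) horner_sum /P0 /P1 (horner_prod_lin e)
    (horner_prod_lin (fun j => p * e j)).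
  rewrite [\sum_(_ < N) _](eq_bigr (fun i : 'I_N => v i)) => [|i _]; last first.
    by rewrite hornerZ (horner_prod_lin (fun j => p * e j)) big1 ?mulr1 // => j _;
      rewrite mulr0 subr0.
  have one m (c : 'I_m -> F) : \prod_(j < m) (1 - c j * 0) = 1.
    by rewrite big1 // => j _; rewrite mulr0 subr0.
  by rewrite !one /A; ring.
rewrite ltnS in lt_i; have GeE := Ge (Ordinal lt_i); set x := (p * e i)^-1.
have xE j : p * e j * x = e j / e i by rewrite /x invfM mulrACA divff // mul1r.
have P0x : \prod_(j < N) (1 - p * e j * x) = 0.
  by rewrite (bigD1 (Ordinal lt_i)) //= xE divff // subrr mul0r.
have P1x : \prod_(j < N.+1) (1 - e j * x) = \prod_(j < N.+1) (1 - p^-1 * e j / e i).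
  by apply: eq_bigr => j _; rewrite /x invfM mulrCA mulrA.
have Sx : \sum_(k < N) (v k *: \prod_(j < N | j != k) (1 - (p * e j) *: 'X)).[x] =
    v i * \prod_(j < N | j != Ordinal lt_i) (1 - e j / e i).
  rewrite (bigD1 (Ordinal lt_i)) //= [X in _ + X]big1 ?addr0 => [|k ne_k].
    rewrite hornerZ (horner_prod_lin (fun j => p * e j)); congr (_ * _).
    by apply: eq_bigr => j _; rewrite xE.
  rewrite hornerZ (horner_prod_lin (fun j => p * e j)) (bigD1 (Ordinal lt_i)) 1?eq_sym //=.
  by rewrite xE divff // subrr mul0r mulr0.
rewrite !(hornerD, hornerN, hornerM, hornerZ, hornerC, hornerX) horner_sum /P0 /P1.
rewrite (horner_prod_lin e) (horner_prod_lin (fun j => p * e j)) Sx P0x P1x GeE /=.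
by ring.
Qed.

End Lagrange.

(** * Adding and removing boxes in determinants *)

Section RowSums.
Implicit Types (la : intpart).

Lemma size_addrow la n i : addable la i -> (size la <= n)%N -> (i < n)%N ->
  (size (addrow la i) <= n)%N.
Proof.
move=> add_i le_n lt_i; rewrite leqNgt -part_gt0 part_addrow //.
by rewrite part_default // gtn_eqF.
Qed.

Lemma size_remrow la n i : removable la i -> (size la <= n)%N ->
  (size (remrow la i) <= n)%N.
Proof. by move=> rem_i le_n; rewrite leqNgt -part_gt0 part_remrow // part_default. Qed.

Lemma beta_addrow n la (i k : 'I_n) : addable la i ->
  beta n (addrow la i) k = if k == i then (beta n la i).+1 else beta n la k.
Proof.
move=> add_i; rewrite /beta part_addrow // -val_eqE.
by case: eqP => [->|_]; rewrite ?addn0 // addn1 addSn.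
Qed.

Lemma beta_remrow n la (i k : 'I_n) : removable la i ->
  beta n (remrow la i) k = if k == i then (beta n la i).-1 else beta n la k.
Proof.
move=> rem_i; rewrite /beta part_remrow // -val_eqE.
move: rem_i; rewrite /removable; case: eqP => [->|_]; last by rewrite subn0.
by move=> /=; lia.
Qed.

Variables (F : comNzRingType) (n : nat) (A : nat -> 'I_n -> F).

Definition rowdet la : F := \det (\matrix_(i, j) A (beta n la i) j).

(** If no box can be added in row i, raising the i-th beta-number by one produces the
    previous beta-number, hence two equal rows. *)
Lemma rowdet_add la (i : 'I_n) : (size la < n)%N ->
  \det (row_repl (\matrix_(i, j) A (beta n la i) j) (A (beta n la i).+1) i) =
  if addable la i then rowdet (addrow la i) else 0.
Proof.
move=> lt_n; case: ifP => [add_i|/norP[]].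
  congr (\det _); apply/matrixP => k j; rewrite !mxE beta_addrow //.
  by case: eqP.
case: i => -[//|i] lt_i /= _ nlt.
have lt_i' : (i < n)%N by apply: ltnW.
apply: (@determinant_alternate _ _ _ (Ordinal lt_i) (Ordinal lt_i')).
  by rewrite -val_eqE /= gtn_eqF.
move=> j; rewrite !mxE eqxx -val_eqE /= ltn_eqF //; congr (A _ _).
by rewrite /beta; have := part_geq la (leqnSn i); move: nlt lt_i; lia.
Qed.

Lemma sum_rowdet_add la (W : int -> F) : (size la < n)%N ->
  \sum_(i < n) W (2 * ((part la i)%:Z - i%:Z)) *
    \det (row_repl (\matrix_(i, j) A (beta n la i) j) (A (beta n la i).+1) i) =
  \sum_(ga <- addseq la) W (kappa ga - kappa la) * rowdet ga.
Proof.
move=> lt_n; rewrite (big_addseq _ lt_n) [RHS]big_mkcond; apply: eq_bigr => i _.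
rewrite rowdet_add //; case: ifP => [add_i|_]; last by rewrite mulr0.
by rewrite kappa_addrow // addrAC subrr add0r.
Qed.

(** If no box can be removed from row i, lowering the i-th beta-number by one produces
    the next one, or a negative number when row i is the last one. *)
Lemma rowdet_rem la (i : 'I_n) : (size la <= n)%N ->
  \det (row_repl (\matrix_(i, j) A (beta n la i) j)
    (fun j => if beta n la i is k.+1 then A k j else 0) i) =
  if removable la i then rowdet (remrow la i) else 0.
Proof.
move=> le_n; case: ifP => [rem_i|nrem].
  have b_gt0 : (0 < beta n la i)%N by move: rem_i; rewrite /removable /beta; lia.
  congr (\det _); apply/matrixP => k j; rewrite !mxE beta_remrow //.
  by case: eqP => // _; case: (beta n la i) b_gt0.
have eq_p : part la i = part la i.+1.
  by have := part_geq la (leqnSn i); move: nrem; rewrite /removable; lia.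
have [lt_i|le_i] := ltnP i.+1 n; last first.
  apply: (@det_row0 _ _ _ i) => j; rewrite mxE eqxx.
  suff -> : beta n la i = 0%N by [].
  rewrite /beta eq_p part_default ?(leq_trans le_n) //.
  by have := ltn_ord i; lia.
apply: (@determinant_alternate _ _ _ i (Ordinal lt_i)).
  by rewrite -val_eqE /= ltn_eqF.
move=> j; rewrite !mxE eqxx -val_eqE /= gtn_eqF //.
suff -> : beta n la i = (beta n la i.+1).+1 by [].
by rewrite /beta eq_p; move: lt_i; lia.
Qed.

Lemma sum_rowdet_rem la (W : int -> F) : (size la <= n)%N ->
  \sum_(i < n) W (2 * ((part la i)%:Z - 1 - i%:Z)) *
    \det (row_repl (\matrix_(i, j) A (beta n la i) j)
      (fun j => if beta n la i is k.+1 then A k j else 0) i) =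
  \sum_(be <- remseq la) W (kappa la - kappa be) * rowdet be.
Proof.
move=> le_n; rewrite (big_remseq _ le_n) [RHS]big_mkcond; apply: eq_bigr => i _.
rewrite rowdet_rem //; case: ifP => [rem_i|_]; last by rewrite mulr0.
by rewrite (kappa_remrow rem_i) [X in _ = W X * _]addrAC subrr add0r.
Qed.

End RowSums.

Local Notation s := qhalf.
Local Notation q := (qhalf ^+ 2).
Local Notation p := (qhalf^-1 ^+ 2).
Local Notation z := (qhalf - qhalf^-1).

Section Contents.
Implicit Types (la mu ga be al : intpart).

Lemma tvarE : tvar = s^-1.
Proof. by rewrite invrK. Qed.

Lemma sV_neq0 : s^-1 != 0.
Proof. by rewrite invr_neq0 ?qhalf_neq0. Qed.

Lemma qX_inj m n : q ^+ m = q ^+ n -> m = n.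
Proof.
rewrite -!exprM /qhalf !exprVn => /invr_inj/tvarX_inj; lia.
Qed.

Lemma q1_neq0 : q - 1 != 0.
Proof. by rewrite subr_eq0; apply/eqP => /(@qX_inj 1 0). Qed.

Fact z_q (F : fieldType) (x : F) : x != 0 -> x - x^-1 = (x ^+ 2 - 1) / x.
Proof. by move=> x_neq0; field. Qed.

Lemma z_neq0 : z != 0.
Proof. by rewrite z_q ?qhalf_neq0 // mulf_neq0 ?q1_neq0 ?sV_neq0. Qed.

(** s_box(q^(la + rho)), which is h_1(q^(la + rho)). *)
Definition D la : K := fps_coef (Hq la) 1.

Lemma Hq_empty : Hq empty_part = Hrho.
Proof. by rewrite /Hq big_ord0 mulr1. Qed.

Lemma fps_coef0M (F : idomainType) (f g : fps F) :
  fps_coef (f * g) 0 = fps_coef f 0 * fps_coef g 0.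
Proof. by rewrite fps_coefM big_ord1. Qed.

Lemma Hq0 la : fps_coef (Hq la) 0 = 1.
Proof.
have H0 : fps_coef Hrho 0 = 1 by rewrite /= /hrho big_ord0.
rewrite /Hq fps_coef0M H0 mul1r.
elim/big_ind: _ => // [f g f0 g0|i _]; first by rewrite fps_coef0M f0 g0 mulr1.
by rewrite fps_coef0M /= coefB coef1 coefZ coefX mulr0 subr0 mulr1.
Qed.

Lemma content_beta n la i : (i < n)%N ->
  s ^ (2 * ((part la i)%:Z - i%:Z)) * q ^+ n = q ^+ (beta n la i).+1.
Proof.
move=> lt_i; rewrite -!exprM !exprnP -expfzDr ?qhalf_neq0 //; congr (_ ^ _).
by rewrite /beta; lia.
Qed.

End Contents.

(** * The values of s_box and the principal specialization *)

Opaque K tvar qhalf.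

Section Eigenvalues.
Implicit Types (la mu ga be al : intpart).

Lemma hrho0 : hrho 0 = 1.
Proof. exact: big_ord0. Qed.

Lemma p_neq1 k : 1 - p ^+ k.+1 != 0.
Proof. by rewrite -tvarE -exprM tvar1X_neq0. Qed.

Lemma hrho_rec k : hrho k.+1 * (1 - p ^+ k.+1) = s^-1 * hrho k.
Proof.
rewrite /hrho big_ord_recr /= -/(hrho k) -tvarE -exprM mulrA mulfVK 1?mulrC //.
by rewrite exprM tvarE p_neq1.
Qed.

Lemma hrho_neq0 k : hrho k != 0.
Proof.
by apply/prodf_neq0 => i _; rewrite mulf_neq0 ?tvar_neq0 ?invr_neq0 ?tvar1X_neq0.
Qed.

Fact z_hrho1 (F : fieldType) (x h : F) : x != 0 -> x - x^-1 != 0 ->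
  h * (1 - x^-1 ^+ 2) = x^-1 -> h = (x - x^-1)^-1.
Proof.
move=> x_neq0 z_neq0 eqh; apply: (mulIf z_neq0); rewrite mulVf //.
have -> : x - x^-1 = x * (1 - x^-1 ^+ 2) by field.
by rewrite mulrCA eqh divff.
Qed.

Lemma D_empty : D empty_part = z^-1.
Proof.
apply: z_hrho1; rewrite ?qhalf_neq0 ?z_neq0 // /D Hq_empty /=.
by have := hrho_rec 0; rewrite expr1 hrho0 mulr1.
Qed.

Lemma fps_coef1_lin (F : idomainType) (f : fps F) c :
  fps_coef (f * lin c) 1 = fps_coef f 1 - c * fps_coef f 0.
Proof. by rewrite mulrC fps_coef_lin. Qed.

Lemma D_add_box la ga : add_box la ga -> D ga = D la + z * s ^ (kappa ga - kappa la).
Proof.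
case/add_boxP=> i add_i ->; rewrite kappa_addrow // addrAC subrr add0r.
set c := 2 * _; have := congr1 (fun f => fps_coef f 1) (Hq_addrow add_i).
rewrite !fps_coef1_lin !Hq0 !mulr1 -/c -!/(D _).
rewrite !expfzDr ?qhalf_neq0 // expr1z exprN1 => /eqP; rewrite subr_eq => /eqP ->.
by ring.
Qed.

Fact geometric_top (F : fieldType) (x : F) n : x != 0 -> x - x^-1 != 0 ->
  (x - x^-1)^-1 * (x ^+ 2) ^+ n = x * (\sum_(i < n) (x ^+ 2) ^+ (n - i.+1)) + (x - x^-1)^-1.
Proof.
move=> x_neq0 z_neq0.
rewrite (reindex_inj rev_ord_inj) /= (eq_bigr (fun i : 'I_n => (x ^+ 2) ^+ i)) => [|i _].
  apply: (mulfI z_neq0); rewrite mulrDr mulVKf // divff // mulrA.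
  have -> : (x - x^-1) * x = x ^+ 2 - 1 by rewrite mulrBl mulVf // expr2.
  by rewrite -subrX1 subrK.
by congr (_ ^+ _); have := ltn_ord i; lia.
Qed.

Fact geometric_bottom (F : fieldType) (x : F) n : x != 0 -> x - x^-1 != 0 ->
  (x - x^-1)^-1 * (x^-1 ^+ 2) ^+ n =
    (x - x^-1)^-1 - x^-1 * (\sum_(i < n) (x^-1 ^+ 2) ^+ (n - i.+1)).
Proof.
move=> x_neq0 z_neq0; have zV : (x^-1 - x^-1^-1)^-1 = - (x - x^-1)^-1.
  by rewrite -[RHS]invrN opprB invrK.
have := @geometric_top _ x^-1 n; rewrite zV invr_neq0 // -oppr_eq0 opprB invrK.
move=> /(_ isT z_neq0) eqS.
by rewrite -[LHS]opprK -mulNr eqS opprD opprK addrC.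
Qed.

Lemma sum_beta_addrow (V : zmodType) n la i (f : nat -> V) : addable la i -> (i < n)%N ->
  \sum_(j < n) f (beta n (addrow la i) j) =
    \sum_(j < n) f (beta n la j) + (f (beta n la i).+1 - f (beta n la i)).
Proof.
move=> add_i lt_i; pose i' := Ordinal lt_i.
rewrite (bigD1 i') //= [in RHS](bigD1 i') //= (@beta_addrow _ _ i' i') // eqxx.
rewrite [RHS]addrC -addrA addKr; congr (_ + _).
by apply: eq_bigr => j ne_j; rewrite (@beta_addrow _ _ i' j) // (negPf ne_j).
Qed.

Lemma size_addrow_ge la n i : addable la i -> (size (addrow la i) <= n)%N ->
  (size la <= n)%N /\ (i < n)%N.
Proof.
move=> add_i le_n; have part_n k : (n <= k)%N -> part la k = 0%N /\ k != i.
  move=> le_k; have := part_addrow k add_i; rewrite part_default ?(leq_trans le_n) //.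
  by case: eqP => //=; lia.
split; first by rewrite leqNgt -part_gt0; case: (part_n n) => // ->.
by rewrite ltnNge; apply/negP => /part_n[_]; rewrite eqxx.
Qed.

Lemma beta_empty n j : beta n empty_part j = (n - j.+1)%N.
Proof. by rewrite /beta part_empty. Qed.

Fact D_beta_step (F : fieldType) (x S Q V : F) : x != 0 ->
  x * S + V + (x - x^-1) * (x ^+ 2 * Q) = x * (S + (x ^+ 2 * Q - Q)) + V.
Proof. by move=> x_neq0; field. Qed.

(** Sums of powers of q over the beta-numbers are what [trdet_diagl] produces;
    here and in [DT_beta] they are identified with the coefficients of the relations. *)
Lemma D_beta n la : (size la <= n)%N ->
  D la * q ^+ n = s * (\sum_(i < n) q ^+ beta n la i) + z^-1.
Proof.
elim/intpart_ind: la n => [|la ga add_ga IH] n le_n.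
  rewrite (eq_bigr (fun i : 'I_n => q ^+ (n - i.+1))) => [|i _]; last by rewrite beta_empty.
  by rewrite D_empty; apply: geometric_top; rewrite ?qhalf_neq0 ?z_neq0.
rewrite (D_add_box add_ga) mulrDl; move: add_ga le_n => /add_boxP[i add_i ->] le_ga.
have [le_n lt_i] := size_addrow_ge add_i le_ga.
rewrite (IH _ le_n) (kappa_addrow add_i) [_ + _ - _]addrAC subrr add0r -mulrA.
rewrite (content_beta _ lt_i).
rewrite (sum_beta_addrow (fun k => q ^+ k) add_i lt_i).
rewrite [q ^+ _.+1]exprS.
by apply: D_beta_step; apply: qhalf_neq0.
Qed.

Fact expVX2 (F : fieldType) (x : F) n : (x^-1 ^+ 2) ^+ n = ((x ^+ 2) ^+ n)^-1.
Proof. by rewrite !exprVn. Qed.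

Fact DT_beta_step (F : fieldType) (x S Q V : F) : x != 0 ->
  V - x^-1 * S + (x - x^-1) * (x^-1 ^+ 2 * Q) = V - x^-1 * (S + (x^-1 ^+ 2 * Q - Q)).
Proof. by move=> x_neq0; field. Qed.

Lemma transpose_empty : transpose empty_part = empty_part.
Proof. by apply: part_inj => i; apply: eq_ltnl => l; rewrite ltn_part_transpose !part_empty. Qed.

Lemma DT_beta n la : (size la <= n)%N ->
  D (transpose la) * p ^+ n = z^-1 - s^-1 * (\sum_(i < n) p ^+ beta n la i).
Proof.
elim/intpart_ind: la n => [|la ga add_ga IH] n le_n.
  rewrite (eq_bigr (fun i : 'I_n => p ^+ (n - i.+1))) => [|i _]; last by rewrite beta_empty.
  by rewrite transpose_empty D_empty; apply: geometric_bottom; rewrite ?qhalf_neq0 ?z_neq0.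
rewrite (D_add_box (add_box_transpose add_ga)) mulrDl !kappa_transpose -opprD.
move: add_ga le_n => /add_boxP[i add_i ->] le_ga.
have [le_n lt_i] := size_addrow_ge add_i le_ga.
rewrite (IH _ le_n) (kappa_addrow add_i) [_ + _ - _]addrAC subrr add0r -mulrA.
have -> : s ^ (- (2 * ((part la i)%:Z - i%:Z))) * p ^+ n = p ^+ (beta n la i).+1.
  by rewrite -invr_expz !(expVX2 s) -invfM content_beta.
rewrite (sum_beta_addrow (fun k => p ^+ k) add_i lt_i) [p ^+ _.+1]exprS.
by apply: DT_beta_step; apply: qhalf_neq0.
Qed.

End Eigenvalues.

Section Principal.
Implicit Types (la mu ga be al : intpart).

(** The principal specialization s_mu(q^rho). *)
Definition g mu : K := schur mu (qrho empty_part).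

(** h_(k - b)(q^rho), the entries of the Jacobi-Trudi matrix of g. *)
Definition hs k b : K := hshift hrho k b.

Lemma g_det n mu : (size mu <= n)%N ->
  g mu = rowdet (fun k (j : 'I_n) => hs k (beta n empty_part j)) mu.
Proof.
move=> le_n; rewrite /g /schur (@skew_schur_jt n) // Hq_empty.
by congr (\det _); apply/matrixP => i j; rewrite !mxE /monom fps_coef_shift.
Qed.

Lemma g_empty : g empty_part = 1.
Proof. by rewrite (@g_det 0) // /rowdet det_mx00. Qed.

Lemma hs_prev k b : hs k b.+1 = if k is k'.+1 then hs k' b else 0.
Proof. by rewrite /hs /hshift; case: k => [|k]; rewrite ?ltn0 // ltnS subSS. Qed.

Lemma hs_rec k b : hs k b * (1 - p ^+ k * q ^+ b) = s^-1 * hs k b.+1.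
Proof.
rewrite /hs /hshift; case: ltngtP => [lt_b|_|->]; rewrite ?mul0r ?mulr0 //.
  have := hrho_rec (k - b.+1); rewrite -subSn // subSS => <-.
  rewrite -{2}(subnKC (ltnW lt_b)) exprD mulrAC -exprMn.
  by rewrite -exprMn mulVf ?qhalf_neq0 // !expr1n mul1r.
by rewrite -exprMn -exprMn mulVf ?qhalf_neq0 // !expr1n subrr mulr0.
Qed.

End Principal.

(** * Sums of principal specializations over removed boxes *)

Section ReplSums.
Variables (R : comNzRingType) (n : nat) (M : 'M[R]_n).

Lemma sum_row_repl (w : 'I_n -> R) (v : 'I_n -> 'I_n -> R) :
  \sum_i w i * \det (row_repl M (v i) i) = trdet M (\matrix_(i, j) (w i * v i j)).
Proof.
apply: eq_bigr => i _; rewrite det_row_repl mulr_sumr; apply: eq_bigr => j _.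
by rewrite mxE -mulrA.
Qed.

Lemma sum_col_repl (w : 'I_n -> R) (v : 'I_n -> 'I_n -> R) :
  \sum_j w j * \det (col_repl M (v j) j) = trdet M (\matrix_(i, j) (w j * v j i)).
Proof.
rewrite /trdet exchange_big; apply: eq_bigr => j _.
rewrite det_col_repl mulr_sumr; apply: eq_bigr => i _.
by rewrite mxE -mulrA.
Qed.

End ReplSums.

Section Recursions.
Implicit Types (la mu ga be al : intpart).

Lemma content_beta_rem n la i : (i < n)%N ->
  s ^ (2 * ((part la i)%:Z - 1 - i%:Z)) * q ^+ n = q ^+ (beta n la i).
Proof.
move=> lt_i; rewrite -!exprM !exprnP -expfzDr ?qhalf_neq0 //; congr (_ ^ _).
by rewrite /beta; lia.
Qed.

Lemma qX_neq0 n : q ^+ n != 0.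
Proof. by rewrite !expf_neq0 ?qhalf_neq0. Qed.

Lemma pX_neq0 n : p ^+ n != 0.
Proof. by rewrite !expf_neq0 ?sV_neq0. Qed.

Fact recB_entry (F : fieldType) (x h Q P B : F) : x != 0 -> Q * P = 1 ->
  Q * (x * (h * (1 - P * B))) = x * (Q * h) + (- x) * (B * h).
Proof.
move=> x_neq0 QP; have -> : Q * (x * (h * (1 - P * B))) = x * (Q * h) - Q * P * x * (B * h) by ring.
by rewrite QP mul1r mulNr.
Qed.

Fact recB_final (F : fieldType) (x S T d V G Qn : F) : d * Qn = x * S + V -> V * Qn = x * T + V ->
  x * (S * G) + (- x) * (T * G) = (d - V) * G * Qn.
Proof.
move=> dQ VQ; have -> : (d - V) * G * Qn = (d * Qn - V * Qn) * G by ring.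
by rewrite dQ VQ; ring.
Qed.

Lemma qp1 n : q ^+ n * p ^+ n = 1.
Proof. by rewrite expVX2 mulfV ?qX_neq0. Qed.

(** The weight q^c of the box removed from row i is q^(beta_i - n), and by
    [hs_rec] the lowered row times q^(beta_i) is a combination of the matrix scaled by
    rows and of the matrix scaled by columns; both contribute multiples of g mu. *)
Lemma sum_remseq_content mu :
  \sum_(al <- remseq mu) s ^ (kappa mu - kappa al) * g al = (D mu - z^-1) * g mu.
Proof.
pose n := size mu; pose A k (j : 'I_n) := hs k (beta n empty_part j).
have size_n al : al \in remseq mu -> (size al <= n)%N.
  by case/mapP => i; rewrite mem_filter => /andP[rem_i _] ->; apply: size_remrow.
transitivity (\sum_(al <- remseq mu) s ^ (kappa mu - kappa al) * rowdet A al).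
  by apply: eq_big_seq => al /size_n le_al; rewrite (g_det le_al).
rewrite (g_det (leqnn (size mu))) -/n -/A.
rewrite -(sum_rowdet_rem A (fun c => s ^ c) (leqnn n)).
apply: (mulIf (qX_neq0 n)); rewrite mulr_suml.
set M := \matrix_(i, j) _.
transitivity (\sum_(i < n) q ^+ (beta n mu i) *
    \det (row_repl M (fun j => hs (beta n mu i) (beta n empty_part j).+1) i)).
  apply: eq_bigr => i _; rewrite -(content_beta_rem mu (ltn_ord i)) mulrAC.
  congr (_ * _ * \det _); apply/matrixP => i' j; rewrite !mxE.
  by case: eqP => // _; rewrite hs_prev.
rewrite sum_row_repl.
rewrite (@eq_trdet _ _ _ _ (s *: (\matrix_(i, j) (q ^+ (beta n mu i) * M i j))
   + (- s) *: (\matrix_(i, j) (q ^+ (beta n empty_part j) * M i j)))) => [|i j]; last first.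
  rewrite !mxE; have -> : hs (beta n mu i) (beta n empty_part j).+1 =
      s * (hs (beta n mu i) (beta n empty_part j) *
        (1 - p ^+ (beta n mu i) * q ^+ (beta n empty_part j))).
    by rewrite hs_rec mulVKf ?qhalf_neq0.
  by apply: recB_entry; rewrite ?qhalf_neq0 ?qp1.
rewrite trdetD !trdetZ (trdet_diagl M (fun i => q ^+ beta n mu i)).
rewrite (trdet_diagr M (fun j => q ^+ beta n empty_part j)).
apply: recB_final; first exact: D_beta.
rewrite (eq_bigr (fun i : 'I_n => q ^+ (n - i.+1))) => [|i _]; last by rewrite beta_empty.
by apply: geometric_top; rewrite ?qhalf_neq0 ?z_neq0.
Qed.

Fact recA_entry (F : fieldType) (x h h' P Pb Qb : F) : Pb * Qb = 1 ->
  h * (1 - P * Qb) = x^-1 * h' -> Pb * h' * x^-1 = Pb * h - P * h.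
Proof.
move=> PQ hE; have -> : Pb * h' * x^-1 = Pb * (x^-1 * h') by ring.
rewrite -hE; have -> : Pb * (h * (1 - P * Qb)) = Pb * h - Pb * Qb * P * h by ring.
by rewrite PQ mul1r.
Qed.

Fact recA_final (F : fieldType) (x S T d V G X P Pn : F) : x != 0 ->
  Pn = x^-1 ^+ 2 * P -> d * Pn = V - x^-1 * S -> V * Pn = V - x^-1 * T ->
  x^-1 * (P * X) = T * G - S * G ->
  X * Pn = (d - V) * G * Pn.
Proof.
move=> x_neq0 PnE dE VE XE; have -> : (d - V) * G * Pn = (d * Pn - V * Pn) * G by ring.
rewrite dE VE; have -> : X * Pn = x^-1 * (x^-1 * (P * X)) by rewrite PnE; ring.
by rewrite XE; ring.
Qed.

(** Without weight, the recursion [hs_rec] requires a factor that depends on the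
    column.  Only the first column matters: in every other one the lowered entries
    repeat the preceding column. *)
Lemma sum_remseq mu :
  \sum_(al <- remseq mu) g al = (D (transpose mu) - z^-1) * g mu.
Proof.
pose n := (size mu).+1; pose A k (j : 'I_n) := hs k (beta n empty_part j).
have size_n al : al \in remseq mu -> (size al <= n)%N.
  by case/mapP => i; rewrite mem_filter => /andP[rem_i _] ->; apply: size_remrow.
transitivity (\sum_(al <- remseq mu) 1 * rowdet A al).
  by apply: eq_big_seq => al /size_n le_al; rewrite (g_det le_al) mul1r.
rewrite (g_det (leqnSn (size mu))) -/n -/A.
rewrite -(sum_rowdet_rem A (fun c => 1) (leqnSn _)).
set M := \matrix_(i, j) _; set X := \sum_i _.
have XE : X = trdet M (\matrix_(i, j) hs (beta n mu i) (beta n empty_part j).+1).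
  rewrite trdet_rows; apply: eq_bigr => i _; rewrite mul1r; congr (\det _).
  by apply/matrixP => i' j; rewrite !mxE hs_prev.
have XE' : p ^+ n.-1 * X = trdet M (\matrix_(i, j)
    (p ^+ beta n empty_part j * hs (beta n mu i) (beta n empty_part j).+1)).
  rewrite XE -(sum_col_repl M (fun j => p ^+ beta n empty_part j)
    (fun j i => hs (beta n mu i) (beta n empty_part j).+1)).
  rewrite trdet_cols mulr_sumr; apply: eq_bigr => j _.
  have -> : \det (col_repl M ((\matrix_(i, j0) hs (beta n mu i) (beta n empty_part j0).+1)^~ j) j) =
            \det (col_repl M (fun i => hs (beta n mu i) (beta n empty_part j).+1) j).
    by congr (\det _); apply/matrixP => i j'; rewrite !mxE.
  rewrite beta_empty; case: j => -[|j] lt_j; first by rewrite subn1.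
  suff -> : \det (col_repl M (fun i => hs (beta n mu i) (n - j.+2).+1) (Ordinal lt_j)) = 0.
    by rewrite !mulr0.
  rewrite -det_tr; apply: (@determinant_alternate _ _ _ (Ordinal lt_j) (Ordinal (ltnW lt_j))).
    by rewrite -val_eqE /= gtn_eqF.
  move=> i; rewrite !mxE eqxx -val_eqE /= ltn_eqF // /A beta_empty /=.
  by congr hs; move: lt_j; lia.
apply: (mulIf (pX_neq0 n)).
apply: (@recA_final _ s (\sum_(i < n) p ^+ beta n mu i)
  (\sum_(i < n) p ^+ beta n empty_part i) _ _ _ _ (p ^+ n.-1)).
- exact: qhalf_neq0.
- by rewrite -exprS.
- by apply: DT_beta; apply: leqnSn.
- rewrite (eq_bigr (fun i : 'I_n => p ^+ (n - i.+1))) => [|i _]; last by rewrite beta_empty.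
  by apply: geometric_bottom; rewrite ?qhalf_neq0 ?z_neq0.
rewrite XE' -trdetZ.
rewrite -[rowdet A mu]/(\det M) -(trdet_diagr M (fun j => p ^+ beta n empty_part j)).
rewrite -(trdet_diagl M (fun j => p ^+ beta n mu j)) -mulN1r -trdetZ -trdetD.
apply: eq_trdet => i j; rewrite !mxE mulN1r mulrC; apply: recA_entry (hs_rec _ _).
by rewrite mulrC qp1.
Qed.

End Recursions.

(** * Injectivity of s_box and transposition *)

Section Injectivity.
Implicit Types (la mu ga be al : intpart).

Lemma tvar_sum_inj n (e f : nat -> nat) :
    \sum_(i < n) tvar ^+ e i = \sum_(i < n) tvar ^+ f i ->
  forall i, (i < n)%N -> exists2 j, (j < n)%N & e i = f j.
Proof.
have sumE (a : nat -> nat) : \sum_(i < n) tvar ^+ a i = (\sum_(i < n) fpsX rat ^+ a i)%:F.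
  by rewrite rmorph_sum; apply: eq_bigr => i _; rewrite rmorphXn.
rewrite !sumE => /eqP; rewrite tofrac_eq => /eqP eq_s i lt_i.
apply: contrapT => no_j; have := congr1 (fun u => fps_coef u (e i)) eq_s.
have coefE a : fps_coef (\sum_(j < n) fpsX rat ^+ a j) (e i) =
    (\sum_(j < n) (e i == a j))%:R.
  rewrite fps_coef_sum natr_sum; apply: eq_bigr => j _.
  rewrite -[_ ^+ _]mulr1 fps_coef_shift fps_coef1 subn_eq0 eqn_leq.
  by case: ltngtP.
rewrite !coefE [X in _ = X%:R]big1 => [|j _]; last first.
  by apply/eqP; rewrite eqb0; apply/eqP => eq_ij; apply: no_j; exists j.
rewrite (bigD1 (Ordinal lt_i)) //= eqxx => /eqP; rewrite Num.Theory.pnatr_eq0.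
by rewrite addn_eq0.
Qed.

Lemma beta_sorted n la : sorted gtn (mkseq (beta n la) n).
Proof.
apply/(sortedP 0%N) => j; rewrite size_mkseq => lt_j.
by rewrite !nth_mkseq ?(ltnW lt_j) //; apply: beta_lt; rewrite ltnSn.
Qed.

(** By [D_beta] the value D la determines a sum of powers of q, hence the set of the
    exponents, which are the beta-numbers of la. *)
Lemma D_inj : injective D.
Proof.
move=> la mu eqD; pose n := maxn (size la) (size mu).
have le_la : (size la <= n)%N := leq_maxl _ _.
have le_mu : (size mu <= n)%N := leq_maxr _ _.
have eq_q : \sum_(i < n) q ^+ beta n la i = \sum_(i < n) q ^+ beta n mu i.
  apply: (mulfI qhalf_neq0); apply: (addIr z^-1).
  by rewrite -(D_beta le_la) -(D_beta le_mu) eqD.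
pose m := maxn (beta n la 0) (beta n mu 0).
pose e nu i := (2 * (m - beta n nu i))%N.
have sumE nu : (beta n nu 0 <= m)%N -> \sum_(i < n) tvar ^+ e nu i =
    tvar ^+ (2 * m) * \sum_(i < n) q ^+ beta n nu i.
  move=> le_m; rewrite mulr_sumr; apply: eq_bigr => i _.
  have le_b : (beta n nu i <= m)%N.
    by apply: leq_trans le_m; rewrite /beta; have := part_geq nu (leq0n i); lia.
  have -> : (2 * m = e nu i + 2 * beta n nu i)%N by rewrite /e; lia.
  rewrite exprD -mulrA tvarE exprM.
  by rewrite [p ^+ _ * _]mulrC qp1 mulr1.
have eq_e : \sum_(i < n) tvar ^+ e la i = \sum_(i < n) tvar ^+ e mu i.
  by rewrite !sumE ?leq_maxl ?leq_maxr // eq_q.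
have sub_b nu nu' : \sum_(i < n) tvar ^+ e nu i = \sum_(i < n) tvar ^+ e nu' i ->
    (beta n nu 0 <= m)%N -> (beta n nu' 0 <= m)%N ->
    {subset mkseq (beta n nu) n <= mkseq (beta n nu') n}.
  move=> eq_nu le_nu le_nu' b /mapP[i]; rewrite mem_iota add0n => lt_i ->.
  have [j lt_j] := tvar_sum_inj eq_nu lt_i; rewrite /e => eq_ij.
  apply/mapP; exists j; first by rewrite mem_iota.
  have : (beta n nu i <= m)%N.
    by apply: leq_trans le_nu; rewrite /beta; have := part_geq nu (leq0n i); lia.
  have : (beta n nu' j <= m)%N.
    by apply: leq_trans le_nu'; rewrite /beta; have := part_geq nu' (leq0n j); lia.
  lia.
have eq_seq : mkseq (beta n la) n = mkseq (beta n mu) n.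
  apply: (irr_sorted_eq (leT := gtn)) => [x y w|x| | |b].
  - by rewrite /gtn /=; lia.
  - by rewrite /gtn /= ltnn.
  - exact: beta_sorted.
  - exact: beta_sorted.
  by apply/idP/idP; apply: sub_b; rewrite ?leq_maxl ?leq_maxr.
apply: part_inj => i; have [lt_i|le_i] := ltnP i n; last first.
  by rewrite !part_default // (leq_trans _ le_i).
have := congr1 (nth 0%N ^~ i) eq_seq; rewrite !nth_mkseq // /beta.
exact: addIn.
Qed.

Lemma remseq_transpose (V : nmodType) la (F : intpart -> V) :
  \sum_(be <- remseq (transpose la)) F be = \sum_(be <- remseq la) F (transpose be).
Proof.
rewrite -(big_map transpose xpredT F); apply: perm_big; apply: uniq_perm.
- exact: uniq_remseq.
- by rewrite map_inj_uniq ?uniq_remseq //; apply: can_inj transposeK.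
move=> be; apply/idP/mapP => [/mem_remseq add_be|[al /mem_remseq add_al ->]].
  exists (transpose be); last by rewrite transposeK.
  by apply/mem_remseq; rewrite /rem_box /= -(transposeK la); apply: add_box_transpose.
by apply/mem_remseq; apply: add_box_transpose.
Qed.

Lemma addseq_transpose (V : nmodType) la (F : intpart -> V) :
  \sum_(ga <- addseq (transpose la)) F ga = \sum_(ga <- addseq la) F (transpose ga).
Proof.
rewrite -(big_map transpose xpredT F); apply: perm_big; apply: uniq_perm.
- exact: uniq_addseq.
- by rewrite map_inj_uniq ?uniq_addseq //; apply: can_inj transposeK.
move=> ga; apply/idP/mapP => [/mem_addseq add_ga|[al /mem_addseq add_al ->]].
  exists (transpose ga); last by rewrite transposeK.
  by apply/mem_addseq; rewrite -(transposeK la); apply: add_box_transpose.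
by apply/mem_addseq; apply: add_box_transpose.
Qed.

(** By [sum_remseq] and [sum_remseq_content], both sides satisfy the same recursion
    over the removed boxes, with the factor D la - D empty_part, nonzero by [D_inj]. *)
Lemma g_transpose la : g (transpose la) = s ^ (- kappa la) * g la.
Proof.
have [n] := ubnP (psize la); elim: n la => // n IHn la lt_n.
have [->|ne_la] := eqVneq la empty_part.
  by rewrite transpose_empty /kappa /boxes /= big_nil mulr0 oppr0 expr0z mul1r.
have D_neq : D la - z^-1 != 0.
  by rewrite subr_eq0 -D_empty; apply: contra_neq ne_la; apply: D_inj.
apply: (mulfI D_neq); rewrite -{1}(transposeK la) -sum_remseq remseq_transpose.
rewrite mulrCA -sum_remseq_content mulr_sumr; apply: eq_big_seq => al al_la.
rewrite IHn; last first.
  by move/mem_remseq/psize_add_box: al_la lt_n => ->.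
by rewrite mulrA -expfzDr ?qhalf_neq0 // addKr.
Qed.

End Injectivity.

Section VandermondeRatios.
Variables (F : fieldType) (N : nat) (y : nat -> F) (kap p tau z : F).
Hypothesis y_neq0 : forall i, y i != 0.
Hypothesis z_tau : z * tau = 1 - p.
Hypothesis y_last : y N = kap.

(** [G] and [G'] are the Jacobi-Trudi determinants before and after a change of one
    row, factored by [det_hshift_row], with [kap / y i] for q^(- beta_i).  Their ratio is
    brought to the form of a residue, as [lagrange] and [lagrange_remove] use it. *)
Lemma ratio_up (i : 'I_N.+1) (B h h' G G' : F) :
    h' * (1 - p * (kap / y i)) = tau * h -> 1 - p * (kap / y i) != 0 ->
    G = B * h * \prod_(j < N.+1 | j != i) (kap / y j - kap / y i) ->
    G' = B * h' * \prod_(j < N.+1 | j != i) (kap / y j - p * (kap / y i)) ->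
  G * \prod_(j < N) (1 - p * y j / y i) =
    z * G' * \prod_(j < N.+1 | j != i) (1 - y j / y i).
Proof.
move=> hE ne0 GE GE'; apply: (mulIf ne0).
have -> : G * \prod_(j < N) (1 - p * y j / y i) * (1 - p * (kap / y i)) =
    G * \prod_(j < N.+1) (1 - p * y j / y i).
  by rewrite big_ord_recr /= y_last -!mulrA.
rewrite (bigD1 i) //= -[p * y i / y i]mulrA divff // mulr1.
have split_y (c : F) : \prod_(j < N.+1 | j != i) (kap / y j - c * (kap / y i)) =
   \prod_(j < N.+1 | j != i) (kap / y j) * \prod_(j < N.+1 | j != i) (1 - c * y j / y i).
  rewrite -big_split; apply: eq_bigr => j _ /=.
  by field; rewrite !y_neq0.
have split1 : \prod_(j < N.+1 | j != i) (kap / y j - kap / y i) =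
   \prod_(j < N.+1 | j != i) (kap / y j) * \prod_(j < N.+1 | j != i) (1 - y j / y i).
  rewrite -big_split; apply: eq_bigr => j _ /=.
  by field; rewrite !y_neq0.
rewrite GE GE' split_y split1.
set P1 := \prod_(_ < _ | _) (1 - _ / _); set Pp := \prod_(_ < _ | _) (1 - p * _ / _).
set Y := \prod_(_ < _ | _) (kap / _).
transitivity (z * B * (h' * (1 - p * (kap / y i))) * Y * Pp * P1); last by ring.
by rewrite hE -z_tau; ring.
Qed.

Lemma ratio_down (q : F) (i : 'I_N) (B h h' G G' : F) :
    tau * (1 - q) = - z -> h * (1 - kap / y i) = tau * h' -> 1 - kap / y i != 0 ->
    G = B * h * \prod_(j < N.+1 | j != i :> nat) (kap / y j - kap / y i) ->
    G' = B * h' * \prod_(j < N.+1 | j != i :> nat) (kap / y j - q * (kap / y i)) ->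
  G * \prod_(j < N.+1) (1 - q * y j / y i) =
    - z * G' * \prod_(j < N | j != i) (1 - y j / y i).
Proof.
move=> zE hE ne0 GE GE'; apply: (mulIf ne0).
have lt_i : (i < N.+1)%N := ltnW (ltn_ord i).
have split_last : \prod_(j < N.+1 | j != i :> nat) (1 - y j / y i) =
    \prod_(j < N | j != i) (1 - y j / y i) * (1 - kap / y i).
  rewrite big_mkcond big_ord_recr /= y_last gtn_eqF //= -big_mkcond.
  by congr (_ * _); apply: eq_bigl => j.
rewrite -[RHS]mulrA -split_last (bigD1 (Ordinal lt_i)) //=.
rewrite -[q * y i / y i]mulrA divff // mulr1.
rewrite (eq_bigl (fun j : 'I_N.+1 => j != i :> nat)) //.
have split_y : \prod_(j < N.+1 | j != i :> nat) (kap / y j - q * (kap / y i)) =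
   \prod_(j < N.+1 | j != i :> nat) (kap / y j) *
   \prod_(j < N.+1 | j != i :> nat) (1 - q * y j / y i).
  rewrite -big_split; apply: eq_bigr => j _ /=.
  by field; rewrite !y_neq0.
have split1 : \prod_(j < N.+1 | j != i :> nat) (kap / y j - kap / y i) =
   \prod_(j < N.+1 | j != i :> nat) (kap / y j) *
   \prod_(j < N.+1 | j != i :> nat) (1 - y j / y i).
  rewrite -big_split; apply: eq_bigr => j _ /=.
  by field; rewrite !y_neq0.
rewrite GE GE' split_y split1.
set P1 := \prod_(_ < _ | _) (1 - _ / _); set Pq := \prod_(_ < _ | _) (1 - q * _ / _).
set Y := \prod_(_ < _ | _) (kap / _).
transitivity (B * (h * (1 - kap / y i)) * (1 - q) * Y * Pq * P1); first by ring.
by rewrite hE -zE; ring.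
Qed.

End VandermondeRatios.

(** * Partial fractions over addable and removable boxes *)

Lemma q_neq0 : q != 0.
Proof. by rewrite expf_neq0 ?qhalf_neq0. Qed.

Lemma fps_coef_affine (F : fieldType) (c d : F) (f : fps F) k :
  fps_coef ((fpsC c - fpsC d * fpsX F) * f) k = c * fps_coef f k - d * prev (fps_coef f) k.
Proof.
rewrite mulrBl -mulrA fps_coefD fps_coefN !fps_coefCM -[fpsX F]expr1 fps_coef_shift.
by case: k => [|k]; rewrite ?mulr0 //= subn1.
Qed.

Fact sum_rem_solve (F : fieldType) (x y G X P h h' S : F) :
  G * (P * h) = X * h - G / x * h' + - (y * S) -> y * S = X * h - G * (x^-1 * h' + P * h).
Proof.
move=> GE; have -> : G * (x^-1 * h' + P * h) = G / x * h' + G * (P * h) by ring.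
by rewrite GE; ring.
Qed.

(** The identities of polynomials given by interpolation become identities of power
    series once the common denominator is divided out. *)
Lemma partial_fractions (R : idomainType) n (l e c : 'I_n -> R) (S H P C Q : R) :
    (forall i, l i * e i = 1) -> S * \prod_i l i = H * P ->
    C * P = Q * \prod_i l i + \sum_i c i * \prod_(j | j != i) l j ->
  C * S = Q * H + \sum_i c i * (H * e i).
Proof.
move=> le1 SE CE; have l_neq0 : \prod_i l i != 0.
  apply/prodf_neq0 => i _; apply: contra_eq_neq (le1 i) => ->.
  by rewrite mul0r eq_sym oner_neq0.
apply: (mulIf l_neq0); rewrite -mulrA SE mulrCA CE mulrDl mulrDr; congr (_ + _).
  by ring.
rewrite mulr_sumr mulr_suml; apply: eq_bigr => i _.
rewrite [in RHS](bigD1 i) //=; set P' := \prod_(_ | _) _.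
transitivity (c i * H * P' * (l i * e i)); last by ring.
by rewrite le1; ring.
Qed.

Section PartialFractions.
Variable mu : intpart.
Let N := size mu.
Let n := N.+1.

(** q^c for the content c of the box that would be added in row [i]. *)
Let y (i : nat) : K := s ^ (2 * ((part mu i)%:Z - i%:Z)).

Let y_neq0 i : y i != 0.
Proof. by rewrite expfz_neq0 ?qhalf_neq0. Qed.

Lemma spow_inj (a b : int) : s ^ a = s ^ b -> a = b.
Proof.
wlog le_ab : a b / (a <= b)%R => [wl eq_ab|].
  by have [le|/ltW le] := leP a b; [|apply/esym]; apply: wl.
have -> : b = a + (absz (b - a))%:Z by lia.
rewrite expfzDr ?qhalf_neq0 // -[X in X = _]mulr1.
move/(mulfI (expfz_neq0 _ qhalf_neq0)); rewrite -exprnP => eq1.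
have := @qX_inj 0 (absz (b - a)); rewrite expr0 exprAC -eq1 expr1n => /(_ erefl).
lia.
Qed.

Let y_inj : injective y.
Proof.
move=> i j /spow_inj eq_c; apply/eqP; rewrite eqn_leq; apply/andP; split; rewrite leqNgt;
  apply/negP => lt; have := part_geq mu (ltnW lt); lia.
Qed.

Let y_last : y N = p ^+ N.
Proof.
rewrite /y part_default // (expVX2 s) -exprM exprnN; congr (_ ^ _); lia.
Qed.

Let p_beta i : (i < n)%N -> p ^+ (beta n mu i) = p ^+ N / y i.
Proof.
move=> lt_i; have yE := content_beta mu lt_i.
have {}yE : y i * q ^+ N = q ^+ beta n mu i.
  by apply: (mulIf q_neq0); rewrite -mulrA -!exprSr.
by rewrite !(expVX2 s) -yE invfM mulrC.
Qed.

Let pX_inj i j : p ^+ i = p ^+ j -> i = j.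
Proof. by rewrite !(expVX2 s) => /invr_inj/qX_inj. Qed.

(** The Jacobi-Trudi determinant of g mu with beta-number [m] in row [i0]. *)
Let jt (i0 : 'I_n) (m : nat) : K :=
  \det (\matrix_(i < n, j < n) hs (if i == i0 then m else beta n mu i) (beta n empty_part j)).

Let jt_row (i0 : 'I_n) : exists B, forall m,
  jt i0 m = B * hrho m * \prod_(j < n | j != i0) (p ^+ N / y j - p ^+ m).
Proof.
have [|i j /beta_inj //|B BE] := @det_hshift_row _ hrho p s^-1 hrho_rec hrho_neq0
  sV_neq0 (pX_neq0 1) pX_inj n (beta n mu) (beta n empty_part) i0.
  by move=> j; rewrite beta_empty; lia.
exists B => m; rewrite /jt BE; congr (_ * _); apply: eq_bigr => j _.
by rewrite p_beta.
Qed.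

Let jt_same (i0 : 'I_n) : jt i0 (beta n mu i0) = g mu.
Proof.
rewrite (g_det (leqnSn (size mu))); congr (\det _); apply/matrixP => i j.
by rewrite !mxE; case: eqP => [->|].
Qed.

Let A k (j : 'I_n) := hs k (beta n empty_part j).

Let jt_repl (i0 : 'I_n) m :
  jt i0 m = \det (row_repl (\matrix_(i < n, j < n) A (beta n mu i) j) (A m) i0).
Proof. by congr (\det _); apply/matrixP => i j; rewrite !mxE; case: eqP. Qed.

Let z_tau : z * s^-1 = 1 - p.
Proof. by rewrite mulrBl mulfV ?qhalf_neq0 // expr2. Qed.

Let ge_beta (i : 'I_n) : 1 - p * (p ^+ N / y i) != 0.
Proof. by rewrite -p_beta // -exprS p_neq1. Qed.

Let add_row (i : 'I_n) :
  g mu * \prod_(j < N) (1 - p * y j / y i) =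
    z * jt i (beta n mu i).+1 * \prod_(j < n | j != i) (1 - y j / y i).
Proof.
have [B BE] := jt_row i.
apply: (@ratio_up K N y (p ^+ N) p s^-1 z y_neq0 z_tau y_last i B
  (hrho (beta n mu i)) (hrho (beta n mu i).+1) _ _ _ (ge_beta i)).
- by rewrite -p_beta // -exprS hrho_rec.
- by rewrite -(jt_same i) BE p_beta.
by rewrite BE [p ^+ _.+1]exprS p_beta.
Qed.

Let pq1 : p * q = 1.
Proof. by rewrite mulrC; apply: (qp1 1). Qed.

Let beta_gt0 i : (i < N)%N -> (0 < beta n mu i)%N.
Proof. by rewrite /beta /n; lia. Qed.

Let rem_row (i : 'I_N) (i' := widen_ord (leqnSn N) i) :
  g mu * \prod_(j < n) (1 - q * y j / y i) =
    - z * jt i' (beta n mu i).-1 * \prod_(j < N | j != i) (1 - y j / y i).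
Proof.
have [B BE] := jt_row i'; have b_gt0 := beta_gt0 (ltn_ord i).
have lt_i : (i < n)%N := ltn_ord i'.
have bE : beta n mu i = (beta n mu i).-1.+1 by rewrite prednK.
have yiE : p ^+ N / y i = p * p ^+ (beta n mu i).-1 by rewrite -exprS -bE p_beta.
apply: (@ratio_down K N y (p ^+ N) s^-1 z y_neq0 y_last q i B
  (hrho (beta n mu i)) (hrho (beta n mu i).-1)).
- by rewrite mulrBr mulr1 expr2 mulKf ?qhalf_neq0 // opprB.
- by rewrite -p_beta // {1 2}bE hrho_rec.
- by rewrite -p_beta // bE p_neq1.
- rewrite -(jt_same i') BE p_beta //; congr (_ * _); apply: eq_bigl => j.
rewrite BE; congr (_ * _); apply: eq_big => [j|j _]; first by rewrite -val_eqE.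
by rewrite yiE mulrA [q * p]mulrC pq1 mul1r.
Qed.

(** The numerator of H(qu) / H(u), interpolated at the poles. *)
Let add_poly :
  g mu *: \prod_(j < N) (1 - (y j / s) *: 'X) =
  \sum_(i < n) (z * jt i (beta n mu i).+1) *:
    \prod_(j < n | j != i) (1 - (y j * s) *: 'X) :> {poly K}.
Proof.
pose w k := if insub k is Some i then z * jt i (beta n mu (i : 'I_n)).+1 else 0.
transitivity (\sum_(i < n) w i *: \prod_(j < n | j != i) (1 - (y j * s) *: 'X) : {poly K}).
  2: by apply: eq_bigr => i _; rewrite /w valK.
apply: (@lagrange _ n (fun j => y j * s) w) => [|i|i j _ _ /(mulIf qhalf_neq0)|i].
- apply: (leq_trans (size_scale_leq _ _)).
  by case: (prod_lin_top N (fun j => y j / s)).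
- by rewrite mulf_neq0 ?y_neq0 ?qhalf_neq0.
- exact: y_inj.
rewrite hornerZ (horner_prod_lin (fun j => y j / s)) /w valK.
have -> : \prod_(j < N) (1 - y j / s * (y i * s)^-1) = \prod_(j < N) (1 - p * y j / y i).
  by apply: eq_bigr => j _; rewrite invfM; ring.
rewrite add_row; congr (_ * _); apply: eq_bigr => j _.
by rewrite invfM mulrACA divff ?qhalf_neq0 // mulr1.
Qed.

(** The numerator of H(u/q) / H(u), whose degree exceeds that of the denominator by
    one; hence the additional linear factor. *)
Let rem_poly (G := g mu) (v := fun k => if insub k is Some i then
    jt (widen_ord (leqnSn N) i) (beta n mu (i : 'I_N)).-1 else 0) :
  G *: \prod_(j < n) (1 - (y j / s) *: 'X) =
    ((G + z * \sum_(i < N) v i)%:P - (G / s) *: 'X) *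
      \prod_(j < N) (1 - (p * (y j / s)) *: 'X)
    - z *: \sum_(i < N) v i *: \prod_(j < N | j != i) (1 - (p * (y j / s)) *: 'X).
Proof.
apply: (@lagrange_remove K N (fun j => y j / s) v G s p z).
- exact: (pX_neq0 1).
- exact: qhalf_neq0.
- by move=> i; rewrite mulf_neq0 ?y_neq0 ?sV_neq0.
- by move=> i j _ _ /(mulIf sV_neq0)/y_inj.
- by rewrite y_last.
move=> i; have yE j : y j / s / (y i / s) = y j / y i.
  by rewrite invfM invrK mulrACA mulVf ?qhalf_neq0 // mulr1.
have pV : p^-1 = q by rewrite exprVn invrK.
under eq_bigr => j _ do rewrite -mulrA yE pV mulrA.
under [X in _ = _ * X]eq_bigr => j _ do rewrite yE.
by rewrite rem_row /v valK.
Qed.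

Let fps_prod_lin m (c : nat -> K) (P : pred 'I_m) :
  fps_of_poly (\prod_(j < m | P j) (1 - c j *: 'X)) = \prod_(j < m | P j) lin (c j).
Proof. by rewrite rmorph_prod. Qed.

Let fpsCM c (P : {poly K}) : fps_of_poly (c *: P) = fpsC c * fps_of_poly P.
Proof. by rewrite -mul_polyC rmorphM. Qed.

Let qrhoE j : qrho mu j = y j / s.
Proof.
by rewrite /y -exprN1 -expfzDr ?qhalf_neq0 //; congr (_ ^ _); lia.
Qed.

Let Hrho_q : lin s * fscale q Hrho = Hrho.
Proof.
have := congr1 (fscale q) Hrho_scale; rewrite fscaleM fscale_lin.
have -> : q * tvar = s by rewrite tvarE expr2 mulfK ?qhalf_neq0.
move=> <-; apply: fpsP => k /=.
by rewrite mulrA tvarE qp1 mul1r.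
Qed.

Lemma Hq_scale_q :
  fscale q (Hq mu) * \prod_(j < n) lin (y j * s) = Hq mu * \prod_(j < N) lin (y j / s).
Proof.
have := congr1 (fscale q) (Hq_lin (leqnSn N)); rewrite !fscaleM !fscale_prod.
have -> : \prod_(j < n) fscale q (lin (qrho mu j)) = \prod_(j < n) lin (y j * s).
  apply: eq_bigr => j _; rewrite fscale_lin qrhoE; congr lin.
  by rewrite expr2 mulrC -mulrA mulKf ?qhalf_neq0.
move=> ->; have -> : \prod_(j < N) lin (y j / s) = \prod_(j < N) lin (qrho mu j).
  by apply: eq_bigr => j _; rewrite qrhoE.
rewrite (Hq_lin (leqnn N)) big_ord_recl /= fscale_lin qrho_empty tvarE.
have -> : q * s^-1 ^+ (2 * 0).+1 = s by rewrite expr1 expr2 mulfK ?qhalf_neq0.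
rewrite mulrA [_ * lin s]mulrC Hrho_q; congr (_ * _).
apply: eq_bigr => j _; rewrite fscale_lin !qrho_empty tvarE; congr lin.
have -> : (2 * bump 0 j).+1 = (2 + (2 * j).+1)%N by rewrite /bump; lia.
by rewrite exprD mulrA [q * p]mulrC pq1 mul1r.
Qed.

Lemma Hq_scale_p :
  fscale p (Hq mu) * \prod_(j < N) lin (p * (y j / s)) = Hq mu * \prod_(j < n) lin (y j / s).
Proof.
have := congr1 (fscale p) Hq_scale_q.
rewrite fscaleM [X in _ = X -> _]fscaleM !fscale_prod.
have -> : fscale p (fscale q (Hq mu)) = Hq mu.
  by apply: fpsP => k /=; rewrite mulrA [_ * q ^+ _]mulrC qp1 mul1r.
have -> : \prod_(j < N) fscale p (lin (y j / s)) = \prod_(j < N) lin (p * (y j / s)).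
  by apply: eq_bigr => j _; rewrite fscale_lin.
move=> <-; congr (_ * _); apply: eq_bigr => j _; rewrite fscale_lin; congr lin.
by rewrite mulrC expr2 -mulrA mulVKf ?qhalf_neq0.
Qed.

(** Coefficients of the partial fraction expansion of H(qu) / H(u), multiplied by
    H(u).  The rows without an addable box have residue zero. *)
Lemma sum_add_geo k :
  z * \sum_(ga <- addseq mu) g ga * fps_coef (Hq mu * geo (s ^ (kappa ga - kappa mu) * s)) k =
  g mu * (q ^+ k * fps_coef (Hq mu) k).
Proof.
have fps_id : fpsC (g mu) * fscale q (Hq mu) =
    \sum_(i < n) fpsC (z * jt i (beta n mu i).+1) * (Hq mu * geo (y i * s)).
  have fps_add : fpsC (g mu) * \prod_(j < N) lin (y j / s) =
      \sum_(i < n) fpsC (z * jt i (beta n mu i).+1) *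
        \prod_(j < n | j != i) lin (y j * s).
    transitivity (fps_of_poly (g mu *: \prod_(j < N) (1 - (y j / s) *: 'X))).
      rewrite fpsCM; congr (_ * _); apply: esym.
      exact: (@fps_prod_lin N (fun j => y j / s) xpredT).
    rewrite add_poly rmorph_sum.
    apply: eq_bigr => i _; rewrite [LHS]fpsCM; congr (_ * _).
    exact: (@fps_prod_lin n (fun j => y j * s) (fun j => j != i)).
  have lin_geo_y (i : 'I_n) : lin (y i * s) * geo (y i * s) = 1 by apply: lin_geo.
  have := partial_fractions (Q := 0) (C := fpsC (g mu))
    (c := fun i => fpsC (z * jt i (beta n mu i).+1)) lin_geo_y Hq_scale_q.
  by rewrite !mul0r !add0r; apply.
have := congr1 (fun f => fps_coef f k) fps_id.
rewrite fps_coefCM => -[->]; rewrite fps_coef_sum mulr_sumr.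
transitivity (\sum_(i < n) z * (fps_coef (Hq mu * geo (y i * s)) k * jt i (beta n mu i).+1)).
  under [RHS]eq_bigr => i _ do rewrite jt_repl.
  rewrite -!mulr_sumr; congr (_ * _).
  rewrite (sum_rowdet_add A (fun c => fps_coef (Hq mu * geo (s ^ c * s)) k) (leqnn n)).
  apply: eq_big_seq => ga /mem_addseq/add_boxP[i add_i ->].
  by rewrite mulrC (@g_det n) // size_addrow ?leqnSn // (addable_lt _ add_i).
by apply: eq_bigr => i _; rewrite fps_coefCM; ring.
Qed.

(** The same for H(u/q) / H(u); the terms with [prev] and without a power of q come
    from the polynomial part. *)
Lemma sum_rem_geo k :
  z * \sum_(al <- remseq mu) g al * fps_coef (Hq mu * geo (s ^ (kappa mu - kappa al) / s)) k =
  (g mu + z * \sum_(al <- remseq mu) g al) * fps_coef (Hq mu) k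
  - g mu * (s^-1 * prev (fps_coef (Hq mu)) k + q ^- k * fps_coef (Hq mu) k).
Proof.
pose v i := if insub i is Some i' then
  jt (widen_ord (leqnSn N) i') (beta n mu (i' : 'I_N)).-1 else 0.
have vE (i : 'I_N) : v i = jt (widen_ord (leqnSn N) i) (beta n mu i).-1 by rewrite /v valK.
have sum_v (W : int -> K) : \sum_(al <- remseq mu) W (kappa mu - kappa al) * g al =
    \sum_(i < N) W (2 * ((part mu i)%:Z - 1 - i%:Z)) * v i.
  transitivity (\sum_(al <- remseq mu) W (kappa mu - kappa al) * rowdet A al).
    apply: eq_big_seq => al /mem_remseq/rem_boxP[i rem_i ->].
    by rewrite (@g_det n) // size_remrow.
  rewrite -(sum_rowdet_rem A W (leqnSn N)) big_ord_recr /=.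
  rewrite [X in _ + X](_ : _ = 0) ?addr0; last first.
    rewrite (@rowdet_rem _ _ A mu ord_max (leqnSn N)) ifF ?mulr0 //.
    by rewrite /removable !part_default.
  apply: eq_bigr => i _; congr (_ * _); rewrite vE jt_repl.
  congr (\det (row_repl _ _ _)); apply/funext => j /=.
  by case: (beta n mu i) (beta_gt0 (ltn_ord i)).
have sumG : \sum_(al <- remseq mu) g al = \sum_(i < N) v i.
  have := sum_v (fun=> 1); under eq_bigr do rewrite mul1r.
  by under [RHS]eq_bigr do rewrite mul1r.
pose G := g mu; pose X := G + z * \sum_(i < N) v i.
have fps_id : fpsC G * fscale p (Hq mu) =
    (fpsC X - fpsC (G / s) * fpsX K) * Hq mu
    + \sum_(i < N) fpsC (- (z * v i)) * (Hq mu * geo (p * (y i / s))).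
  have fps_rem : fpsC G * \prod_(j < n) lin (y j / s) =
      (fpsC X - fpsC (G / s) * fpsX K) * \prod_(j < N) lin (p * (y j / s))
      + \sum_(i < N) fpsC (- (z * v i)) * \prod_(j < N | j != i) lin (p * (y j / s)).
    transitivity (fps_of_poly (G *: \prod_(j < n) (1 - (y j / s) *: 'X))).
      rewrite fpsCM; congr (_ * _); apply: esym.
      exact: (@fps_prod_lin n (fun j => y j / s) xpredT).
    rewrite rem_poly -/v -/G -/X rmorphB rmorphM; congr (_ * _ + _).
    - rewrite rmorphB; congr (_ - _); rewrite [LHS]fpsCM; congr (_ * _).
      by apply: fpsP => i; rewrite /= coefX.
    - exact: (@fps_prod_lin N (fun j => p * (y j / s)) xpredT).
    rewrite -rmorphN -scaleNr scaler_sumr rmorph_sum; apply: eq_bigr => i _.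
    rewrite scalerA mulNr [LHS]fpsCM; congr (_ * _).
    exact: (@fps_prod_lin N (fun j => p * (y j / s)) (fun j => j != i)).
  have lin_geo_y (i : 'I_N) : lin (p * (y i / s)) * geo (p * (y i / s)) = 1.
    exact: lin_geo.
  exact: (partial_fractions lin_geo_y Hq_scale_p fps_rem).
rewrite sumG -/G -/X -(expVX2 s); apply: sum_rem_solve.
have -> : \sum_(al <- remseq mu) g al * fps_coef (Hq mu * geo (s ^ (kappa mu - kappa al) / s)) k =
    \sum_(i < N) v i * fps_coef (Hq mu * geo (p * (y i / s))) k.
  under eq_bigr => al _ do rewrite mulrC.
  rewrite (sum_v (fun c => fps_coef (Hq mu * geo (s ^ c / s)) k)).
  apply: eq_bigr => i _; rewrite mulrC; congr (_ * fps_coef (_ * geo _) _).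
  rewrite mulrA; congr (_ / s); rewrite /y (exprVn s 2) exprnN -expfzDr ?qhalf_neq0 //.
  by congr (_ ^ _); lia.
transitivity (fps_coef (fpsC G * fscale p (Hq mu)) k); first by rewrite fps_coefCM.
rewrite fps_id fps_coefD fps_coef_affine; congr (_ + _).
rewrite fps_coef_sum mulr_sumr -sumrN; apply: eq_bigr => i _.
by rewrite fps_coefCM mulNr mulrA.
Qed.

End PartialFractions.

(** * The vertex as a determinant *)

Opaque Hq.

(** Here [y] is q^c for the content c of the added box. *)
Lemma Hq_add_box (mu ga : intpart) (y := s ^ (kappa ga - kappa mu)) : add_box mu ga ->
  Hq ga * lin (y * s) = Hq mu * lin (y / s).
Proof.
rewrite {}/y => /add_boxP[i add_i ->]; rewrite kappa_addrow // addrAC subrr add0r.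
have := Hq_addrow add_i => /=.
by rewrite !expfzDr ?qhalf_neq0 // expr1z exprN1.
Qed.

(** Transposition negates contents. *)
Lemma Hq_add_box_transpose (mu ga : intpart) (y := s ^ (kappa ga - kappa mu)) :
  add_box mu ga ->
  Hq (transpose ga) * lin (y^-1 * s) = Hq (transpose mu) * lin (y^-1 / s).
Proof.
rewrite {}/y => add_ga; have := Hq_add_box (add_box_transpose add_ga).
by rewrite !kappa_transpose -opprD -invr_expz.
Qed.

Fact mul_lin_geo (F : idomainType) (f h : fps F) a b :
  f * lin a = h * lin b -> f = lin b * (h * geo a).
Proof.
move=> fa; have -> : lin b * (h * geo a) = h * lin b * geo a by ring.
by rewrite -fa -mulrA lin_geo mulr1.
Qed.

Fact lin_mul_geo (F : idomainType) (h : fps F) a : lin a * (h * geo a) = h.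
Proof. by rewrite mulrCA lin_geo mulr1. Qed.

Fact ys_ratio (F : fieldType) (x y : F) : x != 0 -> y != 0 ->
  [/\ y * x / (y / x) = x ^+ 2, y / x / (y * x) = x^-1 ^+ 2,
      (y * x)^-1 = y^-1 / x & (y / x)^-1 = y^-1 * x].
Proof. by move=> x_neq0 y_neq0; split; field; rewrite ?x_neq0 ?y_neq0. Qed.

Fact remove_entry (F : fieldType) (x z G S A B H P P' : F) :
  G * (P^-1 * x^-1 * A + (x ^+ 2)^-1 * P'^-1 * B) + z / x * S = G * H ->
  - (z / x) * S = x^-1 * G * (P^-1 * A) + G * ((x ^+ 2 * P')^-1 * B) + (- G) * H.
Proof.
move=> eqS; have -> : - G * H = - (G * H) by rewrite mulNr.
by rewrite -eqS invfM; ring.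
Qed.

Section VertexDeterminant.
Implicit Types (la mu nu eta ga be al : intpart).

Definition kern mu (k l : nat) : K := ck (Hq mu) (Hq (transpose mu)) k l.

(** The sum over eta in the vertex whose second partition is the transpose of mu, see
    [vertex_sum]. *)
Definition Z n mu la nu : K :=
  \det (\matrix_(i < n, j < n) kern mu (beta n la i) (beta n nu j)).

Lemma skew_schur_eq0 la eta mu : ~~ part_incl eta la -> skew_schur la eta (qrho mu) = 0.
Proof.
move=> nincl; apply: limK_eq; apply: (cvgK_eventually (n0 := 0%N)) (cvgK_cst 0) => N _.
by rewrite /skew_schur_poly (negPf nincl).
Qed.

(** The entries of the matrix are products of rows of h_(k - e)(q^(mu + rho)) and
    h_(l - e)(q^(mu^t + rho)) summed over e, and Cauchy-Binet, in the form of
    [slater_skew_schur], expands the determinant into products of Jacobi-Trudi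
    determinants. *)
Lemma vertex_sum n mu la nu : (size la <= n)%N -> (size nu <= n)%N ->
  \sum_(eta \in [set: intpart])
    (skew_schur la eta (qrho mu) * skew_schur nu eta (qrho (transpose mu))) = Z n mu la nu.
Proof.
move=> le_la le_nu; pose m := part la 0.
pose Phi (j : 'I_n) : fps K := Fps (fun e =>
  if (e <= beta n nu j)%N then fps_coef (Hq (transpose mu)) (beta n nu j - e) else 0).
(* The series [Phi j] lists the h_(l_j - e) by increasing e, so that its Slater
   determinants are the transposed Jacobi-Trudi determinants for nu. *)
transitivity (slater n (fun j => Phi j * Hq mu) la); last first.
  congr (\det _); apply/matrixP => i j; rewrite !mxE /kern /ck.
  set k := beta n la i; set l := beta n nu j.
  rewrite mulrC fps_coefM (reindex_inj rev_ord_inj) /=.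
  rewrite (@big_ord_widen_cond _ _ _ (minn k l).+1 k.+1 xpredT (fun e => fps_coef (Hq mu) (k - e)
    * fps_coef (Hq (transpose mu)) (l - e))) ?ltnS ?geq_minl // [RHS]big_mkcond /=.
  apply: eq_bigr => e _; have le_e : (e <= k)%N by rewrite -ltnS.
  rewrite subSS subKn // ltnS leq_min le_e /=.
  by case: ifP; rewrite ?mulr0.
rewrite (@slater_skew_schur n m) //.
rewrite -(fsbig_widen [set` rect n m]%classic); last 2 first.
- by [].
- move=> eta [_ /= nin]; have nincl : ~~ part_incl eta la.
    apply/negP => incl; apply: nin; apply: mem_rect.
      exact: leq_trans (size_part_incl incl) le_la.
    by move/part_inclP: incl.
  by rewrite skew_schur_eq0 // mul0r.
rewrite -fsbig_seq ?rect_uniq //; apply: eq_bigr => eta _.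
have [incl|nincl] := boolP (part_incl eta la); last by rewrite skew_schur_eq0 // !mul0r.
congr (_ * _); rewrite (@skew_schur_jt n) ?(leq_trans (size_part_incl incl)) //.
rewrite /slater -det_tr; congr (\det _); apply/matrixP => i j; rewrite !mxE.
by rewrite /monom fps_coef_shift.
Qed.

Section Minors.
Variables (N : nat) (mu la nu : intpart).
Let n := N.+1.
Hypothesis le_la : (size la <= N)%N.
Hypothesis le_nu : (size nu <= N)%N.

Let M : 'M[K]_n := \matrix_(i < n, j < n) kern mu (beta n la i) (beta n nu j).

Let colA (l : nat) (i : 'I_n) : K := kern mu (beta n la i) l.
Let rowA (k : nat) (j : 'I_n) : K := kern mu k (beta n nu j).

Let colE ga : rowdet colA ga = Z n mu la ga.
Proof. by rewrite /Z -det_tr; congr (\det _); apply/matrixP => i j; rewrite !mxE. Qed.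

Let tr_col (v : 'I_n -> K) j : \det (col_repl M v j) =
  \det (row_repl (\matrix_(i < n, k < n) colA (beta n nu i) k) v j).
Proof.
by rewrite -det_tr; congr (\det _); apply/matrixP => i k; rewrite !mxE.
Qed.

Lemma sum_col_add (W : int -> K) :
  \sum_(j < n) W (2 * ((part nu j)%:Z - j%:Z)) *
    \det (col_repl M (fun i => kern mu (beta n la i) (beta n nu j).+1) j) =
  \sum_(ga <- addseq nu) W (kappa ga - kappa nu) * Z n mu la ga.
Proof.
under eq_bigr => j _ do rewrite tr_col.
rewrite (sum_rowdet_add colA W); last by rewrite ltnS.
by apply: eq_bigr => ga _; rewrite colE.
Qed.

Lemma sum_col_rem (W : int -> K) :
  \sum_(j < n) W (2 * ((part nu j)%:Z - 1 - j%:Z)) *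
    \det (col_repl M (fun i => prev (kern mu (beta n la i)) (beta n nu j)) j) =
  \sum_(be <- remseq nu) W (kappa nu - kappa be) * Z n mu la be.
Proof.
under eq_bigr => j _ do rewrite tr_col.
transitivity (\sum_(be <- remseq nu) W (kappa nu - kappa be) * rowdet colA be); last first.
  by apply: eq_bigr => be _; rewrite colE.
rewrite -(sum_rowdet_rem colA W (leqW le_nu)); apply: eq_bigr => j _.
congr (_ * \det (row_repl _ _ _)); exact/funext.
Qed.

Lemma sum_row_rem :
  \sum_(i < n) \det (row_repl M (fun j => prev ((kern mu)^~ (beta n nu j)) (beta n la i)) i) =
  \sum_(be <- remseq la) Z n mu be nu.
Proof.
transitivity (\sum_(be <- remseq la) 1 * rowdet rowA be); last first.
  by apply: eq_bigr => be _; rewrite mul1r.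
rewrite -(sum_rowdet_rem rowA (fun=> 1) (leqW le_la)); apply: eq_bigr => i _.
rewrite mul1r; congr (\det (row_repl _ _ _)); exact/funext.
Qed.

Lemma beta_last : beta n nu N = 0%N.
Proof. by rewrite /beta part_default // subnn. Qed.

(** Since the last beta-number of nu is 0, the last column of [M] consists of the
    h_(k_i)(q^(mu + rho)), and [trdet_col] applies.  This is why one more row than the
    length of nu is used. *)
Lemma trdet_last_col (l : 'I_n -> K) :
  trdet M (\matrix_(i, j) (fps_coef (Hq mu) (beta n la i) * l j)) = l ord_max * Z n mu la nu.
Proof.
rewrite -(trdet_col M ord_max l); apply: eq_trdet => i j; rewrite !mxE /= beta_last.
by rewrite /kern ckn0 Hq0 mulr1.
Qed.

(** Adding boxes to nu raises column indices and removing boxes from la lowers row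
    indices; by [ck_shift] the difference of the two shifts has rank one, with the last
    column of [M] as its left factor. *)
Lemma Z_R13 :
  D (transpose mu) * Z n mu la nu =
    \sum_(ga <- addseq nu) Z n mu la ga - \sum_(be <- remseq la) Z n mu be nu.
Proof.
apply/eqP; rewrite eq_sym subr_eq; apply/eqP.
transitivity (\sum_(ga <- addseq nu) 1 * Z n mu la ga).
  by apply: eq_bigr => ga _; rewrite mul1r.
rewrite -(sum_col_add (fun=> 1)) -sum_row_rem.
have -> : \sum_(i < n) \det (row_repl M (fun j => prev ((kern mu)^~ (beta n nu j)) (beta n la i)) i)
   = trdet M (\matrix_(i, j) prev ((kern mu)^~ (beta n nu j)) (beta n la i)).
  rewrite trdet_rows; apply: eq_bigr => i _; congr (\det (row_repl _ _ _)).
  by apply/funext => j; rewrite mxE.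
have -> : D (transpose mu) * Z n mu la nu =
   trdet M (\matrix_(i, j) (fps_coef (Hq mu) (beta n la i)
      * fps_coef (Hq (transpose mu)) (beta n nu j).+1)).
  by rewrite trdet_last_col /= beta_last.
rewrite -trdetD (sum_col_repl M (fun=> 1)
  (fun j i => kern mu (beta n la i) (beta n nu j).+1)).
by apply: eq_trdet => i j; rewrite !mxE mul1r; apply: ck_shift.
Qed.

(** Adding a box to mu multiplies the kernel by
    (1 - y u / s)(1 - v / (y s)) / ((1 - y s u)(1 - s v / y)), and removing one by the
    inverse of this factor for the smaller partition; both are of the form treated in
    [ck_update]. *)
Let kern_add ga (y := s ^ (kappa ga - kappa mu)) k l : add_box mu ga ->
  q * kern ga k l = kern mu k l + (q - 1) *
    (fps_coef (Hq mu * geo (y * s)) k * fps_coef (Hq (transpose mu) * geo (y^-1 * s)) l).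
Proof.
move=> add_ga; have y_neq0 : y != 0 by rewrite expfz_neq0 ?qhalf_neq0.
have [ab _ aV bV] := ys_ratio qhalf_neq0 y_neq0.
have ys_neq0 : y * s != 0 by rewrite mulf_neq0 ?qhalf_neq0.
have yVs_neq0 : y / s != 0 by rewrite mulf_neq0 ?sV_neq0.
have := ck_update (Hq mu * geo (y * s)) (Hq (transpose mu) * geo (y^-1 * s)) k l
  ys_neq0 yVs_neq0.
rewrite ab aV bV !lin_mul_geo -(mul_lin_geo (Hq_add_box add_ga)).
by rewrite -(mul_lin_geo (Hq_add_box_transpose add_ga)).
Qed.

Let kern_rem al (y := s ^ (kappa mu - kappa al)) k l : rem_box mu al ->
  p * kern al k l = kern mu k l + (p - 1) *
    (fps_coef (Hq mu * geo (y / s)) k * fps_coef (Hq (transpose mu) * geo (y^-1 / s)) l).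
Proof.
move=> add_mu; have y_neq0 : y != 0 by rewrite expfz_neq0 ?qhalf_neq0.
have [_ ab aV bV] := ys_ratio qhalf_neq0 y_neq0.
have ys_neq0 : y * s != 0 by rewrite mulf_neq0 ?qhalf_neq0.
have yVs_neq0 : y / s != 0 by rewrite mulf_neq0 ?sV_neq0.
have := ck_update (Hq mu * geo (y / s)) (Hq (transpose mu) * geo (y^-1 / s)) k l
  yVs_neq0 ys_neq0.
rewrite ab aV bV !lin_mul_geo -(mul_lin_geo (esym (Hq_add_box add_mu))).
by rewrite -(mul_lin_geo (esym (Hq_add_box_transpose add_mu))).
Qed.

Let det_update (c d : K) (nu' : intpart) (r l : nat -> K) :
    (forall i j, c * kern nu' i j = kern mu i j + d * (r i * l j)) ->
  c ^+ n * Z n nu' la nu =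
    Z n mu la nu + d * trdet M (\matrix_(i, j) (r (beta n la i) * l (beta n nu j))).
Proof.
move=> upd; rewrite -trdetZ.
have -> : c ^+ n = \prod_(i < n) c by rewrite prodr_const card_ord.
rewrite -(det_scale_rows _ (fun=> c)) -[Z n mu la nu]/(\det M).
have -> : d *: \matrix_(i, j) (r (beta n la i) * l (beta n nu j)) =
    \matrix_(i < n, j < n) ((d * r (beta n la i)) * l (beta n nu j)).
  by apply/matrixP => i j; rewrite !mxE mulrA.
rewrite -det_rank1; congr (\det _); apply/matrixP => i j; rewrite !mxE upd.
by rewrite mulrA.
Qed.

Let sum_update (I : eqType) (c : seq I) (w : I -> K) (r l : I -> nat -> K) :
  \sum_(x <- c) w x * trdet M (\matrix_(i, j) (r x (beta n la i) * l x (beta n nu j))) =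
  trdet M (\matrix_(i, j) \sum_(x <- c) w x * (r x (beta n la i) * l x (beta n nu j))).
Proof.
under eq_bigr => x _ do rewrite -trdetZ.
rewrite -trdet_sum; apply: eq_trdet => i j; rewrite summxE !mxE.
by apply: eq_bigr => x _; rewrite !mxE.
Qed.

Fact R21_final (F : fieldType) (x Qn Zm G S B d T : F) : x - x^-1 != 0 ->
  (x - x^-1) * S = G -> d * Qn = x * T + (x - x^-1)^-1 ->
  S * Zm + (x * G * T * Zm + Qn * G * B) = Qn * (d * G * Zm + G * B).
Proof.
move=> z_neq0 SE dE.
have -> : S = (x - x^-1)^-1 * G by rewrite -SE mulKf.
have -> : Qn * (d * G * Zm + G * B) = (d * Qn) * G * Zm + Qn * G * B by ring.
by rewrite dE; ring.
Qed.

Lemma sum_g_add : z * \sum_(ga <- addseq mu) g ga = g mu.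
Proof.
have := sum_add_geo mu 0; rewrite expr0 Hq0 mul1r mulr1 => <-; congr (_ * _).
by apply: eq_bigr => ga _; rewrite fps_coef_geo addr0 Hq0 mulr1.
Qed.

Let sum_add_l k : z * \sum_(ga <- addseq mu) g ga / s ^ (kappa ga - kappa mu) *
    fps_coef (Hq (transpose mu) * geo ((s ^ (kappa ga - kappa mu))^-1 * s)) k =
  g mu * (q ^+ k * fps_coef (Hq (transpose mu)) k).
Proof.
have := sum_add_geo (transpose mu) k; rewrite addseq_transpose g_transpose.
set E := s ^ (- kappa mu) => eq_t; have E_neq0 : E != 0 by rewrite expfz_neq0 ?qhalf_neq0.
have wE ga : E * (g ga / s ^ (kappa ga - kappa mu)) = g (transpose ga).
  rewrite g_transpose mulrCA mulrC; congr (_ * _).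
  by rewrite invr_expz /E -expfzDr ?qhalf_neq0 //; congr (_ ^ _); lia.
apply: (mulfI E_neq0); rewrite [RHS]mulrA -eq_t mulrCA mulr_sumr; congr (_ * _).
by apply: eq_bigr => ga _; rewrite mulrA wE !kappa_transpose -opprD -invr_expz.
Qed.

(** Each term on the left is Z for mu plus a rank one correction.  By [add_kernel] the
    corrections add up to the matrix [M] scaled by rows, which produces D la, and the
    matrix with shifted and scaled columns, which produces the boxes removed from nu. *)
Lemma Z_R21 :
  \sum_(ga <- addseq mu) g ga * Z n ga la nu =
    D la * g mu * Z n mu la nu
    + g mu * \sum_(be <- remseq nu) s ^ (kappa nu - kappa be) * Z n mu la be.
Proof.
apply: (mulfI (qX_neq0 n)).
pose y ga := s ^ (kappa ga - kappa mu).
pose r ga := Hq mu * geo (y ga * s).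
pose l ga := Hq (transpose mu) * geo ((y ga)^-1 * s).
pose NM : 'M[K]_n := \matrix_(i, j) \sum_(ga <- addseq mu)
  g ga * (fps_coef (r ga) (beta n la i) * fps_coef (l ga) (beta n nu j)).
transitivity ((\sum_(ga <- addseq mu) g ga) * Z n mu la nu + (q - 1) * trdet M NM).
  rewrite mulr_sumr mulr_suml /NM -(sum_update _ g (fun x => fps_coef (r x)) (fun x => fps_coef (l x))).
  rewrite mulr_sumr -big_split; apply: eq_big_seq => ga /mem_addseq add_ga /=.
  rewrite mulrCA (det_update (fun i j => kern_add i j add_ga)) mulrDr; congr (_ + _).
  exact: mulrCA.
rewrite -trdetZ.
have y_neq0 ga : y ga != 0 by rewrite expfz_neq0 ?qhalf_neq0.
have addK := add_kernel qhalf_neq0 y_neq0 (fun ga => lin_mul_geo (Hq mu) (y ga * s))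
  (fun ga => lin_mul_geo (Hq (transpose mu)) ((y ga)^-1 * s)) (sum_add_geo mu) sum_add_l.
have -> : trdet M ((q - 1) *: NM) =
    (s * g mu) * trdet M (\matrix_(i, j) (q ^+ beta n la i * M i j)) +
    g mu * trdet M (\matrix_(i, j) (q ^+ beta n nu j *
       prev (kern mu (beta n la i)) (beta n nu j))).
  rewrite -!trdetZ -trdetD; apply: eq_trdet => i j; rewrite !mxE.
  have -> : q - 1 = s * z by rewrite mulrBr mulfV ?qhalf_neq0 // expr2.
  rewrite -mulrA addK mulrCA mulrDr -!mulrA mulrDr; congr (_ + _).
    by rewrite mulrCA.
  by rewrite mulVKf ?qhalf_neq0.
rewrite (trdet_diagl M (fun i => q ^+ beta n la i)).
rewrite -(sum_col_repl M (fun j => q ^+ beta n nu j)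
  (fun j i => prev (kern mu (beta n la i)) (beta n nu j))).
have -> : \sum_(j < n) q ^+ beta n nu j *
    \det (col_repl M (fun i => prev (kern mu (beta n la i)) (beta n nu j)) j) =
    q ^+ n * \sum_(be <- remseq nu) s ^ (kappa nu - kappa be) * Z n mu la be.
  rewrite -(sum_col_rem (fun c => s ^ c)) mulr_sumr; apply: eq_bigr => j _.
  by rewrite mulrA [q ^+ n * _]mulrC content_beta_rem.
rewrite [g mu * (q ^+ n * _)]mulrCA [q ^+ n * (g mu * _)]mulrA [s * g mu * _]mulrA.
apply: R21_final (D_beta (leqW le_la)).
  exact: z_neq0.
exact: sum_g_add.
Qed.

Let sum_rem_l k : z * \sum_(al <- remseq mu) g al * s ^ (kappa mu - kappa al) *
    fps_coef (Hq (transpose mu) * geo ((s ^ (kappa mu - kappa al))^-1 / s)) k =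
  (g mu + z * \sum_(al <- remseq mu) g al * s ^ (kappa mu - kappa al)) *
    fps_coef (Hq (transpose mu)) k
  - g mu * (s^-1 * prev (fps_coef (Hq (transpose mu))) k
            + q ^- k * fps_coef (Hq (transpose mu)) k).
Proof.
have := sum_rem_geo (transpose mu) k; rewrite !remseq_transpose g_transpose.
set E := s ^ (- kappa mu) => eq_t; have E_neq0 : E != 0 by rewrite expfz_neq0 ?qhalf_neq0.
have wE al : E * (g al * s ^ (kappa mu - kappa al)) = g (transpose al).
  rewrite g_transpose mulrCA mulrC; congr (_ * _).
  by rewrite /E -expfzDr ?qhalf_neq0 //; congr (_ ^ _); lia.
apply: (mulfI E_neq0); rewrite [E * (_ - _)]mulrBr [E * (_ * fps_coef _ k)]mulrA.
rewrite [E * (g mu + _)]mulrDr [E * (g mu * _)]mulrA.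
have -> : E * (z * \sum_(al <- remseq mu) g al * s ^ (kappa mu - kappa al)) =
    z * \sum_(al <- remseq mu) g (transpose al).
  by rewrite mulrCA mulr_sumr; under eq_bigr => al _ do rewrite wE.
rewrite -eq_t mulrCA mulr_sumr; congr (_ * _).
by apply: eq_bigr => al _; rewrite mulrA wE !kappa_transpose -opprD -invr_expz.
Qed.

Fact R12_final (F : fieldType) (x Pn Zm G S B d e T : F) :
    S = (e - (x - x^-1)^-1) * G -> d * Pn = (x - x^-1)^-1 - x^-1 * T ->
  S * Zm + (x^-1 * G * T * Zm + Pn * G * B - G * (e * Zm)) = Pn * (G * B - d * G * Zm).
Proof.
move=> -> dE; have -> : Pn * (G * B - d * G * Zm) = Pn * G * B - d * Pn * G * Zm by ring.
by rewrite dE; ring.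
Qed.

Let content_beta_add j : (j < n)%N ->
  s ^ (- (2 * ((part nu j)%:Z - j%:Z))) * p ^+ n = p ^+ (beta n nu j).+1.
Proof.
move=> lt_j; rewrite -!exprM !(exprVn s) !exprnN.
rewrite -expfzDr ?qhalf_neq0 //; congr (_ ^ _).
by rewrite /beta; lia.
Qed.

(** As for [Z_R21], with [remove_kernel]: the scaled rows produce D for the transpose
    of la, the shifted columns produce the boxes added to nu, and the remaining rank one
    matrix cancels against the sum of the g over the removed boxes ([sum_remseq]), up to
    the constant in [DT_beta]. *)
Lemma Z_R12 :
  \sum_(al <- remseq mu) g al * Z n al la nu =
    g mu * \sum_(ga <- addseq nu) s ^ (- (kappa ga - kappa nu)) * Z n mu la ga
    - D (transpose la) * g mu * Z n mu la nu.
Proof.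
apply: (mulfI (pX_neq0 n)).
pose y al := s ^ (kappa mu - kappa al).
pose r al := Hq mu * geo (y al / s).
pose l al := Hq (transpose mu) * geo ((y al)^-1 / s).
pose NM : 'M[K]_n := \matrix_(i, j) \sum_(al <- remseq mu)
  g al * (fps_coef (r al) (beta n la i) * fps_coef (l al) (beta n nu j)).
transitivity ((\sum_(al <- remseq mu) g al) * Z n mu la nu + (p - 1) * trdet M NM).
  rewrite mulr_sumr mulr_suml /NM -(sum_update _ g (fun x => fps_coef (r x)) (fun x => fps_coef (l x))).
  rewrite mulr_sumr -big_split; apply: eq_big_seq => al /mem_remseq rem_al /=.
  rewrite mulrCA (det_update (fun i j => kern_rem i j rem_al)) mulrDr; congr (_ + _).
  exact: mulrCA.
rewrite -trdetZ.
have y_neq0 al : y al != 0 by rewrite expfz_neq0 ?qhalf_neq0.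
have remK := remove_kernel qhalf_neq0 y_neq0 (fun al => lin_mul_geo (Hq mu) (y al / s))
  (fun al => lin_mul_geo (Hq (transpose mu)) ((y al)^-1 / s))
  (sum_rem_geo mu) sum_rem_l.
have -> : trdet M ((p - 1) *: NM) =
    (s^-1 * g mu) * trdet M (\matrix_(i, j) (p ^+ beta n la i * M i j)) +
    g mu * trdet M (\matrix_(i, j) (p ^+ (beta n nu j).+1 *
       kern mu (beta n la i) (beta n nu j).+1)) +
    (- g mu) * trdet M (\matrix_(i, j) (fps_coef (Hq mu) (beta n la i)
      * fps_coef (Hq (transpose mu)) (beta n nu j).+1)).
  rewrite -!trdetZ -!trdetD; apply: eq_trdet => i j; rewrite !mxE.
  have -> : p - 1 = - (z / s) by rewrite mulrBl mulfV ?qhalf_neq0 // opprB expr2.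
  rewrite !(expVX2 s) [q ^+ _.+1]exprS.
  apply: remove_entry (remK _ _).
rewrite (trdet_diagl M (fun i => p ^+ beta n la i)).
rewrite -(sum_col_repl M (fun j => p ^+ (beta n nu j).+1)
  (fun j i => kern mu (beta n la i) (beta n nu j).+1)).
have -> : \sum_(j < n) p ^+ (beta n nu j).+1 *
    \det (col_repl M (fun i => kern mu (beta n la i) (beta n nu j).+1) j) =
    p ^+ n * \sum_(ga <- addseq nu) s ^ (- (kappa ga - kappa nu)) * Z n mu la ga.
  rewrite -(sum_col_add (fun c => s ^ (- c))) mulr_sumr; apply: eq_bigr => j _.
  by rewrite mulrA [p ^+ n * _]mulrC content_beta_add.
rewrite trdet_last_col beta_last -/(D _).
rewrite [g mu * (p ^+ n * _)]mulrCA [p ^+ n * (g mu * _)]mulrA [s^-1 * g mu * _]mulrA mulNr.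
apply: R12_final (DT_beta (leqW le_la)).
exact: sum_remseq.
Qed.

End Minors.

End VertexDeterminant.

(** * The six relations for the vertex *)

Section VertexRelations.
Implicit Types la mu nu ga be : intpart.

Lemma ck_sym (F : fieldType) (f h : fps F) k l : ck f h k l = ck h f l k.
Proof. by rewrite /ck minnC; apply: eq_bigr => e _; rewrite mulrC. Qed.

Lemma Z_transpose n mu la nu : Z n (transpose mu) nu la = Z n mu la nu.
Proof.
rewrite /Z -det_tr; congr (\det _); apply/matrixP => i j; rewrite !mxE.
by rewrite /kern transposeK ck_sym.
Qed.

Lemma schur_box mu : schur box_part (qrho mu) = D mu.
Proof.
rewrite /schur (@skew_schur_jt 1) // /slater det_mx11 mxE /monom beta_empty.
by rewrite fps_coef_shift.
Qed.

Lemma signed_vertexE n la1 la2 la3 :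
    (size la3 <= n)%N -> (size (transpose la1) <= n)%N ->
  signed_vertex la1 la2 la3 =
    (-1) ^+ (psize la1 + psize la2 + psize la3) *
    (s ^ (- kappa la3) * (g (transpose la2) * Z n (transpose la2) la3 (transpose la1))).
Proof.
move=> le_3 le_1; rewrite /signed_vertex /vertex !transposeK -(vertex_sum _ le_3 le_1).
congr (_ * _); rewrite transposeK mulrA; congr (_ * _).
rewrite !kappa_transpose g_transpose mulrA; congr (_ * _).
by rewrite -expfzDr ?qhalf_neq0 // addrC.
Qed.

Lemma size_add_box la ga n : add_box la ga -> (size la <= n)%N -> (size ga <= n.+1)%N.
Proof.
case/add_boxP=> i add_i -> le_n; apply: size_addrow (leqW le_n) _ => //.
by apply: addable_lt add_i.
Qed.

Lemma size_rem_box la be n : rem_box la be -> (size la <= n)%N -> (size be <= n)%N.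
Proof. by case/rem_boxP=> i rem_i -> le_n; apply: size_remrow. Qed.

Lemma signed_vertex_transpose la1 la2 la3 :
  signed_vertex la1 la2 la3 =
    s ^ (- (kappa la1 + kappa la2 + kappa la3)) *
    signed_vertex (transpose la3) (transpose la2) (transpose la1).
Proof.
pose n := maxn (size la3) (size (transpose la1)).
rewrite (@signed_vertexE n) ?leq_maxl ?leq_maxr //.
rewrite (@signed_vertexE n) ?transposeK ?leq_maxl ?leq_maxr //.
rewrite -(Z_transpose n (transpose la2)) transposeK g_transpose !psize_transpose kappa_transpose.
have -> : (psize la3 + psize la2 + psize la1 = psize la1 + psize la2 + psize la3)%N by lia.
rewrite [RHS]mulrCA; congr (_ * _); rewrite !mulrA; congr (_ * _ * _).
by rewrite -!expfzDr ?qhalf_neq0 //; congr (_ ^ _); lia.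
Qed.

Fact scale_difference (F : fieldType) (d e k w c a b : F) : d * c = b - a ->
  d * (e * (k * (w * c))) = - (e * (k * (w * a))) - - (e * (k * (w * b))).
Proof.
move=> dE; have -> : d * (e * (k * (w * c))) = e * k * w * (d * c) by ring.
by rewrite dE; ring.
Qed.

(** The three relations for [Z], with the powers of q restored by the changes of kappa
    and the minus signs by the changes of size. *)
Lemma signed_vertex_R13 : R13 signed_vertex.
Proof.
move=> la1 la2 la3; pose mu := transpose la2; pose nu := transpose la1.
pose N := maxn (size la3) (size nu); pose n := N.+1.
have le_3 : (size la3 <= N)%N := leq_maxl _ _.
have le_1 : (size nu <= N)%N := leq_maxr _ _.
pose E : K := (-1) ^+ (psize la1 + psize la2 + psize la3).
rewrite schur_box sum_rem_box sum_add_box (@signed_vertexE n) ?leqW //.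
have -> : \sum_(be <- remseq la3) s ^ (kappa be - kappa la3) * signed_vertex la1 la2 be =
    - (E * (s ^ (- kappa la3) * (g mu * \sum_(be <- remseq la3) Z n mu be nu))).
  rewrite !mulr_sumr -sumrN; apply: eq_big_seq => be /mem_remseq rem_be.
  rewrite (@signed_vertexE n) ?(leqW (size_rem_box rem_be le_3)) ?leqW //.
  rewrite /E (psize_add_box rem_be) addnS exprS mulN1r mulNr opprK mulrCA.
  congr (_ * _); rewrite mulrA -expfzDr ?qhalf_neq0 //; congr (s ^ _ * _); lia.
have -> : \sum_(ga <- addseq la1) signed_vertex ga la2 la3 =
    - (E * (s ^ (- kappa la3) * (g mu * \sum_(ga <- addseq nu) Z n mu la3 ga))).
  rewrite addseq_transpose !mulr_sumr -sumrN; apply: eq_big_seq => ga /mem_addseq add_ga.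
  rewrite (@signed_vertexE n) ?(size_add_box (add_box_transpose add_ga) le_1) ?leqW //.
  by rewrite (psize_add_box add_ga) !addSn exprS mulN1r mulNr.
apply: scale_difference; have := Z_R13 mu le_3 le_1; rewrite transposeK; exact.
Qed.

Lemma signed_vertex_R21 : R21 signed_vertex.
Proof.
move=> la1 la2 la3; pose mu := transpose la2; pose nu := transpose la1.
pose N := maxn (size la3) (size nu); pose n := N.+1.
have le_3 : (size la3 <= N)%N := leq_maxl _ _.
have le_1 : (size nu <= N)%N := leq_maxr _ _.
pose E : K := (-1) ^+ (psize la1 + psize la2 + psize la3).
rewrite schur_box sum_rem_box sum_add_box (@signed_vertexE n) ?leqW //.
have -> : \sum_(be <- remseq la1) s ^ (kappa be - kappa la1) * signed_vertex be la2 la3 =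
    - (E * (s ^ (- kappa la3) * (1 * (g mu *
      \sum_(be <- remseq nu) s ^ (kappa nu - kappa be) * Z n mu la3 be)))).
  rewrite mul1r remseq_transpose !mulr_sumr -sumrN.
  apply: eq_big_seq => be /mem_remseq rem_be.
  rewrite (@signed_vertexE n) ?leqW ?(size_rem_box (add_box_transpose rem_be)) //.
  rewrite /E (psize_add_box rem_be) !addSn exprS mulN1r mulNr opprK mulrCA.
  congr (_ * _); rewrite mulrCA; congr (_ * _); rewrite mulrCA; congr (_ * _).
  by rewrite !kappa_transpose opprK addrC.
have -> : \sum_(ga <- addseq la2) signed_vertex la1 ga la3 =
    - (E * (s ^ (- kappa la3) * (1 * \sum_(ga <- addseq mu) g ga * Z n ga la3 nu))).
  rewrite mul1r addseq_transpose !mulr_sumr -sumrN.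
  apply: eq_big_seq => ga /mem_addseq add_ga.
  rewrite (@signed_vertexE n) ?leqW //.
  by rewrite (psize_add_box add_ga) addnS addSn exprS mulN1r mulNr.
rewrite -[g mu * Z _ _ _ _]mul1r; apply: scale_difference.
by rewrite (Z_R21 mu le_3 le_1) addrK mulrA.
Qed.

Lemma signed_vertex_R12 : R12 signed_vertex.
Proof.
move=> la1 la2 la3; pose mu := transpose la2; pose nu := transpose la1.
pose N := maxn (size la3) (size nu); pose n := N.+1.
have le_3 : (size la3 <= N)%N := leq_maxl _ _.
have le_1 : (size nu <= N)%N := leq_maxr _ _.
pose E : K := (-1) ^+ (psize la1 + psize la2 + psize la3).
rewrite schur_box sum_rem_box sum_add_box (@signed_vertexE n) ?leqW //.
have -> : \sum_(al <- remseq la2) signed_vertex la1 al la3 =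
    - (E * (s ^ (- kappa la3) * (1 * \sum_(al <- remseq mu) g al * Z n al la3 nu))).
  rewrite mul1r remseq_transpose !mulr_sumr -sumrN.
  apply: eq_big_seq => al /mem_remseq rem_al.
  rewrite (@signed_vertexE n) ?leqW //.
  by rewrite /E (psize_add_box rem_al) addnS addSn exprS mulN1r mulNr opprK.
have -> : \sum_(ga <- addseq la1) s ^ (kappa ga - kappa la1) * signed_vertex ga la2 la3 =
    - (E * (s ^ (- kappa la3) * (1 * (g mu *
      \sum_(ga <- addseq nu) s ^ (- (kappa ga - kappa nu)) * Z n mu la3 ga)))).
  rewrite mul1r addseq_transpose !mulr_sumr -sumrN.
  apply: eq_big_seq => ga /mem_addseq add_ga.
  rewrite (@signed_vertexE n) ?(size_add_box (add_box_transpose add_ga) le_1) ?leqW //.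
  rewrite /E (psize_add_box add_ga) !addSn exprS mulN1r mulNr mulrN mulrCA; congr (- (_ * _)).
  rewrite mulrCA; congr (_ * _); rewrite mulrCA; congr (_ * _).
  by rewrite !kappa_transpose -opprD opprK.
rewrite -[g mu * Z _ _ _ _]mul1r; apply: scale_difference.
by rewrite (Z_R12 mu le_3 le_1) subKr mulrA.
Qed.

(** Transposing and reversing the triple exchanges the relations in pairs. *)
Section Symmetry.
Variable T : intpart -> intpart -> intpart -> K.
Hypothesis T_transpose : forall la1 la2 la3,
  T la1 la2 la3 = s ^ (- (kappa la1 + kappa la2 + kappa la3)) *
    T (transpose la3) (transpose la2) (transpose la1).

Lemma R13_R31 : R13 T -> R31 T.
Proof.
move=> RT la1 la2 la3; have := RT (transpose la3) (transpose la2) (transpose la1).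
rewrite !sum_rem_box !sum_add_box remseq_transpose addseq_transpose => eqT.
rewrite T_transpose mulrCA eqT mulrBr !mulr_sumr; congr (_ - _).
  apply: eq_bigr => al _; rewrite [in RHS]T_transpose !mulrA -?expfzDr ?qhalf_neq0 //.
  by congr (s ^ _ * _); rewrite !kappa_transpose; lia.
apply: eq_bigr => ga _; rewrite [in RHS]T_transpose !mulrA -?expfzDr ?qhalf_neq0 //.
by congr (s ^ _ * _); lia.
Qed.

Lemma R21_R23 : R21 T -> R23 T.
Proof.
move=> RT la1 la2 la3; have := RT (transpose la3) (transpose la2) (transpose la1).
rewrite !sum_rem_box !sum_add_box remseq_transpose addseq_transpose => eqT.
rewrite T_transpose mulrCA eqT mulrBr !mulr_sumr; congr (_ - _).
  apply: eq_bigr => al _; rewrite [in RHS]T_transpose !mulrA -?expfzDr ?qhalf_neq0 //.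
  by congr (s ^ _ * _); rewrite !kappa_transpose; lia.
apply: eq_bigr => ga _; rewrite [in RHS]T_transpose !mulrA -?expfzDr ?qhalf_neq0 //.
by congr (s ^ _ * _); lia.
Qed.

Lemma R12_R32 : R12 T -> R32 T.
Proof.
move=> RT la1 la2 la3; have := RT (transpose la3) (transpose la2) (transpose la1).
rewrite transposeK !sum_rem_box !sum_add_box remseq_transpose addseq_transpose => eqT.
rewrite T_transpose mulrCA eqT mulrBr !mulr_sumr; congr (_ - _).
  apply: eq_bigr => be _; rewrite [in RHS]T_transpose !mulrA -?expfzDr ?qhalf_neq0 //.
  by congr (s ^ _ * _); lia.
apply: eq_bigr => ga _; rewrite [in RHS]T_transpose !mulrA -?expfzDr ?qhalf_neq0 //.
by congr (s ^ _ * _); rewrite !kappa_transpose; lia.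
Qed.

End Symmetry.

Lemma signed_vertex_system : vertex_system signed_vertex.
Proof.
have sym := signed_vertex_transpose; split; split.
- exact: R12_R32 signed_vertex_R12.
- exact: signed_vertex_R13.
- exact: signed_vertex_R21.
- exact: R13_R31 signed_vertex_R13.
- exact: signed_vertex_R12.
- exact: R21_R23 signed_vertex_R21.
Qed.

Lemma signed_vertex_empty : signed_vertex empty_part empty_part empty_part = 1.
Proof.
rewrite (@signed_vertexE 0) ?transpose_empty // g_empty /Z det_mx00 !mulr1.
by rewrite /kappa /boxes /= big_nil mulr0 oppr0 expr0z expr0 mulr1.
Qed.

End VertexRelations.

(** * Uniqueness *)

Section Uniqueness.
Implicit Types la mu nu ga be : intpart.

(** Testing against the polynomial that vanishes at all the [d y] but [d x] isolates
    [u x], as in the inversion of a Vandermonde matrix. *)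
Lemma moments_eq0 (F : fieldType) (I : eqType) (c : seq I) (d u : I -> F) :
    uniq c -> injective d -> (forall k, \sum_(x <- c) d x ^+ k * u x = 0) ->
  forall x, x \in c -> u x = 0.
Proof.
move=> c_uniq d_inj mom x x_c.
have mom_poly (P : {poly F}) : \sum_(y <- c) P.[d y] * u y = 0.
  under eq_bigr => y _ do rewrite horner_coef mulr_suml.
  rewrite exchange_big big1 //= => i _.
  under eq_bigr => y _ do rewrite -mulrA.
  by rewrite -mulr_sumr mom mulr0.
have := mom_poly (\prod_(y <- rem x c) ('X - (d y)%:P)).
rewrite (big_rem x) //= [X in _ + X]big_seq [X in _ + X]big1 => [|y y_c].
  rewrite addr0 => /eqP; rewrite mulf_eq0 => /orP[|/eqP //].
  rewrite horner_prod prodf_seq_eq0 => /hasP[y]; rewrite mem_rem_uniq // inE => /andP[ne_y _].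
  by rewrite hornerXsubC subr_eq0 (inj_eq d_inj) eq_sym (negPf ne_y).
by rewrite horner_prod (big_rem y) //= hornerXsubC subrr !mul0r.
Qed.

Section Homogeneous.
Variable U : intpart -> intpart -> intpart -> K.
Hypotheses (U32 : R32 U) (U13 : R13 U) (U21 : R21 U) (U23 : R23 U).
Hypothesis U0 : U empty_part empty_part empty_part = 0.

Lemma remseq_empty : remseq empty_part = [::].
Proof. by []. Qed.

Lemma kappa_add_empty ga : add_box empty_part ga -> kappa ga = kappa empty_part.
Proof.
case/add_boxP=> i add_i ->; rewrite kappa_addrow //.
have -> : i = 0%N by move: add_i; rewrite /addable !part_default //; case: i.
by rewrite part_default // subrr mulr0 addr0.
Qed.

Lemma rem_box_exists la : la != empty_part -> exists be, rem_box la be.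
Proof.
elim/intpart_ind: la => [|la ga add_ga _ _]; first by rewrite eqxx.
by exists la.
Qed.

(** The box added to the empty partition has content 0, so that the last sums in [R21]
    and [R23] are equal; and D la3 differs from D for the transpose of la1. *)
Lemma U_diff la1 la3 :
    (forall mu1 mu3, (psize mu1 + psize mu3 < psize la1 + psize la3)%N ->
      U mu1 empty_part mu3 = 0) ->
  la3 != transpose la1 -> U la1 empty_part la3 = 0.
Proof.
move=> IH ne_la; have := U21 la1 empty_part la3; have := U23 la1 empty_part la3.
rewrite !schur_box !sum_rem_box !sum_add_box.
rewrite [X in _ = X - _ -> _]big_seq [X in _ = X - _ -> _]big1 => [|al /mem_remseq rem_al].
  2: by rewrite IH // (psize_add_box rem_al) addnS.
rewrite [X in _ -> _ = X - _ -> _]big_seq [X in _ -> _ = X - _ -> _]big1 => [|al /mem_remseq rem_al].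
  2: by rewrite IH ?mulr0 // (psize_add_box rem_al) addSn.
rewrite [X in _ = _ - X -> _](eq_big_seq (fun ga => U la1 ga la3)) => [|ga /mem_addseq add_ga].
  2: by rewrite kappa_add_empty // subrr expr0z mul1r.
move=> <- /eqP; rewrite -subr_eq0 -mulrBl mulf_eq0 subr_eq0 (inj_eq D_inj).
by rewrite (negPf ne_la) => /eqP.
Qed.

(** When la3 is the transpose of la1, remove a box from la3 and apply [R32]: on the
    right, every partition but la3 is covered by [U_diff]. *)
Lemma U_empty la1 la3 : U la1 empty_part la3 = 0.
Proof.
have [n] := ubnP (psize la1 + psize la3); elim: n la1 la3 => // n IH la1 la3 lt_n.
have IH' m1 m3 (le_m : (psize m1 + psize m3 <= psize la1 + psize la3)%N) mu1 mu3 :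
  (psize mu1 + psize mu3 < psize m1 + psize m3)%N -> U mu1 empty_part mu3 = 0.
  by move=> lt_mu; apply: IH; apply: leq_trans lt_mu _; apply: leq_trans le_m _.
have [eq_la|ne_la] := eqVneq la3 (transpose la1); last first.
  by apply: U_diff ne_la => mu1 mu3; apply: IH'.
have [la30|/rem_box_exists[be rem_be]] := eqVneq la3 empty_part.
  move: eq_la; rewrite la30 => /(congr1 transpose); rewrite transposeK transpose_empty => <-.
  exact: U0.
have la3_be : la3 \in addseq be by apply/mem_addseq.
have := U32 la1 empty_part be; rewrite sum_rem_box sum_add_box remseq_empty big_nil.
rewrite IH ?mulr0; last first.
  by move: lt_n; rewrite (psize_add_box rem_be) addnS.
rewrite (bigD1_seq la3) ?uniq_addseq //= sub0r.
rewrite [X in - (_ + X)]big_seq_cond [X in - (_ + X)]big1 => [/esym/eqP|ga /andP[/mem_addseq add_ga ne_ga]].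
  by rewrite addr0 oppr_eq0 => /eqP.
have sz : psize ga = psize la3 by rewrite (psize_add_box add_ga) (psize_add_box rem_be).
by apply: U_diff; rewrite -?eq_la //; apply: IH'; rewrite sz.
Qed.

(** The relation [R13] at ga turns the factor D ga into a change of the first and
    third partitions, that is, into moments of lower order. *)
Lemma U_moments la : (forall la1 la3, U la1 la la3 = 0) ->
  forall k la1 la3, \sum_(ga <- addseq la) D ga ^+ k * U la1 ga la3 = 0.
Proof.
move=> Ula; elim=> [|k IHk] la1 la3.
  have := U21 la1 la la3; rewrite sum_rem_box sum_add_box Ula mulr0.
  rewrite [X in _ = X - _ -> _]big1 => [|be _]; last by rewrite Ula mulr0.
  rewrite sub0r => /esym/eqP; rewrite oppr_eq0 => /eqP eq0.
  by under eq_bigr => ga _ do rewrite expr0 mul1r.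
transitivity (\sum_(be <- remseq la3) s ^ (kappa be - kappa la3) *
      (\sum_(ga <- addseq la) D ga ^+ k * U la1 ga be)
    - \sum_(ga1 <- addseq la1) \sum_(ga <- addseq la) D ga ^+ k * U ga1 ga la3).
  under [X in _ = X - _]eq_bigr => be _ do rewrite mulr_sumr.
  rewrite exchange_big [X in _ = _ - X]exchange_big -sumrB; apply: eq_bigr => ga _ /=.
  have := U13 la1 ga la3; rewrite schur_box sum_rem_box sum_add_box => eqU.
  rewrite exprSr -mulrA eqU mulrBr !mulr_sumr; congr (_ - _).
  by apply: eq_bigr => be _; rewrite mulrCA.
rewrite big1 => [|be _]; last by rewrite IHk mulr0.
by rewrite big1 ?subr0 // => ga1 _; apply: IHk.
Qed.

Lemma U_eq0 la1 la2 la3 : U la1 la2 la3 = 0.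
Proof.
elim/intpart_ind: la2 la1 la3 => [|la ga add_ga IH] la1 la3; first exact: U_empty.
have mom k := U_moments IH k la1 la3.
by apply: (moments_eq0 (uniq_addseq la) D_inj mom); apply/mem_addseq.
Qed.

End Homogeneous.

Section Difference.
Variables T T' : intpart -> intpart -> intpart -> K.
Let U la1 la2 la3 := T la1 la2 la3 - T' la1 la2 la3.

Let sumB (c : seq intpart) (w F F' : intpart -> K) :
  \sum_(x <- c) w x * (F x - F' x) = \sum_(x <- c) w x * F x - \sum_(x <- c) w x * F' x.
Proof. by rewrite -sumrB; apply: eq_bigr => x _; rewrite mulrBr. Qed.

Fact diff_eq (F : fieldType) (d t t' a a' b b' : F) :
  d * t = a - b -> d * t' = a' - b' -> d * (t - t') = a - a' - (b - b').
Proof. by rewrite mulrBr => -> ->; ring. Qed.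

Lemma R32_diff : R32 T -> R32 T' -> R32 U.
Proof.
move=> RT RT' la1 la2 la3; have := diff_eq (RT la1 la2 la3) (RT' la1 la2 la3).
by rewrite !sum_rem_box !sum_add_box sumB sumrB.
Qed.

Lemma R13_diff : R13 T -> R13 T' -> R13 U.
Proof.
move=> RT RT' la1 la2 la3; have := diff_eq (RT la1 la2 la3) (RT' la1 la2 la3).
by rewrite !sum_rem_box !sum_add_box sumB sumrB.
Qed.

Lemma R21_diff : R21 T -> R21 T' -> R21 U.
Proof.
move=> RT RT' la1 la2 la3; have := diff_eq (RT la1 la2 la3) (RT' la1 la2 la3).
by rewrite !sum_rem_box !sum_add_box sumB sumrB.
Qed.

Lemma R23_diff : R23 T -> R23 T' -> R23 U.
Proof.
move=> RT RT' la1 la2 la3; have := diff_eq (RT la1 la2 la3) (RT' la1 la2 la3).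
by rewrite !sum_rem_box !sum_add_box sumB sumrB.
Qed.

Lemma vertex_system_unique : vertex_system T -> vertex_system T' ->
    T empty_part empty_part empty_part = T' empty_part empty_part empty_part ->
  forall la1 la2 la3, T la1 la2 la3 = T' la1 la2 la3.
Proof.
move=> [[T32 T13 T21] [_ _ T23]] [[T32' T13' T21'] [_ _ T23']] eq0 la1 la2 la3.
apply/eqP; rewrite -subr_eq0; apply/eqP; rewrite -/(U la1 la2 la3).
apply: U_eq0.
- exact: R32_diff T32 T32'.
- exact: R13_diff T13 T13'.
- exact: R21_diff T21 T21'.
- exact: R23_diff T23 T23'.
by rewrite /U eq0 subrr.
Qed.

End Difference.

End Uniqueness.

Theorem theorem1 :
  (vertex_system signed_vertex
   /\ signed_vertex empty_part empty_part empty_part = 1)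
  /\ (forall T : intpart -> intpart -> intpart -> K,
        vertex_system T -> T empty_part empty_part empty_part = 1 ->
        forall la1 la2 la3 : intpart,
          T la1 la2 la3 = signed_vertex la1 la2 la3).
Proof.
split; first by split; [exact: signed_vertex_system | exact: signed_vertex_empty].
move=> T sysT T1; apply: vertex_system_unique sysT signed_vertex_system _.
by rewrite T1 signed_vertex_empty.
Qed.
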